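(* For every $\mu\in\mathrm{Prob}([-R,R]^n)$ with marginals $\mu_1,\dots,\mu_n$, $$H(\mu)=-\mathcal{I}_\mathrm{sym}(\mu)+\sum_{i=1}^nH(\mu_i).$$ Moreover, if $H(\mu_i)>-\infty$ for all $i$, then $\mathcal{I}_\mathrm{sym}(\mu)=I_\mathrm{sym}(\mu)=S(\mu\,\|\,\mu_1\otimes\cdots\otimes\mu_n)$, and $\mathcal{I}_\mathrm{sym}(\mu)=0$ if and only if $\mu=\mu_1\otimes\cdots\otimes\mu_n$.
   Context: Fix $R>0$ and $n\in\mathbb{N}$. $\mathrm{Prob}([-R,R]^k)$ denotes Borel probability measures on $[-R,R]^k$; $C_\mathbb{R}([-R,R]^n)$ real continuous functions with sup-norm; $\mu(h)=\int h\,d\mu$; $\mu_i$ is the $i$th marginal of $\mu$. The Boltzmann–Gibbs entropy is $H(\mu)=-\int p\log p\,d\mathbf{x}$ if $\mu$ has Lebesgue density $p$, else $H(\mu)=-\infty$; $S(\cdot\,\|\,\cdot)$ is relative entropy (Kullback–Leibler divergence). For $\mathbf{x}\in\mathbb{R}^N$ let $\kappa_N(\mathbf{x})=\frac1N\sum_jx_j$, with products and powers of vectors coordinatewise. $[-R,R]_\le^N$ is the set of vectors in $[-R,R]^N$ with nondecreasing coordinates; $S_N$ acts by $\sigma(\mathbf{x})=(x_{\sigma^{-1}(1)},\dots,x_{\sigma^{-1}(N)})$; $\gamma_{S_N}$ is the uniform probability on $S_N$. An approximating sequence for $(\mu_1,\dots,\mu_n)$ is $\Xi(N)=(\xi_1(N),\dots,\xi_n(N))$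 with $\xi_i(N)\in[-R,R]_\le^N$ and $\kappa_N(\xi_i(N)^k)\to\int x^k\,d\mu_i$ for all $k$. $\Delta_R(\mu;N,m,\delta)$ is the set of $(\mathbf{x}_1,\dots,\mathbf{x}_n)\in([-R,R]^N)^n$ with $|\kappa_N(\mathbf{x}_{i_1}\cdots\mathbf{x}_{i_k})-\int x_{i_1}\cdots x_{i_k}\,d\mu|<\delta$ for all $i_1,\dots,i_k\in\{1,\dots,n\}$, $1\le k\le m$; $\Delta_\mathrm{sym}(\mu:\Xi(N);N,m,\delta)$ is the set of $(\sigma_1,\dots,\sigma_n)\in S_N^n$ with $(\sigma_1(\xi_1(N)),\dots,\sigma_n(\xi_n(N)))\in\Delta_R(\mu;N,m,\delta)$; and $I_\mathrm{sym}(\mu)=-\lim_{m\to\infty,\delta\searrow0}\limsup_{N\to\infty}\frac1N\log\gamma_{S_N}^{\otimes n}(\Delta_\mathrm{sym}(\mu:\Xi(N);N,m,\delta))$. For $h\in C_\mathbb{R}([-R,R]^n)$, $\kappa_N(h(\mathbf{x}_1,\dots,\mathbf{x}_n))=\frac1N\sum_{j=1}^Nh(x_{1j},\dots,x_{nj})$, the mutual pressure is $$P_\mathrm{sym}(h:\mu_1,\dots,\mu_n)=\limsup_{N\to\infty}\frac1N\log\Biggl[\frac1{(N!)^n}\sum_{\sigma_1,\dots,\sigma_n\in S_N}\exp\bigl(N\kappa_N(h(\sigma_1(\xi_1(N)),\dots,\sigma_n(\xi_n(N))))\bigr)\Biggr],$$ and $\mathcal{I}_\mathrm{sym}(\mu)=\sup\{\mu(h)-P_\mathrm{sym}(h:\mu_1,\dots,\mu_n):h\in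 C_\mathbb{R}([-R,R]^n)\}\in[0,\infty]$. These quantities are independent of the approximating sequence. *)

(* Defs.v *)
From HB Require Import structures.
From mathcomp Require Import all_boot all_order all_algebra all_fingroup.
From mathcomp Require Import all_classical all_reals all_analysis.
Unset Implicit Arguments. Unset Printing Implicit Defensive.
Import Order.TTheory GRing.Theory Num.Theory.
Local Open Scope classical_set_scope.
Local Open Scope ring_scope.

Section Defs.
Context {R : realType}.

Definition box (r : R) (n : nat) : set (n.-tuple R) :=
  [set x | forall i : 'I_n, -r <= tnth x i <= r].

Definition marg (n : nat) (mu : set (n.-tuple R) -> \bar R) (i : 'I_n)
  : set R -> \bar R := pushforward mu (fun x => tnth x i).

Fixpoint iint (ms : seq (set R -> \bar R)) (f : seq R -> \bar R) : \bar R :=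
  match ms with
  | [::] => f [::]
  | m :: ms' => (\int[m]_x iint ms' (fun t => f (x :: t)))%E
  end.

Definition iintT (n : nat) (ms : seq (set R -> \bar R))
  (g : n.-tuple R -> \bar R) : \bar R :=
  iint ms (fun s => g (insubd [tuple of nseq n 0] s)).

(* Integral against n-dimensional Lebesgue measure (Tonelli: iterated). *)
Definition lebT (n : nat) := @iintT n (nseq n (lebesgue_measure : set R -> \bar R)).
Definition leb1 (f : R -> \bar R) : \bar R := (\int[lebesgue_measure]_x f x)%E.
Definition prodmargT (n : nat) (mu : set (n.-tuple R) -> \bar R) :=
  @iintT n [seq marg n mu i | i <- enum 'I_n].

Definition has_density d (T : measurableType d) (J : (T -> \bar R) -> \bar R)
  (P : set T -> \bar R) (p : T -> R) : Prop :=
  [/\ measurable_fun setT p, (forall x, 0 <= p x) &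
      forall A, measurable A -> P A = J (fun x => (\1_A x * p x)%:E)].

Definition int_xlogx d (T : measurableType d) (J : (T -> \bar R) -> \bar R)
  (p : T -> R) : \bar R :=
  (J (fun x => (Num.max (p x * ln (p x)) 0)%:E)
   - J (fun x => (Num.max (- (p x * ln (p x))) 0)%:E))%E.

Definition entropy d (T : measurableType d) (J : (T -> \bar R) -> \bar R)
  (P : set T -> \bar R) : \bar R :=
  match pselect (exists p, has_density d T J P p) with
  | left h => (- int_xlogx d T J (projT1 (cid h)))%E
  | right _ => -oo%E
  end.

(* Relative entropy S(P || Q), Q given by its integral functional J *)
Definition relent d (T : measurableType d) (J : (T -> \bar R) -> \bar R)
  (P : set T -> \bar R) : \bar R :=
  match pselect (exists f, has_density d T J P f) with
  | left h => int_xlogx d T J (projT1 (cid h))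
  | right _ => +oo%E
  end.

Definition kappa (N : nat) (x : 'I_N -> R) : R := N%:R^-1 * \sum_(j < N) x j.

Definition approx_seq (r : R) (n : nat) (mu : {measure set (n.-tuple R) -> \bar R})
  (Xi : forall N : nat, 'I_n -> 'I_N -> R) : Prop :=
  [/\ (forall N i j, -r <= Xi N i j <= r),
      (forall N i (j k : 'I_N), (j <= k)%N -> Xi N i j <= Xi N i k) &
      (forall (i : 'I_n) (k : nat),
         (fun N => (kappa N (fun j => Xi N i j ^+ k))%:E) @ \oo -->
           (\int[marg n mu i]_x (x ^+ k)%:E)%E)].

Definition cont_box (r : R) (n : nat) (h : n.-tuple R -> R) : Prop :=
  forall x, box r n x -> forall e : R, 0 < e ->
    exists2 dl : R, 0 < dl & forall y, box r n y ->
      (forall i, `|tnth x i - tnth y i| < dl) -> `|h x - h y| < e.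

Definition psym_term (n : nat) (Xi : forall N : nat, 'I_n -> 'I_N -> R)
  (h : n.-tuple R -> R) (N : nat) : R :=
  N%:R^-1 * ln (((N`!)%:R ^+ n)^-1 *
    \sum_(s : {ffun 'I_n -> 'S_N})
       expR (\sum_(j < N) h (mktuple (fun i => Xi N i (((s i)^-1)%g j))))).

Definition Psym (n : nat) (Xi : forall N : nat, 'I_n -> 'I_N -> R)
  (h : n.-tuple R -> R) : \bar R :=
  limn_esup (fun N => (psym_term n Xi h N)%:E).

Definition calIsym (r : R) (n : nat) (mu : {measure set (n.-tuple R) -> \bar R})
  (Xi : forall N : nat, 'I_n -> 'I_N -> R) : \bar R :=
  ereal_sup [set (\int[mu]_(x in box r n) (h x)%:E - Psym n Xi h)%E
            | h in [set h | cont_box r n h]].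

Definition Delta_sym (n : nat) (mu : {measure set (n.-tuple R) -> \bar R})
  (Xi : forall N : nat, 'I_n -> 'I_N -> R) (N m : nat) (dl : R)
  : {set {ffun 'I_n -> 'S_N}} :=
  [set s : {ffun 'I_n -> 'S_N} | `[< forall (k : nat) (w : 'I_k -> 'I_n), (1 <= k <= m)%N ->
     `| kappa N (fun j => \prod_(l < k) Xi N (w l) (((s (w l))^-1)%g j))
        - Rintegral mu setT (fun x => \prod_(l < k) tnth x (w l)) | < dl >]].

Definition gamma_Delta (n : nat) (mu : {measure set (n.-tuple R) -> \bar R})
  (Xi : forall N : nat, 'I_n -> 'I_N -> R) (N m : nat) (dl : R) : R :=
  #|Delta_sym n mu Xi N m dl|%:R / ((N`!)%:R ^+ n).

(* I_sym(mu) = - lim_{m->oo, dl->0} limsup_N (1/N) log gamma(...);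
   the inner limsup is monotone in (m, dl), so the limit is the infimum. *)
Definition Isym (n : nat) (mu : {measure set (n.-tuple R) -> \bar R})
  (Xi : forall N : nat, 'I_n -> 'I_N -> R) : \bar R :=
  (- ereal_inf [set limn_esup (fun N => (N%:R^-1)%:E * lne (gamma_Delta n mu Xi N md.1 md.2)%:E)
               | md in [set md : nat * R | (0 < md.2)%R]])%E.

End Defs.

(* Main.v *)
(* Both [calIsym] and [Isym] equal the relative entropy S of mu with respect to the product Q of its
   marginals, whatever the entropies of the marginals; the entropy formula then is the chain rule
   ln (dmu/dx) = ln (dmu/dQ) + sum_i ln (dmu_i/dx_i).

   Lower bounds for the partition functions come from the method of types. Cut [-r, r] into small
   intervals whose end points are atoms of no marginal. Counting the permutation tuples whose joint
   cell frequencies are a given contingency table with nearly the masses of mu shows that a fraction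
   of at least exp (- N (D + o(1))) of them is typical, where D <= S is the relative entropy of the
   discretized law. On typical tuples every kappa_N h is close to mu h, hence I <= S and
   mu h - P(h) <= S.

   For the converse, conditioning an i.i.d. sample of Q-cells on its marginal types costs only a
   polynomial factor, so P(h) <= ln (int exp h dQ). Weierstrass (h is uniformly close to a polynomial
   in the moments constrained by Delta_sym) and Markov's inequality bound Delta_sym in the same way,
   so that both quantities dominate mu h - ln (int exp h dQ) for every h in a class of test functions
   large enough for the Donsker-Varadhan formula to give S as the supremum. *)

Require Import Defs.
From HB Require Import structures.
From mathcomp Require Import all_boot all_order all_algebra all_fingroup.
From mathcomp Require Import all_classical all_reals all_analysis.
From mathcomp Require Import measurable_realfun.
From mathcomp Require Import zify ring lra.
Import Order.TTheory GRing.Theory Num.Theory.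
Import numFieldNormedType.Exports.

(** Convergent moments give only weak convergence, so a cell frequency need not converge unless the
    boundary of the cell has no mass; this is why the cut points avoid atoms. The tables that are
    counted must have exactly the marginal counts of the sample, which are not N times the masses of
    the marginals: the masses of [mu] are shrunk slightly, rounded down, and the remaining columns
    are filled greedily. The test functions are the uniform limits of polynomials in the coordinates
    clamped to [-r, r]. They are continuous on the box, hence admissible for [calIsym], and are
    governed by finitely many moments up to a small error, hence usable for [Isym]. They form a
    lattice, so they approximate indicators in L1 of [mu] and of Q at once. Clamping makes them
    bounded on the whole space, so their integrals are real numbers. Infinite values remain in the
    entropies (S may be +oo, a marginal entropy -oo), so the chain rule works with functions whose
    negative part is integrable, where sums never meet oo - oo. *)

(** A permutation of N+1 points is the image of [ord0] together with a permutation of the rest. This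
    drives the induction on N for sums over permutations. *)
Lemma big_perm_lift (T : Type) (idx : T) (op : Monoid.com_law idx) (N : nat)
    (F : 'S_N.+1 -> T) :
  \big[op/idx]_s F s
  = \big[op/idx]_(i < N.+1) \big[op/idx]_(t : 'S_N) F (lift_perm ord0 i t).
Proof.
pose f (u : 'I_N.+1 * 'S_N) := lift_perm ord0 u.1 u.2.
have f_inj : injective f.
  move=> [i t] [i' t'] E; have Ei : i = i'.
    by have /permP/(_ ord0) := E; rewrite !lift_perm_id.
  move: E; rewrite -Ei => /permP E; congr (_, _); apply/permP => k.
  by have := E (lift ord0 k); rewrite !lift_perm_lift => /lift_inj.
have f_bij : bijective f.
  by apply: inj_card_bij => //; rewrite card_prod !card_Sn card_ord factS.
by rewrite (reindex f) ?pair_bigA//=; exact: onW_bij.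
Qed.

(** * Counting permutations by type *)

Section TypeCount.
Variable C : finType.

Definition cnt (N : nat) (c : 'I_N -> C) (k : C) : nat := \sum_(j < N) (c j == k).

Definition same_type (N : nat) (c y : 'I_N -> C) : bool :=
  [forall k, cnt N c k == cnt N y k].

Lemma cnt_lift (N : nat) (c : 'I_N.+1 -> C) (i : 'I_N.+1) (k : C) :
  cnt N.+1 c k = (c i == k) + cnt N (c \o lift i) k.
Proof. by rewrite /cnt (bigD1_ord i). Qed.

(** Induction on N through the image [i] of [ord0]: it must carry the colour [y ord0], and removing
    one point of that colour on both sides preserves equality of types. *)
Lemma card_perm_fiber (N : nat) (c y : 'I_N -> C) :
  \sum_(s : 'S_N) [forall j, c (s j) == y j]
  = if same_type N c y then \prod_k (cnt N c k)`! else 0.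
Proof.
elim: N c y => [|N IH] c y.
  have -> : same_type 0 c y.
    by apply/forallP => k; rewrite /cnt !big_ord0.
  transitivity (\sum_(s : 'S_0) 1).
    by apply: eq_bigr => s _; rewrite (_ : [forall j, _] = true)//; apply/forallP; case.
  rewrite sum1_card card_Sn fact0 big1// => k _.
  by rewrite /cnt big_ord0.
rewrite big_perm_lift.
transitivity (\sum_(i < N.+1) (c i == y ord0) *
    (if same_type N (c \o lift i) (y \o lift ord0)
     then \prod_k (cnt N (c \o lift i) k)`! else 0)).
  apply: eq_bigr => i _; rewrite -IH big_distrr /=.
  apply: eq_bigr => t _; rewrite mulnb; congr nat_of_bool.
  apply/forallP/andP => [H|[/eqP H0 /forallP H] j].
    split; first by have := H ord0; rewrite lift_perm_id.
    by apply/forallP => j; have := H (lift ord0 j); rewrite lift_perm_lift.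
  case: (unliftP ord0 j) => [j'|] ->; first by rewrite lift_perm_lift; exact: H.
  by rewrite lift_perm_id H0.
have E i : c i = y ord0 ->
    same_type N (c \o lift i) (y \o lift ord0) = same_type N.+1 c y.
  move=> ciy; apply: eq_forallb => k.
  by rewrite (cnt_lift _ c i) (cnt_lift _ y ord0) ciy eqn_add2l.
transitivity (\sum_(i < N.+1) (c i == y ord0) *
    (if same_type N.+1 c y then \prod_k (cnt N (c \o lift i) k)`! else 0)).
  apply: eq_bigr => i _; case: eqP => [/E ->|]//=; by rewrite !mul0n.
case: ifPn => // T; last by rewrite big1// => i _; rewrite muln0.
have P i : c i = y ord0 ->
   cnt N.+1 c (y ord0) * \prod_k (cnt N (c \o lift i) k)`! = \prod_k (cnt N.+1 c k)`!.
  move=> ciy; rewrite (bigD1 (y ord0))//= [RHS](bigD1 (y ord0))//= mulnA.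
  congr (_ * _); last first.
    by apply: eq_bigr => k kn; rewrite (cnt_lift _ c i) ciy eq_sym (negbTE kn).
  by rewrite (cnt_lift _ c i) ciy eqxx add1n factS.
(* Multiplying both sides by this positive count turns each remainder into the full product of
   factorials and avoids a quotient. *)
have pos : 0 < cnt N.+1 c (y ord0).
  by have /eqP-> := forallP T (y ord0); rewrite (cnt_lift _ y ord0) eqxx.
apply/eqP; rewrite -(eqn_pmul2l pos) big_distrr /=; apply/eqP.
transitivity (\sum_(i < N.+1) (c i == y ord0) * \prod_k (cnt N.+1 c k)`!).
  apply: eq_bigr => i _; case: eqP => [/P <-|]; by rewrite ?mul1n ?mul0n ?muln0.
by rewrite -big_distrl.
Qed.

Lemma card_perm_fiberV (N : nat) (c y : 'I_N -> C) :
  \sum_(s : 'S_N) [forall j, c (s^-1%g j) == y j]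
  = if same_type N c y then \prod_k (cnt N c k)`! else 0.
Proof.
rewrite -card_perm_fiber (reindex_inj invg_inj) /=.
by apply: eq_bigr => s _; rewrite invgK.
Qed.

(** Orbit counting: every permutation [s] yields exactly one word [z \o s], and each word of the
    type of [z] is reached by the number of permutations given by [card_perm_fiber]. *)
Lemma card_type_class (N : nat) (z : 'I_N -> C) :
  (\sum_(y : {ffun 'I_N -> C}) same_type N z y) * \prod_k (cnt N z k)`! = N`!.
Proof.
transitivity (\sum_(y : {ffun 'I_N -> C}) \sum_(s : 'S_N) [forall j, z (s j) == y j]).
  rewrite big_distrl /=; apply: eq_bigr => y _; rewrite card_perm_fiber.
  by case: ifP; rewrite ?mul1n ?mul0n.
rewrite exchange_big /= -card_Sn -sum1_card; apply: eq_bigr => s _.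
rewrite (bigD1 [ffun j => z (s j)])//= big1 ?addn0.
  by rewrite (_ : [forall j, _] = true)//; apply/forallP => j; rewrite ffunE.
move=> y yn; apply/eqP; rewrite eqb0; apply: contra yn => /forallP H.
by apply/eqP/ffunP => j; rewrite ffunE; rewrite (eqP (H j)).
Qed.

Lemma sum_cnt (N : nat) (c : 'I_N -> C) : \sum_k cnt N c k = N.
Proof.
rewrite /cnt exchange_big /= -[RHS]card_ord -sum1_card; apply: eq_bigr => j _.
rewrite (bigD1 (c j))//= eqxx big1// => k; rewrite eq_sym; by case: eqP.
Qed.

Lemma cnt_le (N : nat) (c : 'I_N -> C) (k : C) : cnt N c k <= N.
Proof.
have := sum_cnt N c; rewrite (bigD1 k)//=; move: (cnt N c k) => x.
by move=> <-; rewrite leq_addr.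
Qed.

Local Open Scope ring_scope.

Lemma prod_cnt (R : comPzRingType) (N : nat) (c : 'I_N -> C) (F : C -> R) :
  \prod_(j < N) F (c j) = \prod_k F k ^+ cnt N c k.
Proof.
rewrite (partition_big c xpredT)//=; apply: eq_bigr => k _.
rewrite (eq_bigr (fun=> F k)); last by move=> j /eqP ->.
rewrite prodr_const; congr (_ ^+ _); rewrite /cnt -sum1_card big_mkcond /=.
by apply: eq_bigr => j _; rewrite unfold_in -/(c j == k); case: (c j == k).
Qed.

Lemma sumr_cnt (R : pzRingType) (N : nat) (c : 'I_N -> C) (F : C -> R) :
  \sum_(j < N) F (c j) = \sum_k F k *+ cnt N c k.
Proof.
rewrite (partition_big c xpredT)//=; apply: eq_bigr => k _.
rewrite (eq_bigr (fun=> F k)); last by move=> j /eqP ->.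
rewrite sumr_const; congr (_ *+ _); rewrite /cnt -sum1_card big_mkcond /=.
by apply: eq_bigr => j _; rewrite unfold_in -/(c j == k); case: (c j == k).
Qed.

End TypeCount.

Local Open Scope classical_set_scope.
Local Open Scope ring_scope.

(** * Stirling bounds and multinomial coefficients *)

Section Stirling.
Context {R : realType}.

Definition xlnx (x : R) : R := x * ln x.

Lemma ln_le_subr1 (x : R) : 0 < x -> ln x <= x - 1.
Proof. by move=> x0; rewrite -[X in ln X](subrKC 1); apply: le_ln1Dx; lra. Qed.

Lemma ln_ge_1subV (x : R) : 0 < x -> 1 - x^-1 <= ln x.
Proof.
move=> x0; have := ln_le_subr1 x^-1; rewrite invr_gt0 => /(_ x0).
by rewrite lnV ?posrE//; lra.
Qed.

(** Convexity: the graph lies above its tangent at [a]. For positive [x] this is ln y >= 1 - 1/y at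
    y = x / a. Both semicontinuity estimates below rest on it. *)
Lemma xlnx_tangent (a x : R) : 0 < a -> 0 <= x ->
  xlnx a + (1 + ln a) * (x - a) <= xlnx x.
Proof.
move=> a0; rewrite le_eqVlt => /orP[/eqP <-|x0].
  by rewrite /xlnx mul0r; lra.
have xa : 0 < x / a by rewrite divr_gt0.
have := ln_ge_1subV _ xa; rewrite ln_div ?posrE// invf_div => H.
have : x * (1 - a / x) <= x * (ln x - ln a) by rewrite ler_pM2l.
have -> : x * (1 - a / x) = x - a by field; rewrite gt_eqF.
rewrite /xlnx; nra.
Qed.

Lemma ln_fact_ge (k : nat) : k%:R * ln k%:R - k%:R <= ln (k`!%:R : R).
Proof.
elim: k => [|k IH]; first by rewrite fact0 ln1 mul0r subr0.
rewrite factS natrM lnM ?posrE ?ltr0n ?fact_gt0//.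
have [->|k0] := posnP k; first by rewrite fact0 ln1; lra.
have kp : (0 : R) < k%:R by rewrite ltr0n.
have k1p : (0 : R) < k.+1%:R by rewrite ltr0n.
have xa : 0 < (k.+1%:R / k%:R : R) by rewrite divr_gt0.
have := ln_le_subr1 _ xa; rewrite ln_div ?posrE// => H.
have : k%:R * (ln k.+1%:R - ln k%:R) <= k%:R * (k.+1%:R / k%:R - 1) :> R.
  by rewrite ler_pM2l.
have -> : k%:R * (k.+1%:R / k%:R - 1) = 1 :> R.
  by rewrite -natr1; field; rewrite gt_eqF.
move: IH; rewrite -natr1; nra.
Qed.

(** The factor 2 in the error term makes the induction close: one step gains at least 2 / (k+2), and
    must pay 1 / (k+1). *)
Lemma ln_fact_le (k : nat) :
  ln (k`!%:R : R) <= k%:R * ln k%:R - k%:R + 2 * ln k.+1%:R.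
Proof.
elim: k => [|k IH]; first by rewrite fact0 ln1 mul0r; lra.
rewrite factS natrM lnM ?posrE ?ltr0n ?fact_gt0//.
have k1p : (0 : R) < k.+1%:R by rewrite ltr0n.
have k2p : (0 : R) < k.+2%:R by rewrite ltr0n.
have H : 1 - k.+1%:R / k.+2%:R <= ln k.+2%:R - ln k.+1%:R :> R.
  rewrite -ln_div ?posrE// -(invf_div k.+2%:R); apply: ln_ge_1subV.
  by rewrite divr_gt0.
have e : 1 - k.+1%:R / k.+2%:R = k.+2%:R^-1 :> R.
  have k2E : k.+2%:R = k.+1%:R + 1 :> R by rewrite natr1.
  rewrite !k2E; move: (k.+1%:R : R) k1p => a a0.
  by field; rewrite gt_eqF//; lra.
have G : k%:R * (1 - k%:R / k.+1%:R) <= k%:R * (ln k.+1%:R - ln k%:R) :> R.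
  have [->|k0] := posnP k; first by rewrite !mul0r.
  have kp : (0 : R) < k%:R by rewrite ltr0n.
  rewrite ler_pM2l// -ln_div ?posrE// -(invf_div k.+1%:R).
  by apply: ln_ge_1subV; rewrite divr_gt0.
have e2 : k%:R * (1 - k%:R / k.+1%:R) = 1 - k.+1%:R^-1 :> R.
  by rewrite -natr1; field; rewrite natr1 gt_eqF.
have F : k.+1%:R^-1 <= 2 * k.+2%:R^-1 :> R.
  rewrite -invf_div lef_pV2 ?posrE ?divr_gt0//.
  by rewrite ler_pdivrMr// -natrM ler_nat; lia.
rewrite e in H; rewrite e2 in G.
move: IH H G F; move: (k.+2%:R^-1) (k.+1%:R^-1) (ln k.+2%:R) (ln k`!%:R) (ln k%:R) (ln k.+1%:R) => i2 i1 L2 F0 L0 L1; rewrite -(natr1 k); move: (k%:R : R) => x. lra.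
Qed.

Lemma ln_prod (I : Type) (s : seq I) (F : I -> R) : (forall i, 0 < F i) ->
  ln (\prod_(i <- s) F i) = \sum_(i <- s) ln (F i).
Proof.
move=> F0; elim: s => [|i s IH]; first by rewrite !big_nil ln1.
by rewrite !big_cons lnM ?posrE ?IH// prodr_gt0.
Qed.

Lemma xlnx_frac (N m : nat) : (0 < N)%N ->
  N%:R * xlnx (m%:R / N%:R) = m%:R * ln m%:R - m%:R * ln N%:R.
Proof.
move=> N0; have Np : (0 : R) < N%:R by rewrite ltr0n.
have [->|m0] := posnP m; first by rewrite /xlnx !mul0r mulr0 subr0.
have mp : (0 : R) < m%:R by rewrite ltr0n.
rewrite /xlnx ln_div ?posrE// mulrA -mulrBr; congr (_ * _).
by rewrite mulrCA mulfV ?mulr1// gt_eqF.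
Qed.

Section Multinomial.
Variables (C : finType) (m : C -> nat) (N : nat).
Hypothesis sum_m : (\sum_k m k = N)%N.
Hypothesis N_gt0 : (0 < N)%N.

Lemma sum_xlnx_frac :
  N%:R * \sum_k xlnx ((m k)%:R / N%:R) =
  \sum_k (m k)%:R * ln (m k)%:R - N%:R * ln N%:R :> R.
Proof.
rewrite mulr_sumr (eq_bigr _ (fun k _ => xlnx_frac _ (m k) N_gt0)).
by rewrite sumrB -mulr_suml -natr_sum sum_m.
Qed.

(** The left side is minus the logarithm of a multinomial coefficient. Each of the [#|C|] factorials
    is bounded from above and costs one error term. *)
Lemma multinomial_ub :
  \sum_k ln ((m k)`!%:R) - ln (N`!%:R) <=
  N%:R * \sum_k xlnx ((m k)%:R / N%:R) + 2 * #|C|%:R * ln (N.+1%:R) :> R.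
Proof.
rewrite sum_xlnx_frac.
have H1 : \sum_k ln ((m k)`!%:R) <=
  \sum_k ((m k)%:R * ln (m k)%:R - (m k)%:R + 2 * ln N.+1%:R) :> R.
  apply: ler_sum => k _; apply: (le_trans (ln_fact_le _)).
  rewrite lerD2l ler_pM2l// ler_ln ?posrE ?ltr0n// ler_nat ltnS -sum_m.
  by rewrite (bigD1 k)//= leq_addr.
rewrite big_split sumrB /= -natr_sum sum_m sumr_const -[_ *+ #|_|]mulr_natr in H1.
have := ln_fact_ge N; move: H1.
have -> : 2 * ln N.+1%:R * #|C|%:R = 2 * #|C|%:R * ln N.+1%:R :> R by ring.
lra.
Qed.

(** Only N! is bounded from above here, hence a single error term, whatever the number of cells. *)
Lemma multinomial_lb :
  N%:R * \sum_k xlnx ((m k)%:R / N%:R) - 2 * ln (N.+1%:R) <=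
  \sum_k ln ((m k)`!%:R) - ln (N`!%:R) :> R.
Proof.
rewrite sum_xlnx_frac.
have H1 : \sum_k ((m k)%:R * ln (m k)%:R - (m k)%:R) <= \sum_k ln ((m k)`!%:R) :> R.
  by apply: ler_sum => k _; exact: ln_fact_ge.
rewrite sumrB /= -natr_sum sum_m in H1.
have := ln_fact_le N; lra.
Qed.

End Multinomial.

End Stirling.

(** * Joint types of independently permuted words *)

Section JointType.
Context {R : realType}.
Variables (n : nat) (C : finType) (N : nat) (c : 'I_n -> 'I_N -> C).
Hypothesis N_gt0 : (0 < N)%N.
Local Notation W := {ffun 'I_n -> C}.
Local Notation S := {ffun 'I_n -> 'S_N}.

Definition joint (s : S) (j : 'I_N) : W := [ffun i => c i ((s i)^-1%g j)].

(** The n permutations are chosen independently, so the condition splits into one per coordinate and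
    the count factorizes. *)
Lemma card_joint_fiber (y : 'I_N -> W) :
  (\sum_(s : S) [forall j, joint s j == y j] =
  \prod_i (if same_type C N (c i) (fun j => y j i)
           then \prod_k (cnt C N (c i) k)`! else 0))%N.
Proof.
transitivity (\prod_i \sum_(s : 'S_N) [forall j, c i (s^-1%g j) == y j i])%N; last first.
  by apply: eq_bigr => i _; rewrite card_perm_fiberV.
rewrite bigA_distr_bigA /=; apply: eq_bigr => s _.
have [/forallP H|/forallPn[j Hj]] := boolP [forall j, joint s j == y j].
  rewrite big1// => i _; rewrite (_ : [forall j, _] = true)//.
  by apply/forallP => j; rewrite -(eqP (H j)) ffunE.
have [i Hi] : exists i, c i ((s i)^-1%g j) != y j i.
  apply/existsP; move: Hj; apply: contraNT; rewrite negb_exists => /forallP H.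
  by apply/eqP/ffunP => i; rewrite ffunE; apply/eqP; rewrite -[_ == _]negbK.
rewrite (bigD1 i)//= (_ : [forall j, _] = false) ?mul0n//.
by apply/negbTE/forallPn; exists j.
Qed.

Let freq (i : 'I_n) (k : C) : R := (cnt C N (c i) k)%:R / N%:R.

(* Conditioning an i.i.d. sample on its type, whose probability is at least
   inverse polynomial, gives the uniform measure on the permutations. *)
Lemma sum_joint_le (g : W -> R) : (forall w, 0 <= g w) ->
  ((N`!)%:R ^+ n)^-1 * \sum_(s : S) \prod_(j < N) g (joint s j)
  <= expR (2 * #|C|%:R * ln N.+1%:R) ^+ n * (\sum_w g w * \prod_i freq i (w i)) ^+ N.
Proof.
move=> g0.
(* In one coordinate: a uniform rearrangement of [c i] equals [y] with probability at most a
   polynomial factor times the i.i.d. probability of [y] under the frequencies of [c i]. *)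
have key i (y : 'I_N -> C) : (N`!)%:R^-1 * (if same_type C N (c i) y
     then \prod_k (cnt C N (c i) k)`! else 0)%N%:R <=
   expR (2 * #|C|%:R * ln N.+1%:R) * \prod_j freq i (y j).
  have f0 j : 0 <= freq i (y j) by rewrite divr_ge0.
  case: ifPn => [/forallP T|_]; last by rewrite mulr0 mulr_ge0 ?expR_ge0 ?prodr_ge0.
  rewrite (prod_cnt C _ _ y (freq i)).
  have -> : \prod_k freq i k ^+ cnt C N y k
          = expR (N%:R * \sum_k xlnx (freq i k)).
    rewrite mulr_sumr expR_sum; apply: eq_bigr => k _.
    rewrite -(eqP (T k)) xlnx_frac//.
    have [->|m0] := posnP (cnt C N (c i) k); first by rewrite expr0 !mul0r subr0 expR0.
    rewrite -mulrBr -ln_div ?posrE ?ltr0n// expRM_natl lnK// posrE divr_gt0 ?ltr0n//.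
  have P0 : 0 < \prod_k ((cnt C N (c i) k)`!)%:R :> R.
    by apply: prodr_gt0 => k _; rewrite ltr0n fact_gt0.
  have Ni0 : 0 < (N`!)%:R^-1 :> R by rewrite invr_gt0 ltr0n fact_gt0.
  rewrite -expRD natr_prod -[leLHS]lnK ?posrE ?mulr_gt0// ler_expR lnM ?posrE//.
  rewrite lnV ?posrE ?ltr0n ?fact_gt0// ln_prod; last by move=> k; rewrite ltr0n fact_gt0.
  by have := @multinomial_ub R C (cnt C N (c i)) N (sum_cnt _ _ _) N_gt0; lra.
(* Group the permutation tuples by the joint word that they produce. *)
have -> : \sum_(s : S) \prod_(j < N) g (joint s j) =
   \sum_(y : {ffun 'I_N -> W}) (\prod_j g (y j)) *
      (\sum_(s : S) [forall j, joint s j == y j])%N%:R.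
  under [RHS]eq_bigr do rewrite natr_sum mulr_sumr.
  rewrite exchange_big /=; apply: eq_bigr => s _.
  rewrite (bigD1 [ffun j => joint s j])//= [X in _ + X]big1 ?addr0; last first.
    move=> y yn; suff -> : [forall j, joint s j == y j] = false by rewrite mulr0.
    apply/negbTE; apply: contra yn => /forallP H; apply/eqP/ffunP => j.
    by rewrite ffunE (eqP (H j)).
  have -> : [forall j, joint s j == [ffun j => joint s j] j]; last first.
    by rewrite mulr1; apply: eq_bigr => j _; rewrite ffunE.
  by apply/forallP => j; rewrite ffunE.
have -> : (\sum_w g w * \prod_i freq i (w i)) ^+ N =
   \sum_(y : {ffun 'I_N -> W}) \prod_j (g (y j) * \prod_i freq i (y j i)).
  rewrite -[N in LHS]card_ord -prodr_const bigA_distr_bigA /=.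
  by [].
rewrite !mulr_sumr; apply: ler_sum => y _.
rewrite card_joint_fiber natr_prod mulrCA [X in _ <= _ * X]big_split /= [leRHS]mulrCA.
apply: ler_wpM2l; first by apply: prodr_ge0.
have XP (x : R) : x ^+ n = \prod_(i < n) x by rewrite prodr_const card_ord.
rewrite exchange_big /= !XP -prodfV -!big_split /=.
by apply: ler_prod => i _; rewrite key andbT mulr_ge0// invr_ge0.
Qed.

Lemma cnt_proj (y : 'I_N -> W) (i : 'I_n) (k : C) :
  cnt C N (fun j => y j i) k = (\sum_(w : W | w i == k) cnt W N y w)%N.
Proof.
rewrite /cnt exchange_big /=; apply: eq_bigr => j _.
rewrite big_mkcond (bigD1 (y j))//= eqxx big1 ?addn0; last first.
  by move=> w; rewrite eq_sym => /negbTE ->; case: ifP.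
by case: eqP.
Qed.

Lemma same_type_proj (z y : 'I_N -> W) (i : 'I_n) : same_type W N z y ->
  same_type C N (fun j => z j i) (fun j => y j i).
Proof.
move=> /forallP T; apply/forallP => k; rewrite !cnt_proj; apply/eqP.
by apply: eq_bigr => w _; rewrite (eqP (T w)).
Qed.

(** [card_type_class] counts the words of the type of [z]; all of them have the marginal types of
    [c], so each arises from the same number of permutation tuples. *)
Lemma card_joint_type (z : 'I_N -> W) :
  (forall i, same_type C N (c i) (fun j => z j i)) ->
  (#|[set s | same_type W N z (joint s)]%SET| * \prod_w (cnt W N z w)`! =
  N`! * \prod_i \prod_k (cnt C N (c i) k)`!)%N.
Proof.
move=> cz; rewrite -(card_type_class W N z) mulnAC; congr (_ * _)%N.
rewrite -sum1_card big_mkcond /= big_distrl /=.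
transitivity (\sum_(s : S) \sum_(y : {ffun 'I_N -> W})
    same_type W N z y * [forall j, joint s j == y j])%N.
  apply: eq_bigr => s _; rewrite inE (bigD1 [ffun j => joint s j])//=.
  rewrite [X in (_ + X)%N]big1 ?addn0; last first.
    move=> y yn; suff -> : [forall j, joint s j == y j] = false by rewrite muln0.
    apply/negbTE; apply: contra yn => /forallP H; apply/eqP/ffunP => j.
    by rewrite ffunE (eqP (H j)).
  have -> : [forall j, joint s j == [ffun j => joint s j] j].
    by apply/forallP => j; rewrite ffunE.
  rewrite muln1; have -> : same_type W N z [ffun j => joint s j] = same_type W N z (joint s).
    apply: eq_forallb => w; congr (_ == _); apply: eq_bigr => j _.
    by rewrite ffunE.
  by case: ifP.
rewrite exchange_big /=; apply: eq_bigr => y _; rewrite -big_distrr /=.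
have [T|] := boolP (same_type W N z y); last by rewrite !mul0n.
rewrite !mul1n card_joint_fiber; apply: eq_bigr => i _.
have /forallP A := cz i; have /forallP B := same_type_proj _ _ i T.
suff -> : same_type C N (c i) (fun j => y j i) by [].
by apply/forallP => k; rewrite (eqP (A k)) (eqP (B k)).
Qed.

(** The bracket multiplied by N is the relative entropy of the empirical joint law with respect to
    the product of its marginals. The errors are [#|W|] terms from the joint table and one from each
    of the n marginals. *)
Lemma card_joint_type_ge (z : 'I_N -> W) :
  (forall i, same_type C N (c i) (fun j => z j i)) ->
  expR (- (N%:R * (\sum_w xlnx ((cnt W N z w)%:R / N%:R) - \sum_i \sum_k xlnx (freq i k)))
        - 2 * (#|W| + n)%N%:R * ln N.+1%:R) <=
  (#|[set s | same_type W N z (joint s)]%SET|)%:R / (N`!)%:R ^+ n.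
Proof.
move=> cz; have fp m : 0 < (m`!)%:R :> R by rewrite ltr0n fact_gt0.
have Pp (I : finType) (F : I -> nat) : 0 < \prod_i ((F i)`!)%:R :> R.
  by apply: prodr_gt0 => i _; exact: fp.
have -> : (#|[set s | same_type W N z (joint s)]%SET|)%:R =
  (N`!)%:R * (\prod_i \prod_k ((cnt C N (c i) k)`!)%:R) / \prod_w ((cnt W N z w)`!)%:R :> R.
  apply: (canRL (mulfK _)); first by rewrite gt_eqF// Pp.
  rewrite -natr_prod -natrM card_joint_type// natrM natr_prod.
  by congr (_ * _); apply: eq_bigr => i _; rewrite natr_prod.
rewrite -[leRHS]lnK; last first.
  by rewrite posrE !mulr_gt0 ?invr_gt0 ?exprn_gt0//; apply: prodr_gt0 => i _.
have PPp : 0 < \prod_i \prod_k ((cnt C N (c i) k)`!)%:R :> R.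
  by apply: prodr_gt0 => i _.
rewrite ler_expR !(ln_div, lnM) ?posrE ?mulr_gt0 ?invr_gt0 ?exprn_gt0//.
rewrite lnXn// ln_prod; last by move=> i; apply: prodr_gt0 => k _.
rewrite ln_prod//.
have H1 := @multinomial_ub R _ (cnt W N z) N (sum_cnt _ _ _) N_gt0.
have H2 : \sum_i (N%:R * \sum_k xlnx (freq i k) - 2 * ln (N.+1%:R)) <=
   \sum_i (\sum_k ln (((cnt C N (c i) k)`!)%:R) - ln (N`!%:R)) :> R.
  by apply: ler_sum => i _; exact: (multinomial_lb C (cnt C N (c i)) N (sum_cnt _ _ _) N_gt0).
rewrite !big_split /= -mulr_sumr !sumr_const card_ord !mulNrn in H2.
have -> : \sum_i ln (\prod_k ((cnt C N (c i) k)`!)%:R) =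
    \sum_i \sum_k ln (((cnt C N (c i) k)`!)%:R) :> R.
  by apply: eq_bigr => i _; rewrite ln_prod.
rewrite natrD; move: H1 H2; rewrite -[_ * ln _ *+ n]mulr_natr -[ln _ *+ n]mulr_natr.
move: (\sum_i \sum_k ln _) (\sum_i \sum_k xlnx _) (\sum_w xlnx _) (\sum_k ln _).
move: (ln N.+1%:R) (ln N`!%:R) => a b; move: (n%:R : R) (#|_|%:R : R) (N%:R : R).
by move=> n' w' N' x y z' t H1 H2; lra.
Qed.

End JointType.

(** * Tables with prescribed marginals *)

Section Fill.
Variables (n : nat) (C : finType).
Local Notation W := {ffun 'I_n -> C}.

(** Columns are placed one at a time, the demanded ones first; once the demand [m] is exhausted, any
    column compatible with the remaining marginals will do. The bound on [\sum_w m w] covers n = 0,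
    where the marginal conditions are empty. *)
Lemma contingency_fill (N : nat) (m : W -> nat) (M : 'I_n -> C -> nat) :
  (forall i, \sum_k M i k = N)%N ->
  (forall i k, \sum_(w : W | w i == k) m w <= M i k)%N ->
  (\sum_w m w <= N)%N ->
  exists z : 'I_N -> W, (forall i k, cnt C N (fun j => z j i) k = M i k) /\
    (forall w, m w <= cnt W N z w)%N.
Proof.
elim: N m M => [|N IH] m M sM mM mN.
  have v : 'I_0 -> W by case.
  exists v; split => [i k|w].
    rewrite /cnt big_ord0; apply/esym/eqP.
    by have /eqP := sM i; rewrite sum_nat_eq0 => /forallP/(_ k).
  have : (\sum_w m w == 0)%N by rewrite -leqn0.
  by rewrite sum_nat_eq0 => /forallP/(_ w)/eqP->.
have [w0 [Mw0 mw0]] : exists w0 : W, (forall i, 0 < M i (w0 i))%N /\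
    ((0 < m w0)%N \/ forall w, m w = 0%N).
  have [/existsP[w0 mw0]|/existsPn m0] := boolP [exists w, 0 < m w]%N.
    exists w0; split; last by left.
    move=> i; apply: (leq_trans mw0); apply: (leq_trans _ (mM i (w0 i))).
    by rewrite (bigD1 w0)//= leq_addr.
  have ex i : exists k, (0 < M i k)%N.
    apply/existsP; apply: contraT; rewrite negb_exists => /forallP H.
    have := sM i; rewrite big1// => k _; apply/eqP.
    by have := H k; rewrite -eqn0Ngt.
  exists [ffun i => xchoose (ex i)]; split; first by move=> i; rewrite ffunE (xchooseP (ex i)).
  by right => w; apply/eqP; have := m0 w; rewrite -eqn0Ngt.
have M'E i : (\sum_k M i k = \sum_k (M i k - (w0 i == k)) + 1)%N.
  rewrite [in LHS](bigD1 (w0 i))//= [in RHS](bigD1 (w0 i))//= eqxx addnAC subnK//.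
  by congr (_ + _)%N; apply: eq_bigr => k; rewrite eq_sym => /negbTE ->; rewrite subn0.
(* Subtraction in nat is truncated, so removing the column [w0] lowers the demand only if it was
   positive there. *)
have m'E (P : pred W) : (\sum_(w | P w) (m w - (w0 == w)) = \sum_(w | P w) m w - (P w0 && (0 < m w0)))%N.
  have [Pw|Pw] := boolP (P w0); last first.
    rewrite subn0; apply: eq_bigr => w Pw'; case: eqP => [E|]; last by rewrite subn0.
    by rewrite -E (negbTE Pw) in Pw'.
  rewrite (bigD1 w0)//= [in RHS](bigD1 w0)//= eqxx.
  rewrite (eq_bigr m); last by move=> w /andP[_]; rewrite eq_sym => /negbTE ->; rewrite subn0.
  case: (m w0) => [|k] /=; first by rewrite sub0n !add0n subn0.
  by rewrite !subn1 addSn.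
have [|||z [zM zm]] := IH (fun w => m w - (w0 == w))%N (fun i k => M i k - (w0 i == k))%N.
- by move=> i; have := M'E i; rewrite sM addn1 => -[].
- move=> i k; rewrite m'E; have := mM i k; case: eqP => [<-|_] /=; last by rewrite !subn0.
  case: mw0 => [->|m0 _]; first by move=> ?; apply: leq_sub2r.
  by rewrite big1.
- rewrite m'E /=; case: mw0 => [->|m0]; first by rewrite leq_subLR.
  by rewrite big1.
exists (fun j => if unlift ord0 j is Some j' then z j' else w0); split => [i k|w].
  rewrite (cnt_lift _ _ _ ord0) unlift_none.
  rewrite (_ : cnt _ _ _ _ = M i k - (w0 i == k))%N; last first.
    by rewrite -zM; apply: eq_bigr => j _; rewrite /= liftK.
  by case: eqP => [<-|_]; rewrite ?subnKC ?add0n ?subn0.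
rewrite (cnt_lift _ _ _ ord0) unlift_none.
rewrite (_ : cnt _ _ (_ \o _) _ = cnt W N z w); last first.
  by apply: eq_bigr => j _; rewrite /= liftK.
by rewrite -leq_subLR.
Qed.

End Fill.

(** * Semicontinuity of x ln x, and logarithms against N *)

Section Asymptotics.
Context {R : realType}.

(** The tangent is taken at the moving point [x], where ln is bounded below by ln (p / 2). At p = 0
    the restriction to [0, 1] gives the sign. The upper bound serves the joint table, the lower
    bound of the next lemma the marginals. *)
Lemma xlnx_usc (p e : R) : 0 <= p -> 0 < e ->
  \forall d \near 0^'+, forall x, 0 <= x <= 1 -> `|x - p| <= d -> xlnx x <= xlnx p + e.
Proof.
rewrite le_eqVlt => /orP[/eqP<-|p0] e0.
  apply: nearW => d x /andP[x0 x1] _; rewrite /xlnx mul0r add0r.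
  by apply: le_trans (ltW e0); rewrite mulr_ge0_le0// ln_le0.
pose L := 1 + `|ln (p / 2)|.
have L0 : 0 < L by rewrite /L ltr_pwDl.
near=> d => x /andP[x0 x1] xd.
have d0 : 0 < d by near: d; exact: nbhs_right_gt.
have dp : d < p / 2 by near: d; apply: nbhs_right_lt; rewrite divr_gt0.
have dL : d < e / L by near: d; apply: nbhs_right_lt; rewrite divr_gt0.
move: xd; rewrite ler_norml => /andP[xd1 xd2].
have xp : p / 2 < x by lra.
have x00 : 0 < x by apply: lt_trans xp; rewrite divr_gt0.
have := xlnx_tangent x p x00 (ltW p0).
have lx0 : ln x <= 0 by rewrite ln_le0.
have lx1 : ln (p / 2) <= ln x by rewrite ler_ln ?posrE ?divr_gt0// ltW.
have lp : `|ln (p / 2)| = - ln (p / 2) by rewrite ler0_norm// (le_trans lx1).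
have : `|(1 + ln x) * (p - x)| <= L * d.
  rewrite normrM ler_pM//; last by rewrite ler_norml; lra.
  by rewrite /L lp ler_norml; lra.
rewrite ler_norml => /andP[H1 H2].
by move: dL; rewrite ltr_pdivlMr// => dL H; rewrite mulrC in H1; nra.
Unshelve. all: by end_near. Qed.

Lemma xlnx_lsc (q e : R) : 0 <= q -> 0 < e ->
  \forall d \near 0^'+, forall x, 0 <= x -> `|x - q| <= d -> xlnx q - e <= xlnx x.
Proof.
move=> q0 e0.
(* The tangent at 0 is vertical, so for q = 0 it is taken at e / 2, where its intercept is - e /
   2. *)
pose a := if q == 0 then e / 2 else q.
have a0 : 0 < a by rewrite /a; case: eqP => [_|/eqP qn]; [rewrite divr_gt0|rewrite lt_neqAle eq_sym qn].
have L0 : 0 < 2 * (1 + `|1 + ln a|) by rewrite mulr_gt0// ltr_pwDl.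
near=> d => x x0 xd.
have d0 : 0 < d by near: d; exact: nbhs_right_gt.
have dL : d < e / (2 * (1 + `|1 + ln a|)).
  by near: d; apply: nbhs_right_lt; rewrite divr_gt0.
move: dL; rewrite ltr_pdivlMr// => dL.
have := xlnx_tangent a x a0 x0.
have : `|(1 + ln a) * (x - q)| <= `|1 + ln a| * d.
  by rewrite normrM ler_wpM2l.
rewrite ler_norml => /andP[H1 _]; have := normr_ge0 (1 + ln a).
rewrite /a in H1 dL *; case: eqP H1 dL => [->|_] H1 dL.
  by rewrite /xlnx !mul0r; nra.
by nra.
Unshelve. all: by end_near. Qed.

Lemma ln_succ_little (A e : R) : 0 <= A -> 0 < e ->
  \forall N \near \oo, A * ln N.+1%:R <= e * N%:R.
Proof.
move=> A0 e0.
(* With this [a] the bound ln x <= x / a - 1 + ln a, times A + 1, has slope e / 2; using A + 1 keeps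
   [a] positive when A = 0. *)
pose a := 2 * (A + 1) / e.
have a0 : 0 < a by rewrite divr_gt0// mulr_gt0// ltr_pwDr.
near=> N.
have N1 : (0 : R) < N.+1%:R by rewrite ltr0n.
have xa : 0 < (N.+1%:R / a) by rewrite divr_gt0.
have H := ln_le_subr1 _ xa; rewrite ln_div ?posrE// in H.
have : (2 / e) * (e + (A + 1) * `|ln a|) <= N%:R.
  near: N; exact: nbhs_infty_ger.
have -> : 2 / e * (e + (A + 1) * `|ln a|) = 2 + 2 / e * (A + 1) * `|ln a| by field; rewrite gt_eqF.
move=> HN.
have HN2 : e * (2 + 2 / e * (A + 1) * `|ln a|) <= e * N%:R by rewrite ler_pM2l.
have E1 : e * (2 + 2 / e * (A + 1) * `|ln a|) = 2 * e + 2 * (A + 1) * `|ln a| by field; rewrite gt_eqF.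
rewrite E1 in HN2.
have E2 : (A + 1) * (N.+1%:R / a) = e / 2 * N.+1%:R.
  by rewrite /a; field; rewrite gt_eqF//= gt_eqF// ltr_pwDr.
have H3 : (A + 1) * ln N.+1%:R <= (A + 1) * (N.+1%:R / a - 1 + ln a).
  by rewrite ler_pM2l ?ltr_pwDr//; lra.
have l0 : 0 <= ln N.+1%:R :> R by rewrite ln_ge0// ler1n.
have la := ler_norm (ln a).
have H4 : (A + 1) * ln a <= (A + 1) * `|ln a| by rewrite ler_pM2l// ltr_pwDr.
rewrite !mulrDr E2 -natr1 in H3.
have := normr_ge0 (ln a).
nra.
Unshelve. all: by end_near. Qed.

End Asymptotics.

(** * Exponential lower bound for the permutations of nearly prescribed type *)

Section JointTypeLower.
Context {R : realType}.
Variables (n : nat) (C : finType) (c : forall N, 'I_n -> 'I_N -> C).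
Local Notation W := {ffun 'I_n -> C}.
Variables (q : 'I_n -> C -> R) (p : W -> R).
Hypothesis p_ge0 : forall w, 0 <= p w.
Hypothesis sum_p : \sum_w p w = 1.
Hypothesis marg_p : forall i k, \sum_(w : W | w i == k) p w = q i k.
Hypothesis cvg_freq : forall i k,
  (fun N => (cnt C N (c N i) k)%:R / N%:R : R) @ \oo --> q i k.

(** The integer parts of (1 - d/2) N p fit below the true marginal counts for large N.
    [contingency_fill] completes them to a table with exactly these marginals, still within [d] of
    [p], to which [card_joint_type_ge] applies. *)
Lemma joint_type_lower (e : R) : 0 < e ->
  \forall N \near \oo,
    expR (- (N%:R * (\sum_w xlnx (p w) - \sum_i \sum_k xlnx (q i k) + e))) <=
    (#|[set s | [forall w, `|(cnt W N (joint n C N (c N) s) w)%:R / N%:R - p w| <= e]]%SET|)%:R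
    / (N`!)%:R ^+ n.
Proof.
move=> e0.
have q_ge0 i k : 0 <= q i k by rewrite -marg_p sumr_ge0.
(* One third of [e] for the joint terms, one third for the marginal terms, and one third for the
   polynomial factor. *)
pose e1 : R := e / (3 * #|W|.+1%:R).
have e10 : 0 < e1 by rewrite divr_gt0// mulr_gt0// ltr0n.
pose e2 : R := e / (3 * (n * #|C|).+1%:R).
have e20 : 0 < e2 by rewrite divr_gt0// mulr_gt0// ltr0n.
have G1 : \forall d \near 0^'+, forall w x, 0 <= x <= 1 -> `|x - p w| <= d ->
    xlnx x <= xlnx (p w) + e1.
  by apply: filter_forall => w; exact: xlnx_usc.
have G2 : \forall d \near 0^'+, forall i k x, 0 <= x -> `|x - q i k| <= d ->
    xlnx (q i k) - e2 <= xlnx x.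
  by apply: filter_forall => i; apply: filter_forall => k; exact: xlnx_lsc.
have [d [d0 de d1 dp dq]] : exists d : R, [/\ 0 < d, d <= e, d < 1,
    (forall w x, 0 <= x <= 1 -> `|x - p w| <= d -> xlnx x <= xlnx (p w) + e1) &
    (forall i k x, 0 <= x -> `|x - q i k| <= d -> xlnx (q i k) - e2 <= xlnx x)].
  near (0 : R)^'+ => d; exists d; split; near: d => //.
  - exact: nbhs_right_gt.
  - exact: nbhs_right_le.
  - exact: nbhs_right_lt.
have F1 : \forall N \near \oo, forall i k,
    `|(cnt C N (c N i) k)%:R / N%:R - q i k| <= d.
  apply: filter_forall => i; apply: filter_forall => k.
  move/cvgrPdist_le : (cvg_freq i k) => /(_ d d0).
  by apply: filterS => N; rewrite distrC.
(* The shrinking factor buys this lower bound on the counts; it is trivial when [q i k] is 0. *)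
have F2 : \forall N \near \oo, forall i k,
    (1 - d / 2) * q i k <= (cnt C N (c N i) k)%:R / N%:R.
  apply: filter_forall => i; apply: filter_forall => k.
  have := q_ge0 i k; rewrite le_eqVlt => /orP[/eqP <-|qp].
    by apply: nearW => N; rewrite mulr0 divr_ge0.
  have dq0 : 0 < d / 2 * q i k by rewrite mulr_gt0// divr_gt0.
  move/cvgrPdist_le : (cvg_freq i k) => /(_ _ dq0).
  apply: filterS => N; rewrite ler_norml => /andP[_ H]; lra.
near=> N.
have N0 : (0 < N)%N by near: N; exact: nbhs_infty_gt.
have Np : (0 : R) < N%:R by rewrite ltr0n.
have freq_d : forall i k, `|(cnt C N (c N i) k)%:R / N%:R - q i k| <= d by near: N.
have freq_q : forall i k, (1 - d / 2) * q i k <= (cnt C N (c N i) k)%:R / N%:R by near: N.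
have WN : #|W|%:R / N%:R <= d / 2.
  rewrite ler_pdivrMr// mulrC -ler_pdivrMr ?divr_gt0//.
  by near: N; exact: nbhs_infty_ger.
have lnN : 2 * (#|W| + n)%:R * ln N.+1%:R <= e / 3 * N%:R :> R.
  by near: N; apply: ln_succ_little; rewrite ?mulr_ge0// divr_gt0.
pose m (w : W) := Num.truncn ((1 - d / 2) * N%:R * p w).
have md (w : W) : 0 <= (1 - d / 2) * N%:R * p w.
  by rewrite !mulr_ge0//; lra.
have mle w : (m w)%:R <= (1 - d / 2) * N%:R * p w.
  by rewrite /m; have /andP[] := truncn_itv (md w).
have mge w : (1 - d / 2) * N%:R * p w <= (m w)%:R + 1.
  by rewrite natr1; have /andP[_ /ltW] := truncn_itv (md w).
have [||| z [zc zm]] := contingency_fill n C N m (fun i => cnt C N (c N i)).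
- by move=> i; exact: sum_cnt.
- move=> i k; rewrite -(ler_nat R) natr_sum.
  apply: (@le_trans _ _ (\sum_(w : W | w i == k) (1 - d / 2) * N%:R * p w)).
    exact: ler_sum.
  rewrite -mulr_sumr marg_p; have := freq_q i k; rewrite ler_pdivlMr// => H.
  by rewrite mulrAC.
- rewrite -(ler_nat R) natr_sum.
  apply: (@le_trans _ _ (\sum_(w : W) (1 - d / 2) * N%:R * p w)).
    exact: ler_sum.
  rewrite -mulr_sumr sum_p mulr1; nra.
have cz i : same_type C N (c N i) (fun j => z j i).
  by apply/forallP => k; rewrite zc.
(* A lower bound on every cell suffices: the frequencies and [p] both sum to 1, so the excess of one
   cell is at most the total deficit of the others. *)
have z_d w : `|(cnt W N z w)%:R / N%:R - p w| <= d.
  have zl (w' : W) : (1 - d / 2) * p w' - N%:R^-1 <= (cnt W N z w')%:R / N%:R.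
    rewrite ler_pdivlMr// mulrBl mulVf ?gt_eqF//.
    have := zm w'; rewrite -(ler_nat R) => H; have := mge w'.
    rewrite -mulrA (mulrC N%:R) mulrA; lra.
  have z1 : \sum_w' (cnt W N z w')%:R / N%:R = 1 :> R.
    by rewrite -mulr_suml -natr_sum sum_cnt divff// gt_eqF.
  have W1 : N%:R^-1 <= #|W|%:R / N%:R :> R.
    rewrite -[leLHS]mul1r ler_pM2r ?invr_gt0// ler1n.
    by apply/card_gt0P; exists w.
  have p1 : p w <= 1 by rewrite -sum_p (bigD1 w)//= lerDl sumr_ge0.
  have pw := p_ge0 w.
  rewrite ler_norml; apply/andP; split.
    have := zl w; nra.
  rewrite (bigD1 w)//= in z1.
  have H : \sum_(w' | w' != w) ((1 - d / 2) * p w' - N%:R^-1) <=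
           \sum_(w' | w' != w) (cnt W N z w')%:R / N%:R :> R.
    by apply: ler_sum => w' _; exact: zl.
  rewrite sumrB -mulr_sumr sumr_const in H.
  have S : \sum_(w' | w' != w) p w' = 1 - p w by rewrite -sum_p [in RHS](bigD1 w)//= addrC addrK.
  have K : N%:R^-1 *+ #|[pred w' : W | w' != w]| <= #|W|%:R / N%:R :> R.
    by rewrite -[_ *+ #|_|]mulr_natl ler_pM2r ?invr_gt0// ler_nat max_card.
  rewrite S in H; move: (N%:R^-1 *+ #|_|) H K => X H K.
  by nra.
apply: (@le_trans _ _ ((#|[set s | same_type W N z (joint n C N (c N) s)]%SET|)%:R / (N`!)%:R ^+ n)); last first.
  rewrite ler_pM2r ?invr_gt0 ?exprn_gt0 ?ltr0n ?fact_gt0// ler_nat.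
  apply/subset_leq_card/fintype.subsetP => s; rewrite !inE => /forallP T.
  by apply/forallP => w; rewrite -(eqP (T w)) (le_trans (z_d w)).
apply: le_trans (card_joint_type_ge n C N (c N) N0 z cz).
rewrite ler_expR.
have A : \sum_w xlnx ((cnt W N z w)%:R / N%:R) <= \sum_w xlnx (p w) + e / 3.
  apply: (@le_trans _ _ (\sum_w (xlnx (p w) + e1))).
    apply: ler_sum => w _; apply: dp => //; rewrite divr_ge0//= ler_pdivrMr// mul1r ler_nat.
    exact: cnt_le.
  rewrite big_split /= lerD2l sumr_const -[_ *+ #|_|]mulr_natr /e1.
  rewrite invfM mulrA -mulrA -[leRHS]mulr1 ler_pM2l ?divr_gt0//.
  by rewrite mulrC ler_pdivrMr ?ltr0n// mul1r ler_nat.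
have B : \sum_i \sum_k xlnx (q i k) - e / 3 <=
    \sum_i \sum_k xlnx ((cnt C N (c N i) k)%:R / N%:R).
  apply: (@le_trans _ _ (\sum_i \sum_k (xlnx (q i k) - e2))).
    have -> : \sum_i \sum_k (xlnx (q i k) - e2) =
        \sum_i \sum_k xlnx (q i k) - e2 *+ (n * #|C|).
      under eq_bigr do rewrite sumrB sumr_const.
      by rewrite sumrB sumr_const card_ord -mulrnA mulnC.
    rewrite lerD2l lerN2 -[_ *+ (_ * _)]mulr_natr /e2.
    rewrite invfM mulrA -mulrA -[leRHS]mulr1 ler_pM2l ?divr_gt0//.
    by rewrite mulrC ler_pdivrMr ?ltr0n// mul1r ler_nat.
  apply: ler_sum => i _; apply: ler_sum => k _; apply: dq => //; exact: freq_d.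
move: lnN A B.
move: (\sum_i \sum_k xlnx _) (\sum_i \sum_k xlnx _) => B1 B2.
move: (\sum_w xlnx _) (\sum_w xlnx _) => A1 A2.
nra.
Unshelve. all: by end_near. Qed.

End JointTypeLower.

(** * Product measures and densities *)

Section IteratedIntegral.
Context {R : realType}.
Local Open Scope ereal_scope.

(** An iterated integral evaluates its integrand only on lists of the length of [ms], so the default
    value of [insubd] in [iintT] never matters. *)
Lemma eq_iint (ms : seq (set R -> \bar R)) (f g : seq R -> \bar R) :
  (forall s, size s = size ms -> f s = g s) -> iint ms f = iint ms g.
Proof.
elim: ms f g => [|m ms IH] f g fg /=; first exact: fg.
congr (integral m setT _); apply/funext => x.
by apply: IH => s sms; apply: fg => /=; rewrite sms.
Qed.

Lemma iintT_cons (n : nat) (m : 'I_n.+1 -> set R -> \bar R) (g : n.+1.-tuple R -> \bar R) :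
  iintT n.+1 [seq m i | i <- enum 'I_n.+1] g =
  \int[m ord0]_x iintT n [seq m (lift ord0 i) | i <- enum 'I_n]
     (fun t => g [tuple of x :: t]).
Proof.
rewrite /iintT enum_ordSl /=; congr (integral _ setT _); apply/funext => x.
rewrite -map_comp.
apply: eq_iint => s; rewrite size_map size_enum_ord => sn; congr g.
by apply/val_inj; rewrite /= !val_insubd /= eqSS sn eqxx.
Qed.

Lemma iintT0 (m : 'I_0 -> set R -> \bar R) (g : 0.-tuple R -> \bar R) :
  iintT 0 [seq m i | i <- enum 'I_0] g = g [tuple].
Proof. by rewrite /iintT (size0nil (size_enum_ord 0)) /=; congr g; exact: tuple0. Qed.

Lemma measurable_consr (n : nat) (x : R) :
  measurable_fun setT (fun t : n.-tuple R => [tuple of x :: t]).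
Proof. exact: (@measurable_cons _ _ _ _ (cst x) n id). Qed.

Section ConsMeasure.
Variables (n : nat) (m0 : {sigma_finite_measure set R -> \bar R})
  (M : {sigma_finite_measure set (n.-tuple R) -> \bar R}).

Definition cons_pair (z : R * n.-tuple R) : n.+1.-tuple R := [tuple of z.1 :: z.2].

Let measurable_cons_pair : measurable_fun setT cons_pair.
Proof. exact: (@measurable_cons _ _ _ _ (fst : R * n.-tuple R -> R) n snd). Qed.

HB.instance Definition _ := isMeasurableFun.Build _ _ _ _ cons_pair measurable_cons_pair.

Definition cons_measure : set (n.+1.-tuple R) -> \bar R :=
  pushforward (m0 \x M) cons_pair.

Let cons_measure0 : cons_measure set0 = 0.
Proof. exact: measure0. Qed.

Let cons_measure_ge0 A : 0 <= cons_measure A.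
Proof. exact: measure_ge0. Qed.

Let cons_measure_sigma_additive : semi_sigma_additive cons_measure.
Proof. exact: measure_semi_sigma_additive. Qed.

HB.instance Definition _ := isMeasure.Build _ _ _ cons_measure
  cons_measure0 cons_measure_ge0 cons_measure_sigma_additive.

(** The exhausting sets are rectangles read through head and tail; since both given sequences
    increase, the larger of two indices serves both coordinates. *)
Let cons_measure_sigma_finite : sigma_finite setT cons_measure.
Proof.
have /sigma_finiteP[F [TF ndF Foo]] := sigma_finiteT m0.
have /sigma_finiteP[G [TG ndG Goo]] := sigma_finiteT M.
pose E k : set (n.+1.-tuple R) :=
  [set t | F k (tnth t ord0) /\ G k [tuple of behead t]].
have EE k : cons_pair @^-1` E k = F k `*` G k.
  apply/seteqP; split => -[x t] /=; rewrite /E /= (tnth0 x t);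
    by rewrite (val_inj (erefl : val [tuple of behead [tuple of x :: t]] = val t)).
have mE k : measurable (E k).
  have [mF _] := Foo k; have [mG _] := Goo k.
  apply: measurableI.
    by rewrite -[X in measurable X]setTI; apply: measurable_tnth.
  by rewrite -[X in measurable X]setTI; apply: (@measurable_behead _ R n).
exists E.
  apply/seteqP; split => // t _.
  have : (\bigcup_i F i) (tnth t ord0) by rewrite -TF.
  have : (\bigcup_i G i) [tuple of behead t] by rewrite -TG.
  move=> [k _ Gk] [k' _ Fk]; exists (maxn k k') => //; split.
  - by move: Fk; apply/subsetPset/ndF/leq_maxr.
  - by move: Gk; apply/subsetPset/ndG/leq_maxl.
move=> k; split => //; have [mF Fk] := Foo k; have [mG Gk] := Goo k.
rewrite /cons_measure /pushforward EE product_measure1E//.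
by rewrite lte_mul_pinfty// ge0_fin_numE.
Qed.

HB.instance Definition _ := Measure_isSigmaFinite.Build _ _ _ cons_measure
  cons_measure_sigma_finite.

Lemma integral_cons_measure (g : n.+1.-tuple R -> \bar R) :
  measurable_fun setT g -> (forall x, 0 <= g x) ->
  \int[cons_measure]_x g x = \int[m0]_x \int[M]_t g [tuple of x :: t].
Proof.
move=> mg g0; rewrite ge0_integral_pushforward// preimage_setT.
by rewrite fubini_tonelli1; [ | exact: (measurableT_comp mg measurable_cons_pair) | move=> x; exact: g0].
Qed.

Lemma measurable_integral_cons (g : n.+1.-tuple R -> \bar R) :
  measurable_fun setT g -> (forall x, 0 <= g x) ->
  measurable_fun setT (fun x => \int[M]_t g [tuple of x :: t]).
Proof.
move=> mg g0.
apply: (@measurable_fun_fubini_tonelli_F _ _ _ _ _ M (g \o cons_pair)) => //.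
  exact: (measurableT_comp mg measurable_cons_pair).
by move=> z; exact: g0.
Qed.

End ConsMeasure.

Section ProductMeasure.

(** A genuine measure that represents the functional [iintT] on nonnegative measurable functions, so
    that Radon-Nikodym and convergence theorems apply to it. *)
Fixpoint prod_measure (n : nat) :
    ('I_n -> {sigma_finite_measure set R -> \bar R}) ->
    {sigma_finite_measure set (n.-tuple R) -> \bar R} :=
  match n with
  | 0 => fun=> \d_([tuple] : 0.-tuple R)
  | k.+1 => fun m => cons_measure k (m ord0) (prod_measure k (m \o lift ord0))
  end.

Lemma integral_prod_measure (n : nat) (m : 'I_n -> {sigma_finite_measure set R -> \bar R})
    (g : n.-tuple R -> \bar R) :
  measurable_fun setT g -> (forall x, 0 <= g x) ->
  \int[prod_measure n m]_x g x = iintT n [seq (m i : set R -> \bar R) | i <- enum 'I_n] g.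
Proof.
elim: n m g => [|n IH] m g mg g0.
  by rewrite iintT0 /= integral_dirac// diracE in_setT mul1e.
rewrite (iintT_cons n m) /= integral_cons_measure//.
apply: eq_integral => x _; rewrite (IH (m \o lift ord0))//.
exact: (measurableT_comp mg (measurable_consr n x)).
Qed.

Lemma measurable_prod_tnth (n : nat) (u : 'I_n -> R -> R) :
  (forall i, measurable_fun setT (u i)) ->
  measurable_fun setT (fun t : n.-tuple R => (\prod_(i < n) u i (tnth t i))%R).
Proof.
move=> mu; apply: measurable_prod => i _.
exact: (measurableT_comp (mu i) (measurable_tnth i)).
Qed.

Lemma prod_tnth_cons (n : nat) (u : 'I_n.+1 -> R -> R) (x : R) (t : n.-tuple R) :
  (\prod_(i < n.+1) u i (tnth [tuple of x :: t] i) =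
   u ord0 x * \prod_(i < n) u (lift ord0 i) (tnth t i))%R.
Proof. by rewrite big_ord_recl; congr (_ * _)%R; apply: eq_bigr => i _; rewrite tnthS. Qed.

(** The coordinate densities multiply. Inner iterated integrals are rewritten as integrals for
    [prod_measure], where measurability is known and constants can be moved inside. *)
Lemma iintT_density (n : nat) (m l : 'I_n -> {sigma_finite_measure set R -> \bar R})
    (p : 'I_n -> R -> R) (g : n.-tuple R -> \bar R) :
  (forall i, measurable_fun setT (p i)) -> (forall i x, (0 <= p i x)%R) ->
  (forall i f, measurable_fun setT f -> (forall x, 0 <= f x) ->
     \int[m i]_x f x = \int[l i]_x ((p i x)%:E * f x)) ->
  measurable_fun setT g -> (forall x, 0 <= g x) ->
  iintT n [seq (m i : set R -> \bar R) | i <- enum 'I_n] g =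
  iintT n [seq (l i : set R -> \bar R) | i <- enum 'I_n]
    (fun x => (\prod_(i < n) p i (tnth x i))%:E * g x).
Proof.
elim: n m l p g => [|n IH] m l p g mp p0 mlp mg g0.
  by rewrite !iintT0 big_ord0 mul1e.
have mgx x : measurable_fun setT (fun t : n.-tuple R => g [tuple of x :: t]).
  exact: (measurableT_comp mg (measurable_consr n x)).
rewrite (iintT_cons n m) (iintT_cons n l) /=.
transitivity (\int[m ord0]_x \int[prod_measure n (m \o lift ord0)]_t g [tuple of x :: t]).
  by apply: eq_integral => x _; rewrite (integral_prod_measure n (m \o lift ord0)).
rewrite mlp; [|exact: measurable_integral_cons|by move=> x; exact: integral_ge0].
apply: eq_integral => x _.
rewrite (integral_prod_measure n (m \o lift ord0))//.
rewrite (IH (m \o lift ord0) (l \o lift ord0) (fun i => p (lift ord0 i)))//; last first.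
  by move=> i f mf f0; exact: mlp.
have pp0 (t : n.-tuple R) : 0 <= (\prod_(i < n) p (lift ord0 i) (tnth t i))%:E.
  by rewrite lee_fin prodr_ge0.
have mprod : measurable_fun setT (fun t : n.-tuple R =>
   (\prod_(i < n) p (lift ord0 i) (tnth t i))%:E * g [tuple of x :: t]).
  apply: emeasurable_funM => //; apply/measurable_EFinP.
  by apply: (measurable_prod_tnth n (fun i => p (lift ord0 i))).
rewrite -(integral_prod_measure n (l \o lift ord0))//; last first.
  by move=> t; rewrite mule_ge0.
rewrite -ge0_integralZl//; last 2 first.
  by move=> t _; rewrite mule_ge0.
  by rewrite lee_fin.
rewrite (integral_prod_measure n (l \o lift ord0))//; last 2 first.
  by apply: emeasurable_funM => //; apply: measurable_cst.
  by move=> t; rewrite !mule_ge0// lee_fin.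
congr (iintT n _ _); apply/funext => t.
by rewrite prod_tnth_cons EFinM muleA.
Qed.

Lemma iintT_prod (n : nat) (m : 'I_n -> {sigma_finite_measure set R -> \bar R})
    (u : 'I_n -> R -> R) :
  (forall i, measurable_fun setT (u i)) -> (forall i x, (0 <= u i x)%R) ->
  iintT n [seq (m i : set R -> \bar R) | i <- enum 'I_n]
    (fun x => (\prod_(i < n) u i (tnth x i))%:E) =
  \prod_(i < n) \int[m i]_x (u i x)%:E.
Proof.
elim: n m u => [|n IH] m u mu u0; first by rewrite iintT0 !big_ord0.
rewrite (iintT_cons n m) /= big_ord_recl.
have K0 : 0 <= \prod_(i < n) \int[m (lift ord0 i)]_x (u (lift ord0 i) x)%:E.
  by apply: prode_ge0 => i _; apply: integral_ge0 => x _; rewrite lee_fin.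
transitivity (\int[m ord0]_x ((u ord0 x)%:E *
   \prod_(i < n) \int[m (lift ord0 i)]_x (u (lift ord0 i) x)%:E)); last first.
  rewrite ge0_integralZr//; first exact/measurable_EFinP.
  by move=> x _; rewrite lee_fin.
apply: eq_integral => x _.
rewrite -(IH (m \o lift ord0) (fun i => u (lift ord0 i)))//.
have mP := measurable_prod_tnth n (fun i => u (lift ord0 i)) (fun i => mu _).
rewrite -(integral_prod_measure n (m \o lift ord0))//; last 2 first.
  exact/measurable_EFinP.
  by move=> t; rewrite lee_fin prodr_ge0.
rewrite -ge0_integralZl//; last 3 first.
  exact/measurable_EFinP.
  by move=> t _; rewrite lee_fin prodr_ge0.
  by rewrite lee_fin.
rewrite (integral_prod_measure n (m \o lift ord0))//; last 2 first.
  apply: emeasurable_funM; first exact: measurable_cst.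
  exact/measurable_EFinP.
  by move=> t; rewrite mule_ge0// lee_fin ?prodr_ge0.
congr (iintT n _ _); apply/funext => t.
by rewrite prod_tnth_cons EFinM.
Qed.

End ProductMeasure.

End IteratedIntegral.

(** * Densities for a functional that agrees with an integral *)

Section Density.
Context {R : realType} {d} {T : measurableType d}.
Variables (M : {sigma_finite_measure set T -> \bar R}) (P : {finite_measure set T -> \bar R}).
Variable J : (T -> \bar R) -> \bar R.
Hypothesis JM : forall g, measurable_fun setT g -> (forall x, 0%E <= g x)%E ->
  J g = (\int[M]_x g x)%E.
Local Open Scope ereal_scope.

Lemma J_indic (p : T -> R) (A : set T) : measurable_fun setT p -> (forall x, 0 <= p x)%R ->
  measurable A -> J (fun x => (\1_A x * p x)%:E) = \int[M]_(x in A) (p x)%:E.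
Proof.
move=> mp p0 mA; rewrite JM; last 2 first.
- by apply/measurable_EFinP/measurable_funM.
- by move=> x; rewrite lee_fin mulr_ge0.
rewrite [RHS]integral_mkcond; apply: eq_integral => x _.
by rewrite restrict_EFin /= patchE indicE; case: ifP; rewrite ?mul1r ?mul0r.
Qed.

Lemma has_density_dominates (p : T -> R) : has_density d T J P p -> P `<< M.
Proof.
move=> [mp p0 PE]; apply/null_content_dominatesP => A mA MA0.
rewrite PE// J_indic// null_set_integral//.
by apply/measurable_EFinP; exact: measurable_funTS.
Qed.

Lemma dominates_has_density : P `<< M -> exists p, has_density d T J P p.
Proof.
move=> /radon_nikodym_sigma_finite[f [f0 ffin fint fE]].
have mf : measurable_fun setT f := measurable_int _ fint.
exists (fine \o f); split.
- exact: measurableT_comp.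
- by move=> x; rewrite /= fine_ge0.
move=> A mA; rewrite J_indic//=; last 2 first.
- exact: measurableT_comp.
- by move=> x; rewrite /= fine_ge0.
by rewrite fE//; apply: eq_integral => x _; rewrite /= fineK.
Qed.

(** [p] has the same integral as the Radon-Nikodym derivative over every measurable set, so the two
    agree almost everywhere, and the change of variables known for the derivative passes to [p]. *)
Lemma density_integral (p : T -> R) (f : T -> \bar R) : has_density d T J P p ->
  measurable_fun setT f -> (forall x, 0 <= f x) ->
  \int[P]_x f x = \int[M]_x ((p x)%:E * f x).
Proof.
move=> hp mf f0; have PM := has_density_dominates _ hp.
rewrite -(Radon_Nikodym_SigmaFinite.change_of_variables PM)//.
have [mp p0 PE] := hp.
have mRN := measurable_int _ (Radon_Nikodym_SigmaFinite.f_integrable PM).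
apply: ge0_ae_eq_integral => //.
- exact: emeasurable_funM.
- by apply: emeasurable_funM => //; exact/measurable_EFinP.
- by move=> x _; rewrite mule_ge0// Radon_Nikodym_SigmaFinite.f_ge0.
- by move=> x _; rewrite mule_ge0// lee_fin.
have : ae_eq M setT (Radon_Nikodym_SigmaFinite.f P M) (EFin \o p).
  apply: integral_ae_eq => //.
  - exact: Radon_Nikodym_SigmaFinite.f_integrable.
  - exact/measurable_EFinP.
  - by move=> E _ mE; rewrite -Radon_Nikodym_SigmaFinite.f_integral// PE// J_indic.
by apply: filterS => x H _; rewrite H// muleC.
Qed.

Lemma density_gt0 (p : T -> R) : has_density d T J P p -> P [set x | p x = 0%R] = 0.
Proof.
move=> [mp p0 PE].
have mA : measurable [set x | p x = 0%R].
  by rewrite -[X in measurable X]setTI; exact: (mp measurableT [set 0%R]).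
rewrite PE// J_indic//; apply: integral0_eq => x /= ->//.
Qed.

(** Passing from p ln p under the reference measure to ln p under [P] makes logarithms of products
    additive under one fixed measure. *)
Lemma int_xlogxE (p : T -> R) : has_density d T J P p ->
  int_xlogx d T J p = \int[P]_x (ln (p x))%:E.
Proof.
move=> hp; have [mp p0 PE] := hp.
have mln : measurable_fun setT (fun x => (ln (p x))%:E : \bar R).
  by apply/measurable_EFinP; exact: measurableT_comp.
have mpln : measurable_fun setT (fun x => p x * ln (p x))%R.
  by apply: measurable_funM => //; exact: measurableT_comp.
rewrite [RHS]integralE (density_integral _ _ hp)//; last exact: measurable_funepos.
rewrite (density_integral _ _ hp)//; last exact: measurable_funeneg.
rewrite /int_xlogx JM; last 2 first.
- by apply/measurable_EFinP; exact: measurable_maxr.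
- by move=> x; rewrite lee_fin le_max lexx orbT.
rewrite JM; last 2 first.
- by apply/measurable_EFinP; apply: measurable_maxr => //; exact: measurableT_comp.
- by move=> x; rewrite lee_fin le_max lexx orbT.
congr (_ - _); apply: eq_integral => x _.
- by rewrite funeposE -EFin_max -EFinM maxr_pMr// mulr0.
- by rewrite funenegE -EFin_max -EFinM maxr_pMr// mulr0 mulrN.
Qed.

(** [entropy] and [relent] pick some density by choice; this makes their values independent of the
    pick. *)
Lemma density_integral_ln (p p' : T -> R) :
  has_density d T J P p -> has_density d T J P p' ->
  \int[P]_x (ln (p x))%:E = \int[P]_x (ln (p' x))%:E.
Proof.
move=> hp hp'; have [mp p0 PE] := hp; have [mp' p0' PE'] := hp'.
have PM := has_density_dominates _ hp.
have intp : M.-integrable setT (EFin \o p).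
  apply/integrableP; split; first exact/measurable_EFinP.
  rewrite (eq_integral (EFin \o p)); last first.
    by move=> x _ /=; rewrite ger0_norm.
  by rewrite -(J_indic _ setT)// -PE// ltey_eq fin_num_measure.
have /(null_dominates_ae_eq measurableT PM) pp' : ae_eq M setT (EFin \o p) (EFin \o p').
  apply: integral_ae_eq => //; first exact/measurable_EFinP.
  by move=> E _ mE; rewrite -J_indic// -PE// PE'// J_indic.
apply: ae_eq_integral => //.
- by apply/measurable_EFinP; exact: measurableT_comp.
- by apply/measurable_EFinP; exact: measurableT_comp.
by apply: filterS pp' => x /(_ I) [->].
Qed.

Lemma relentE (p : T -> R) : has_density d T J P p ->
  relent d T J P = \int[P]_x (ln (p x))%:E.
Proof.
move=> hp; rewrite /relent; case: pselect => [h|]; last by case; exists p.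
case: (cid h) => /= p' hp'.
by rewrite int_xlogxE//; exact: density_integral_ln.
Qed.

Lemma entropyE (p : T -> R) : has_density d T J P p ->
  entropy d T J P = - \int[P]_x (ln (p x))%:E.
Proof.
move=> hp; rewrite /entropy; case: pselect => [h|]; last by case; exists p.
case: (cid h) => /= p' hp'; congr (- _).
by rewrite int_xlogxE//; exact: density_integral_ln.
Qed.

Lemma entropy_no_density : ~ (exists p, has_density d T J P p) ->
  entropy d T J P = -oo.
Proof. by move=> h; rewrite /entropy; case: pselect. Qed.

Lemma relent_no_density : ~ (exists p, has_density d T J P p) ->
  relent d T J P = +oo.
Proof. by move=> h; rewrite /relent; case: pselect. Qed.

(** The integral is at most the reference mass of [D], because p max (- ln p, 0) <= 1 pointwise, by
    ln p >= 1 - 1/p. This is what excludes oo - oo later. *)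
Lemma density_ln_neg_lty (p : T -> R) (D : set T) : has_density d T J P p ->
  measurable D -> M D < +oo -> P (~` D) = 0 ->
  \int[P]_x (fun x => (ln (p x))%:E)^\- x < +oo.
Proof.
move=> hp mD MD PD; have [mp p0 PE] := hp.
have mln : measurable_fun setT (fun x => (ln (p x))%:E : \bar R).
  by apply/measurable_EFinP; exact: measurableT_comp.
have mneg := measurable_funeneg mln.
have m1 : measurable_fun setT (fun x => (\1_D x)%:E : \bar R).
  exact/measurable_EFinP.
rewrite (@ge0_ae_eq_integral _ _ _ P setT _
   (fun x => (\1_D x)%:E * (fun x => (ln (p x))%:E)^\- x))//; last 3 first.
- exact: emeasurable_funM.
- by move=> x _; rewrite mule_ge0// lee_fin.
- exists (~` D); split => //; first exact: measurableC.
  move=> x /= H Dx; apply: H => _.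
  by rewrite indicE mem_set// mul1e.
rewrite (density_integral _ _ hp); last 2 first.
- exact: emeasurable_funM.
- by move=> x; rewrite mule_ge0// lee_fin.
apply: (@le_lt_trans _ _ (\int[M]_x (\1_D x)%:E)); last by rewrite integral_indic// setIT.
apply: ge0_le_integral => //.
- by move=> x _; rewrite !mule_ge0// lee_fin.
- by apply: emeasurable_funM; [exact/measurable_EFinP|exact: emeasurable_funM].
move=> x _; rewrite funenegE -EFin_max muleCA.
suff: (\1_D x * (p x * Num.max (- ln (p x)) 0) <= \1_D x)%R by rewrite -lee_fin.
rewrite -[leRHS]mulr1 ler_wpM2l// maxr_pMr// mulr0 ge_max ler01 andbT.
have := p0 x; rewrite le_eqVlt => /orP[/eqP <-|px]; first by rewrite mul0r.
have := ln_ge_1subV _ px.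
rewrite -(ler_pM2l px) mulrBr mulfV ?gt_eqF//; lra.
Qed.

End Density.

(** * Additivity of integrals with finite negative part *)

Section IntegralNeg.
Context {R : realType} {d} {T : measurableType d} (P : {measure set T -> \bar R}).
Local Open Scope ereal_scope.

Definition neg_finite (f : T -> R) : Prop :=
  measurable_fun setT f /\ \int[P]_x (fun x => (f x)%:E)^\- x < +oo.

Lemma neg_finite_gtNy (f : T -> R) : neg_finite f -> -oo < \int[P]_x (f x)%:E.
Proof.
move=> [mf fn]; rewrite integralE.
have : 0 <= \int[P]_x (fun x => (f x)%:E)^\- x by exact: integral_ge0.
have : 0 <= \int[P]_x (fun x => (f x)%:E)^\+ x by exact: integral_ge0.
move: fn; case: (\int[P]_x (fun x => (f x)%:E)^\- x) => [a| |]//.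
by case: (\int[P]_x (fun x => (f x)%:E)^\+ x) => [b| |]// _ _ _; rewrite -EFinN -EFinD ltNyr.
Qed.

Lemma neg_finiteD (f g : T -> R) : neg_finite f -> neg_finite g ->
  neg_finite (f \+ g)%R /\
  \int[P]_x (f x + g x)%:E = \int[P]_x (f x)%:E + \int[P]_x (g x)%:E.
Proof.
move=> [mf fn] [mg gn].
have mfg : measurable_fun setT (f \+ g)%R by exact: measurable_funD.
have Ef := proj2 (measurable_EFinP setT f) mf.
have Eg := proj2 (measurable_EFinP setT g) mg.
have Efg := proj2 (measurable_EFinP setT (f \+ g)%R) mfg.
have fgn : \int[P]_x (fun x => (f x + g x)%:E)^\- x < +oo.
  apply: (@le_lt_trans _ _ (\int[P]_x ((fun x => (f x)%:E)^\- x + (fun x => (g x)%:E)^\- x))).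
    apply: ge0_le_integral => //.
    - exact: measurable_funeneg.
    - by apply: emeasurable_funD; exact: measurable_funeneg.
    move=> x _; rewrite !funenegE -!EFin_max -EFinD lee_fin.
    by case: (lerP (- (f x + g x)) 0); case: (lerP (- f x) 0);
       case: (lerP (- g x) 0) => *; lra.
  rewrite ge0_integralD//; [|exact: measurable_funeneg|exact: measurable_funeneg].
  by rewrite lte_add_pinfty.
split; first by split.
rewrite [LHS]integralE [X in _ = X + _]integralE [X in _ = _ + X]integralE.
(* The subtraction-free form of f + g = (f + g), whose terms are all nonnegative; the possible
   values +oo are then separated by cases. *)
have : \int[P]_x (fun x => (f x + g x)%:E)^\+ x +
    (\int[P]_x (fun x => (f x)%:E)^\- x + \int[P]_x (fun x => (g x)%:E)^\- x) =
    \int[P]_x (fun x => (f x + g x)%:E)^\- x +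
    (\int[P]_x (fun x => (f x)%:E)^\+ x + \int[P]_x (fun x => (g x)%:E)^\+ x).
  rewrite -!ge0_integralD//; do ?[exact: measurable_funeneg|exact: measurable_funepos|by move=> x _; rewrite adde_ge0|by apply: emeasurable_funD; first [exact: measurable_funeneg|exact: measurable_funepos]].
  apply: eq_integral => x _; rewrite !funenegE !funeposE -!EFin_max -!EFinD; congr EFin.
  by case: (lerP (- (f x + g x)) 0); case: (lerP (- f x) 0); case: (lerP (- g x) 0);
     case: (lerP (f x + g x) 0); case: (lerP (f x) 0); case: (lerP (g x) 0) => *; lra.
have : 0 <= \int[P]_x (fun x => (f x)%:E)^\- x by exact: integral_ge0.
have : 0 <= \int[P]_x (fun x => (g x)%:E)^\- x by exact: integral_ge0.
have : 0 <= \int[P]_x (fun x => (f x + g x)%:E)^\- x by exact: integral_ge0.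
have : 0 <= \int[P]_x (fun x => (f x)%:E)^\+ x by exact: integral_ge0.
have : 0 <= \int[P]_x (fun x => (g x)%:E)^\+ x by exact: integral_ge0.
have : 0 <= \int[P]_x (fun x => (f x + g x)%:E)^\+ x by exact: integral_ge0.
move: fn gn fgn.
case: (\int[P]_x (fun x => (f x)%:E)^\- x) => [a| |]//.
case: (\int[P]_x (fun x => (g x)%:E)^\- x) => [b| |]//.
case: (\int[P]_x (fun x => (f x + g x)%:E)^\- x) => [c| |]//.
case: (\int[P]_x (fun x => (f x)%:E)^\+ x) => [a'| |]//;
case: (\int[P]_x (fun x => (g x)%:E)^\+ x) => [b'| |]//;
case: (\int[P]_x (fun x => (f x + g x)%:E)^\+ x) => [c'| |]//.
by move=> _ _ _ _ _ _ _ _ _ -[H]; rewrite -!EFinN -!EFinD; congr EFin; lra.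
Qed.

Lemma neg_finite_sum (I : Type) (s : seq I) (f : I -> T -> R) :
  (forall i, neg_finite (f i)) ->
  neg_finite (fun x => \sum_(i <- s) f i x)%R /\
  \int[P]_x (\sum_(i <- s) f i x)%:E = \sum_(i <- s) \int[P]_x (f i x)%:E.
Proof.
move=> nf; elim: s => [|i s [nS IH]].
  rewrite big_nil; split.
    rewrite (_ : (fun x => _) = cst 0%R); last by apply/funext => x; rewrite big_nil.
    split; first exact: measurable_cst.
    by rewrite integral0_eq// => x _; rewrite funenegE /= oppr0 maxxx.
  by rewrite integral0_eq// => x _; rewrite big_nil.
rewrite (_ : (fun x => _) = (f i \+ (fun x => \sum_(i <- s) f i x))%R); last first.
  by apply/funext => x; rewrite big_cons.
have [h1 h2] := neg_finiteD _ _ (nf i) nS; split => //.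
rewrite big_cons -IH -h2; apply: eq_integral => x _.
by rewrite big_cons.
Qed.

End IntegralNeg.

Section LebesgueDefaultDisplay.
Context {R : realType}.
Local Open Scope ereal_scope.

(* [lebesgue_measure] lives on [measurableTypeR R]; this is the same set function
   on the canonical measurable structure of [R], which has another display. *)
Definition lebR : set R -> \bar R := lebesgue_measure.

Let measurable_id_R : measurable_fun setT (id : measurableTypeR R -> R).
Proof. by move=> _ Y mY; rewrite setTI. Qed.

Let lebR0 : lebR set0 = 0.
Proof. exact: measure0. Qed.

Let lebR_ge0 A : 0 <= lebR A.
Proof. exact: measure_ge0. Qed.

Let lebR_sigma_additive : semi_sigma_additive lebR.
Proof. by move=> F mF tF mUF; exact: (@measure_semi_sigma_additive _ _ _ (@lebesgue_measure R)). Qed.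

HB.instance Definition _ := isMeasure.Build _ R _ lebR
  lebR0 lebR_ge0 lebR_sigma_additive.

Let lebR_sigma_finite : sigma_finite setT lebR.
Proof.
have [F TF Ffin] : sigma_finite setT (@lebesgue_measure R) by exact: sigma_finiteT.
by exists F.
Qed.

HB.instance Definition _ := Measure_isSigmaFinite.Build _ R _ lebR lebR_sigma_finite.

Lemma leb1_integral (g : R -> \bar R) : measurable_fun setT g ->
  (forall x, 0 <= g x) -> leb1 g = \int[lebR]_x g x.
Proof.
move=> mg g0.
have := ge0_integral_pushforward measurable_id_R (@lebesgue_measure R) measurableT mg (fun x _ => g0 x).
by rewrite preimage_setT => /esym H; exact: H.
Qed.

End LebesgueDefaultDisplay.

(** * Marginals and their product *)

Section Marginals.
Context {R : realType} (n : nat) (mu : probability (n.-tuple R) R).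
Local Open Scope ereal_scope.

Definition tnth_coord (i : 'I_n) (x : n.-tuple R) : R := tnth x i.

HB.instance Definition _ (i : 'I_n) :=
  isMeasurableFun.Build _ _ _ _ (tnth_coord i) (measurable_tnth i).

Definition margp (i : 'I_n) : probability R R := distribution mu (tnth_coord i).

Definition lebp : {sigma_finite_measure set (n.-tuple R) -> \bar R} :=
  prod_measure n (fun=> lebR).

Definition margprod : {sigma_finite_measure set (n.-tuple R) -> \bar R} :=
  prod_measure n margp.

Lemma lebT_integral (g : n.-tuple R -> \bar R) : measurable_fun setT g ->
  (forall x, 0 <= g x) -> lebT n g = \int[lebp]_x g x.
Proof.
move=> mg g0; rewrite integral_prod_measure// /lebT; congr iintT.
by rewrite -[n in nseq n _](size_enum_ord n); elim: (enum _) => //= _ s <-.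
Qed.

Lemma prodmargT_integral (g : n.-tuple R -> \bar R) : measurable_fun setT g ->
  (forall x, 0 <= g x) -> prodmargT n mu g = \int[margprod]_x g x.
Proof. by move=> mg g0; rewrite integral_prod_measure. Qed.

Lemma margprod_rect (B : 'I_n -> set R) : (forall i, measurable (B i)) ->
  margprod [set x | forall i, B i (tnth x i)] = \prod_(i < n) marg n mu i (B i).
Proof.
move=> mB.
have mrect : measurable [set x : n.-tuple R | forall i, B i (tnth x i)].
  rewrite (_ : [set x | _] = \bigcap_(i in [set: 'I_n]) (tnth_coord i @^-1` B i)); last first.
    by apply/seteqP; split => x /= h i; [move=> _; exact: h|exact: h].
  apply: fin_bigcap_measurable => // i _.
  by rewrite -[X in measurable X]setTI; exact: measurable_tnth.
rewrite -[in LHS](setIT [set x | _]) -integral_indic//.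
rewrite integral_prod_measure//; last first.
  by apply/measurable_EFinP; exact: measurable_indic.
transitivity (\prod_(i < n) \int[margp i]_x (\1_(B i) x)%:E); last first.
  by apply: eq_bigr => i _; rewrite integral_indic// setIT.
rewrite -(iintT_prod n margp (fun i => \1_(B i)))//.
congr (iintT n _ _); apply/funext => x; congr EFin.
rewrite indicE; case: (boolP (x \in _)) => [|/negP h].
  by rewrite inE /= => h; rewrite big1// => i _; rewrite indicE mem_set.
have [i hi] : exists i, ~ B i (tnth x i).
  by apply/existsNP => hB; apply: h; rewrite inE.
by rewrite (bigD1 i)//= indicE memNset// mul0r.
Qed.

(** The other factors are infinite; the cylinder is null thanks to the convention 0 * oo = 0. *)
Lemma lebp_cylinder0 (i : 'I_n) (B : set R) : measurable B ->
  lebR B = 0 -> lebp [set x | B (tnth x i)] = 0.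
Proof.
move=> mB B0.
have mc : measurable [set x : n.-tuple R | B (tnth x i)].
  by rewrite -[X in measurable X]setTI; exact: measurable_tnth.
rewrite -[in LHS](setIT [set x | _]) -integral_indic//.
rewrite integral_prod_measure//; last first.
  by apply/measurable_EFinP; exact: measurable_indic.
pose u (j : 'I_n) : R -> R := if j == i then \1_B else cst 1%R.
have mu_ j : measurable_fun setT (u j).
  by rewrite /u; case: ifP => _; [exact: measurable_indic|exact: measurable_cst].
have u0 j x : (0 <= u j x)%R by rewrite /u; case: ifP.
transitivity (\prod_(j < n) \int[lebR]_x (u j x)%:E); last first.
  rewrite (bigD1 i)//= [X in X * _](_ : _ = 0) ?mul0e//.
  by rewrite /u eqxx integral_indic// setIT.
rewrite -(iintT_prod n (fun=> lebR) u)//.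
congr (iintT n _ _); apply/funext => x; congr EFin.
rewrite (bigD1 i)//= big1; last by move=> j /negbTE ji; rewrite /u ji.
by rewrite /u eqxx mulr1.
Qed.

End Marginals.

Section OppSum.
Context {R : realType}.
Local Open Scope ereal_scope.

(** The sum of +oo and -oo is -oo by convention, so negation is not additive on mixed infinities. *)
Lemma oppe_addNy (x y : \bar R) : x != -oo -> y != -oo -> - (x + y) = - x - y.
Proof. by case: x => [x| |]; case: y => [y| |]//= _ _; rewrite opprD. Qed.

Lemma sume_neqNy (I : Type) (s : seq I) (x : I -> \bar R) : (forall i, x i != -oo) ->
  \sum_(i <- s) x i != -oo.
Proof.
move=> xN; elim: s => [|i s IH]; first by rewrite big_nil.
by rewrite big_cons adde_eq_ninfty negb_or xN.
Qed.

Lemma sumeN_neqNy (I : Type) (s : seq I) (x : I -> \bar R) : (forall i, x i != -oo) ->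
  \sum_(i <- s) - x i = - \sum_(i <- s) x i.
Proof.
move=> xN; elim: s => [|i s IH]; first by rewrite !big_nil oppe0.
by rewrite !big_cons IH oppe_addNy// sume_neqNy.
Qed.

End OppSum.

(** * The chain rule for the entropy *)

Section EntropyIdentity.
Context {R : realType} (r : R) (n : nat) (mu : probability (n.-tuple R) R).
Hypothesis mu_box : mu (box r n) = 1%E.
Local Open Scope ereal_scope.

Let has_leb (p : n.-tuple R -> R) := has_density _ _ (lebT n) mu p.
Let has_leb1 i (p : R -> R) := has_density _ _ leb1 (marg n mu i) p.

Lemma measurable_box : measurable (box r n).
Proof.
rewrite (_ : box r n = \bigcap_(i in [set: 'I_n]) (tnth_coord n i @^-1` `[(- r)%R, r])); last first.
  by apply/seteqP; split => x /= h i; [move=> _|]; have := h i; rewrite /= in_itv/= => ->.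
apply: fin_bigcap_measurable => // i _.
by rewrite -[X in measurable X]setTI; exact: measurable_tnth.
Qed.

Lemma marg_boxC (i : 'I_n) : marg n mu i (~` `[(- r)%R, r]) = 0.
Proof.
have H : mu (~` box r n) = 0.
  by rewrite probability_setC ?mu_box ?subee//; exact: measurable_box.
apply: (@subset_measure0 _ _ _ mu (fun x => (~` `[(- r)%R, r]) (tnth x i)) (~` box r n)) => //.
- by rewrite -[X in measurable X]setTI; apply: measurable_tnth => //; exact: measurableC.
- by apply: measurableC; exact: measurable_box.
- by move=> x /= h b; apply: h; rewrite /= in_itv/=; exact: b.
Qed.

Lemma marg_dominates (p : n.-tuple R -> R) (i : 'I_n) : has_leb p ->
  margp n mu i `<< lebR.
Proof.
move=> hp; apply/null_content_dominatesP => B mB B0.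
have /null_content_dominatesP := has_density_dominates (lebp n) mu _ (lebT_integral n) _ hp.
apply; last exact: lebp_cylinder0.
by rewrite -[X in measurable X]setTI; exact: measurable_tnth.
Qed.

Let has_rel (f : n.-tuple R -> R) := has_density _ _ (prodmargT n mu) mu f.

Lemma margprod_density (p_ : 'I_n -> R -> R) : (forall i, has_leb1 i (p_ i)) ->
  forall g, measurable_fun setT g -> (forall x, 0 <= g x) ->
  \int[margprod n mu]_x g x = \int[lebp n]_x ((\prod_(i < n) p_ i (tnth x i))%:E * g x).
Proof.
move=> hp_ g mg g0.
have mp_ i : measurable_fun setT (p_ i) by have [] := hp_ i.
have p_0 i x : (0 <= p_ i x)%R by have [_ + _] := hp_ i; exact.
rewrite integral_prod_measure// integral_prod_measure//; last 2 first.
- apply: emeasurable_funM => //; apply/measurable_EFinP.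
  exact: measurable_prod_tnth.
- by move=> x; rewrite mule_ge0// lee_fin prodr_ge0.
apply: iintT_density => // i f mf f0.
exact: (density_integral lebR (margp n mu i) _ leb1_integral _ _ (hp_ i)).
Qed.

Lemma marg_gt0 (p_ : 'I_n -> R -> R) : (forall i, has_leb1 i (p_ i)) ->
  {ae mu, forall x, forall i, (0 < p_ i (tnth x i))%R}.
Proof.
move=> hp_.
have H i : {ae mu, forall x, (0 < p_ i (tnth x i))%R}.
  have [mp_ p_0 _] := hp_ i.
  have m0 : measurable [set x | p_ i x = 0%R].
    by rewrite -[X in measurable X]setTI; exact: (mp_ measurableT [set 0%R]).
  exists [set x : n.-tuple R | p_ i (tnth x i) = 0%R]; split.
  - by rewrite -[X in measurable X]setTI; exact: (measurable_tnth i measurableT m0).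
  - exact: (density_gt0 lebR (margp n mu i) _ leb1_integral _ (hp_ i)).
  - move=> x /= /negP; rewrite -leNgt => h; apply/eqP.
    by rewrite eq_le h p_0.
by apply: filter_forall.
Qed.

Lemma leb_rel_density (p_ : 'I_n -> R -> R) (f : n.-tuple R -> R) :
  (forall i, has_leb1 i (p_ i)) -> has_rel f ->
  has_leb (fun x => \prod_(i < n) p_ i (tnth x i) * f x)%R.
Proof.
move=> hp_ [mf f0 fE].
have mp_ i : measurable_fun setT (p_ i) by have [] := hp_ i.
have p_0 i x : (0 <= p_ i x)%R by have [_ + _] := hp_ i; exact.
have mprod := measurable_prod_tnth n p_ mp_.
split.
- exact: measurable_funM.
- by move=> x; rewrite mulr_ge0// prodr_ge0.
move=> A mA; rewrite fE// prodmargT_integral; last 2 first.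
- by apply/measurable_EFinP/measurable_funM.
- by move=> x; rewrite lee_fin mulr_ge0.
rewrite (margprod_density p_)//; last 2 first.
- by apply/measurable_EFinP/measurable_funM.
- by move=> x; rewrite lee_fin mulr_ge0.
rewrite lebT_integral; last 2 first.
- by apply/measurable_EFinP; do 2 apply: measurable_funM => //.
- by move=> x; rewrite lee_fin !mulr_ge0// prodr_ge0.
by apply: eq_integral => x _; rewrite -EFinM mulrCA.
Qed.

Lemma measurable_pos (q : n.-tuple R -> R) : measurable_fun setT q ->
  measurable [set x | (0 < q x)%R].
Proof.
move=> mq; rewrite (_ : [set x | _] = setT `&` q @^-1` `]0%R, +oo[); last first.
  by rewrite setTI; apply/seteqP; split => x /=; rewrite in_itv/= andbT.
exact: mq.
Qed.

(** The density is p divided by the product of the [p_ i], written with [expR] and [ln] for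
    measurability by composition. Its value where the product vanishes does not matter: Q has
    density 0 there, and [mu] does not charge that set. *)
Lemma rel_leb_density (p_ : 'I_n -> R -> R) (p : n.-tuple R -> R) :
  (forall i, has_leb1 i (p_ i)) -> has_leb p ->
  has_rel (fun x => p x * expR (- ln (\prod_(i < n) p_ i (tnth x i))))%R.
Proof.
move=> hp_ hp; have [mp p0 pE] := hp.
have mp_ i : measurable_fun setT (p_ i) by have [] := hp_ i.
have p_0 i x : (0 <= p_ i x)%R by have [_ + _] := hp_ i; exact.
have mprod := measurable_prod_tnth n p_ mp_.
set q := fun x : n.-tuple R => (\prod_(i < n) p_ i (tnth x i))%R.
have q0 x : (0 <= q x)%R by exact: prodr_ge0.
have mf : measurable_fun setT (fun x => p x * expR (- ln (q x)))%R.
  apply: measurable_funM => //; apply: measurableT_comp => //.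
  by apply: measurableT_comp => //; apply: measurableT_comp.
have f0 x : (0 <= p x * expR (- ln (q x)))%R by rewrite mulr_ge0// expR_ge0.
split => // A mA.
rewrite prodmargT_integral; last 2 first.
- by apply/measurable_EFinP/measurable_funM.
- by move=> x; rewrite lee_fin mulr_ge0.
rewrite (margprod_density p_)//; last 2 first.
- by apply/measurable_EFinP/measurable_funM.
- by move=> x; rewrite lee_fin mulr_ge0.
pose B := [set x | (0 < q x)%R].
have mB : measurable B by exact: measurable_pos.
have muB : mu A = mu (A `&` B).
  rewrite (measureDI mu mA mB) [X in X + _ = _](_ : _ = 0) ?add0e//.
  apply: measure_negligible; first exact: measurableD.
  apply: negligibleS (marg_gt0 p_ hp_) => x [_ Bx] /= h; apply: Bx.
  by apply: prodr_gt0 => i _; exact: h.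
rewrite muB pE; last exact: measurableI.
rewrite lebT_integral; last 2 first.
- by apply/measurable_EFinP; apply: measurable_funM => //; apply: measurable_indic; exact: measurableI.
- by move=> x; rewrite lee_fin !mulr_ge0.
apply: eq_integral => x _; rewrite -EFinM; congr EFin.
rewrite indicI /=; have := q0 x; rewrite le_eqVlt => /orP[/eqP e|qx].
  by rewrite -/(q x) -e mul0r [\1_B x]indicE memNset ?mulr0 ?mul0r// /B /= -e ltxx.
rewrite [\1_B x]indicE mem_set// mulr1 -/(q x) expRN lnK ?posrE//.
by field; rewrite gt_eqF.
Qed.

Lemma margprod_setT : margprod n mu setT = 1.
Proof.
have -> : setT = [set x : n.-tuple R | forall i : 'I_n, (fun=> [set: R]) i (tnth x i)].
  by apply/seteqP; split.
rewrite (margprod_rect n mu (fun=> setT))// big1// => i _.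
exact: (probability_setT (margp n mu i)).
Qed.

Lemma relent_ln_neg_finite (f : n.-tuple R -> R) : has_rel f ->
  neg_finite mu (fun x => ln (f x)).
Proof.
move=> hf; have [mf _ _] := hf; split; first exact: measurableT_comp.
apply: (density_ln_neg_lty (margprod n mu) mu _ (prodmargT_integral n mu) _ setT hf) => //.
  by rewrite margprod_setT ltry.
by rewrite setCT measure0.
Qed.

Lemma integral_marg (g : R -> R) (i : 'I_n) : measurable_fun setT g ->
  \int[margp n mu i]_x (g x)%:E = \int[mu]_x (g (tnth x i))%:E.
Proof.
move=> mg; have mEg := proj2 (measurable_EFinP setT g) mg.
have T : measurable_fun setT (fun x : n.-tuple R => tnth x i) by exact: measurable_tnth.
have E (h : R -> \bar R) : measurable_fun setT h -> (forall x, 0 <= h x) ->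
    \int[margp n mu i]_x h x = \int[mu]_x h (tnth x i).
  by move=> mh h0; have := ge0_integral_pushforward T mu measurableT mh (fun x _ => h0 x);
     rewrite preimage_setT.
rewrite integralE [RHS]integralE; congr (_ - _).
- rewrite E//; last exact: measurable_funepos.
  by apply: eq_integral => x _; rewrite !funeposE.
- rewrite E//; last exact: measurable_funeneg.
  by apply: eq_integral => x _; rewrite !funenegE.
Qed.

(** Lebesgue measure on the line is infinite; the bounded support supplies the set [[- r, r]] of
    finite measure. *)
Lemma marg_ln_neg_finite (p : R -> R) (i : 'I_n) : has_leb1 i p ->
  neg_finite mu (fun x => ln (p (tnth x i))).
Proof.
move=> hp; have [mp _ _] := hp.
have mlnp : measurable_fun setT (fun x => ln (p x)) by exact: measurableT_comp.
split; first exact: (measurableT_comp mlnp (measurable_tnth i)).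
have := density_ln_neg_lty lebR (margp n mu i) _ leb1_integral _ `[(- r)%R, r]%classic hp.
have T : measurable_fun setT (fun x : n.-tuple R => tnth x i) by exact: measurable_tnth.
rewrite (ge0_integral_pushforward T) ?preimage_setT//; last first.
  by apply: measurable_funeneg; exact/measurable_EFinP.
rewrite (eq_integral (fun x : n.-tuple R => (fun x : n.-tuple R => (ln (p (tnth x i)))%:E)^\- x)); last first.
  by move=> x _; rewrite /= !funenegE.
apply => //; last exact: marg_boxC.
by rewrite [X in X < _]lebesgue_measure_itv/=; case: ifP => //; rewrite ?ltry// -EFinB ltry.
Qed.

(** If a marginal has no density then neither has [mu], and -oo absorbs the right side. If the
    marginals have densities and [mu] has none, then [mu] has no density with respect to Q either,
    and S = +oo. Only the remaining case uses the chain rule. *)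
Lemma entropy_identity :
  entropy _ _ (lebT n) mu =
  - relent _ _ (prodmargT n mu) mu + \sum_(i < n) entropy _ _ leb1 (marg n mu i).
Proof.
have [[p_ hp_]|no_p] := pselect (exists p_, forall i, has_leb1 i (p_ i)); last first.
  have [i hi] : exists i, ~ exists p, has_leb1 i p.
    by apply/existsNP => /choice[p_ hp_]; apply: no_p; exists p_.
  have Hi : entropy _ _ leb1 (marg n mu i) = -oo by exact: (entropy_no_density (margp n mu i)).
  have -> : \sum_(i < n) entropy _ _ leb1 (marg n mu i) = -oo.
    by rewrite (bigD1 i)//= Hi addNye.
  rewrite addeNy; apply: entropy_no_density => -[p hp]; apply: hi.
  apply: (dominates_has_density lebR (margp n mu i) _ leb1_integral).
  exact: marg_dominates hp.
have Hm i : entropy _ _ leb1 (marg n mu i) = - \int[mu]_x (ln (p_ i (tnth x i)))%:E.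
  transitivity (- \int[margp n mu i]_x (ln (p_ i x))%:E).
    exact: (entropyE lebR (margp n mu i) _ leb1_integral _ (hp_ i)).
  congr (- _); apply: (integral_marg (fun x => ln (p_ i x))).
  by have [mp _ _] := hp_ i; exact: measurableT_comp.
have nfm i := marg_ln_neg_finite (p_ i) i (hp_ i).
have [[p hp]|no] := pselect (exists p, has_leb p); last first.
  have -> : entropy _ _ (lebT n) mu = -oo by exact: (entropy_no_density mu).
  have -> : relent _ _ (prodmargT n mu) mu = +oo.
    apply: (relent_no_density mu) => -[f hf]; apply: no.
    by eexists; exact: (leb_rel_density p_ f).
  by rewrite addNye.
have hf := rel_leb_density p_ p hp_ hp; set f := fun x => _ in hf.
have nff := relent_ln_neg_finite f hf.
rewrite (entropyE (lebp n) mu _ (lebT_integral n) p)//.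
rewrite (relentE (margprod n mu) mu _ (prodmargT_integral n mu) f)//.
have [nfS IS] := neg_finite_sum mu _ (index_enum 'I_n) (fun i x => ln (p_ i (tnth x i))) nfm.
have [_ ID] := neg_finiteD mu _ _ nff nfS.
(* The logarithm splits only where [p] and all the [p_ i] are positive, a set of full [mu]
   measure. *)
have -> : \int[mu]_x (ln (p x))%:E =
    \int[mu]_x (ln (f x) + \sum_(i < n) ln (p_ i (tnth x i)))%:E.
  apply: ae_eq_integral => //.
  - by apply/measurable_EFinP; have [mp _ _] := hp; exact: measurableT_comp.
  - apply/measurable_EFinP; apply: measurable_funD; [exact: nff.1|exact: nfS.1].
  have [mp p0 _] := hp.
  have : {ae mu, forall x, (0 < p x)%R}.
    have m0 : measurable [set x | p x = 0%R].
      by rewrite -[X in measurable X]setTI; exact: (mp measurableT [set 0%R]).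
    exists [set x | p x = 0%R]; split => //.
      exact: (density_gt0 (lebp n) mu _ (lebT_integral n) _ hp).
    by move=> x /= /negP; rewrite -leNgt => h; apply/eqP; rewrite eq_le h p0.
  have := marg_gt0 p_ hp_.
  apply: filterS2 => x pi0 px _; congr EFin.
  rewrite /f lnM ?posrE ?expR_gt0// expRK ln_prod ?subrK//.
rewrite ID IS.
have SNy := neg_finite_gtNy _ _ nff.
have INy i := neg_finite_gtNy _ _ (nfm i).
rewrite (eq_bigr _ (fun i _ => Hm i)) sumeN_neqNy; last by move=> i; rewrite -ltNye.
by rewrite oppe_addNy// -?ltNye// ltNye sume_neqNy// => i; rewrite -ltNye.
Qed.

End EntropyIdentity.

(** * The Donsker-Varadhan formula over a class of test functions *)

Section Bounded.
Context {R : realType} {d} {T : measurableType d} (P : probability T R).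

(** A class that is integrable for every probability at once, so that [mu], Q and the marginals are
    treated alike, with real integrals. *)
Definition bounded_meas (f : T -> R) : Prop :=
  measurable_fun setT f /\ exists K : R, forall x, `|f x| <= K.

Lemma bounded_meas_int (f : T -> R) : bounded_meas f -> P.-integrable setT (EFin \o f).
Proof.
move=> [mf [K fK]]; apply: measurable_bounded_integrable => //.
  by rewrite -ge0_fin_numE// fin_num_measure.
exists K; split; first exact: num_real.
by move=> M KM x _ /=; rewrite (le_trans (fK x))// ltW.
Qed.

Lemma bounded_meas_cst (c : R) : bounded_meas (fun=> c).
Proof. by split; [exact: measurable_cst|exists `|c|]. Qed.

Lemma bounded_measD (f g : T -> R) : bounded_meas f -> bounded_meas g ->
  bounded_meas (fun x => f x + g x).
Proof.
move=> [mf [K fK]] [mg [L gL]]; split; first exact: measurable_funD.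
by exists (K + L) => x; rewrite (le_trans (ler_normD _ _))// lerD.
Qed.

Lemma bounded_measM (f g : T -> R) : bounded_meas f -> bounded_meas g ->
  bounded_meas (fun x => f x * g x).
Proof.
move=> [mf [K fK]] [mg [L gL]]; split; first exact: measurable_funM.
by exists (K * L) => x; rewrite normrM ler_pM.
Qed.

Lemma bounded_measZ (c : R) (f : T -> R) : bounded_meas f -> bounded_meas (fun x => c * f x).
Proof. by move=> bf; apply: bounded_measM => //; exact: bounded_meas_cst. Qed.

Lemma bounded_measN (f : T -> R) : bounded_meas f -> bounded_meas (fun x => - f x).
Proof.
move=> [mf [K fK]]; split; first exact: measurableT_comp.
by exists K => x; rewrite normrN.
Qed.

Lemma bounded_measB (f g : T -> R) : bounded_meas f -> bounded_meas g ->
  bounded_meas (fun x => f x - g x).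
Proof. by move=> hf hg; apply: bounded_measD => //; exact: bounded_measN. Qed.

Lemma bounded_meas_norm (f : T -> R) : bounded_meas f -> bounded_meas (fun x => `|f x|).
Proof.
move=> [mf [K fK]]; split; first exact: measurableT_comp.
by exists K => x; rewrite normr_id.
Qed.

Lemma bounded_meas_expR (f : T -> R) : bounded_meas f -> bounded_meas (fun x => expR (f x)).
Proof.
move=> [mf [K fK]]; split; first exact: measurableT_comp.
exists (expR K) => x; rewrite ger0_norm ?expR_ge0// ler_expR.
by rewrite (le_trans (ler_norm _)).
Qed.

Lemma bounded_meas_sum (I : Type) (s : seq I) (f : I -> T -> R) :
  (forall i, bounded_meas (f i)) -> bounded_meas (fun x => \sum_(i <- s) f i x).
Proof.
move=> bf; elim: s => [|i s IH].
  by rewrite (_ : (fun=> _) = (fun=> 0)); [exact: bounded_meas_cst|apply/funext => x; rewrite big_nil].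
rewrite (_ : (fun=> _) = (fun x => f i x + \sum_(i <- s) f i x)); first exact: bounded_measD.
by apply/funext => x; rewrite big_cons.
Qed.

Lemma bounded_meas_indic (A : set T) : measurable A -> bounded_meas \1_A.
Proof.
move=> mA; split; first exact: measurable_indic.
by exists 1 => x; rewrite ger0_norm// indicE; case: (_ \in _).
Qed.

Lemma Rint_cst (c : R) : \int[P]_x c = c.
Proof. by rewrite /Rintegral integral_cst// [X in (_ * X)%E]probability_setT mule1. Qed.

Lemma RintD (f g : T -> R) : bounded_meas f -> bounded_meas g ->
  \int[P]_x (f x + g x) = \int[P]_x f x + \int[P]_x g x.
Proof. by move=> bf bg; rewrite RintegralD//; exact: bounded_meas_int. Qed.

Lemma RintB (f g : T -> R) : bounded_meas f -> bounded_meas g ->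
  \int[P]_x (f x - g x) = \int[P]_x f x - \int[P]_x g x.
Proof. by move=> bf bg; rewrite RintegralB//; exact: bounded_meas_int. Qed.

Lemma RintZl (c : R) (f : T -> R) : bounded_meas f ->
  \int[P]_x (c * f x) = c * \int[P]_x f x.
Proof. by move=> bf; rewrite RintegralZl//; exact: bounded_meas_int. Qed.

Lemma Rint_sum (I : Type) (s : seq I) (f : I -> T -> R) :
  (forall i, bounded_meas (f i)) ->
  \int[P]_x (\sum_(i <- s) f i x) = \sum_(i <- s) \int[P]_x f i x.
Proof.
move=> bf; elim: s => [|i s IH].
  rewrite big_nil -[RHS](Rint_cst 0); apply: eq_Rintegral => x _; exact: big_nil.
rewrite big_cons -IH -RintD//; last exact: bounded_meas_sum.
by apply: eq_Rintegral => x _; rewrite big_cons.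
Qed.

Lemma le_Rint (f g : T -> R) : bounded_meas f -> bounded_meas g ->
  (forall x, f x <= g x) -> \int[P]_x f x <= \int[P]_x g x.
Proof. by move=> bf bg fg; apply: le_Rintegral => //; exact: bounded_meas_int. Qed.

Lemma Rint_expR_gt0 (f : T -> R) : bounded_meas f -> 0 < \int[P]_x expR (f x).
Proof.
move=> bf; have [_ [K fK]] := bf.
apply: (@lt_le_trans _ _ (\int[P]_x expR (- K))); first by rewrite Rint_cst expR_gt0.
apply: le_Rint; [exact: bounded_meas_cst|exact: bounded_meas_expR|move=> x].
by rewrite ler_expR; have := fK x; rewrite ler_norml => /andP[].
Qed.

Lemma Rint_dist (f g : T -> R) (e : R) : bounded_meas f -> bounded_meas g ->
  (forall x, `|f x - g x| <= e) -> `|\int[P]_x f x - \int[P]_x g x| <= e.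
Proof.
move=> bf bg fg; have bfg := bounded_measB _ _ bf bg.
rewrite -RintB// ler_norml; apply/andP; split.
  rewrite -[leLHS]Rint_cst; apply: le_Rint => //; first exact: bounded_meas_cst.
  by move=> x; have := fg x; rewrite ler_norml => /andP[].
rewrite -[leRHS]Rint_cst; apply: le_Rint => //; first exact: bounded_meas_cst.
by move=> x; have := fg x; rewrite ler_norml => /andP[].
Qed.

Lemma Rint_indic (A : set T) : measurable A -> \int[P]_x \1_A x = fine (P A).
Proof. by move=> mA; rewrite /Rintegral integral_indic// setIT. Qed.

Lemma EFin_Rint (f : T -> R) : bounded_meas f ->
  (\int[P]_x f x)%:E = (\int[P]_x (f x)%:E)%E.
Proof.
by move=> bf; rewrite /Rintegral fineK//; apply: integrable_fin_num => //; exact: bounded_meas_int.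
Qed.

End Bounded.

Section LayerCake.
Context {R : realType}.

(** The sum counts the positive integers up to [y], hence is the integer part of [y]. *)
Lemma layer_cake (y : R) (M : nat) : 0 <= y <= M%:R ->
  `|y - \sum_(j < M) (j.+1%:R <= y)%R%:R| <= 1.
Proof.
elim: M => [|M IH] /andP[y0 yM].
  have -> : y = 0 by apply/eqP; rewrite eq_le yM y0.
  by rewrite big_ord0 subr0 normr0.
rewrite big_ord_recr /=.
have [yM'|yM'] := leP y M%:R.
  have -> : (M.+1%:R <= y) = false.
    by apply/negbTE; rewrite -ltNge (le_lt_trans yM')// ltr_nat.
  by rewrite addr0 IH// y0.
rewrite (eq_bigr (fun=> 1)); last first.
  by move=> j _; rewrite (_ : (_ <= y)) // (le_trans _ (ltW yM'))// ler_nat.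
rewrite sumr_const card_ord; case: (leP M.+1%:R y) => h.
  have -> : y = M.+1%:R by apply/eqP; rewrite eq_le yM h.
  by rewrite natr1 subrr normr0.
rewrite addr0 ger0_norm ?subr_ge0 ?ltW//; move: h; rewrite -natr1; lra.
Qed.

End LayerCake.

Section DonskerVaradhan.
Context {R : realType} {d} {T : measurableType d} (mu Q : probability T R).
Variable (A : (T -> R) -> Prop).
Hypothesis A_bounded : forall h, A h -> bounded_meas h.
Hypothesis A_cst : forall c, A (fun=> c).
Hypothesis AD : forall f g, A f -> A g -> A (fun x => f x + g x).
Hypothesis AZ : forall c f, A f -> A (fun x => c * f x).
Hypothesis A_indic : forall (B : set T) (e : R), measurable B -> 0 < e ->
  exists g, [/\ A g, (forall x, 0 <= g x <= 1),
    \int[mu]_x `|\1_B x - g x| <= e & \int[Q]_x `|\1_B x - g x| <= e].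
Variable V : \bar R.
Hypothesis AV : forall h, A h ->
  ((\int[mu]_x h x - ln (\int[Q]_x expR (h x)))%:E <= V)%E.

(** A bounded function is nearly a combination of indicators of its upper level sets, and these are
    approximable by hypothesis. *)
Lemma A_approx (h : T -> R) (K e : R) : measurable_fun setT h -> 0 < K ->
  (forall x, 0 <= h x <= K) -> 0 < e ->
  exists g, [/\ A g, (forall x, 0 <= g x <= K),
    \int[mu]_x `|h x - g x| <= e & \int[Q]_x `|h x - g x| <= e].
Proof.
move=> mh K0 hK e0.
have bh : bounded_meas h.
  by split => //; exists K => x; have /andP[? ?] := hK x; rewrite ger0_norm.
(* Levels of height K / M cost at most e / 2; the M indicators, each with error e / (2 K) and weight
   K / M, cost the other half. *)
pose M := (Num.truncn (2 * K / e)).+1.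
have M0 : (0 : R) < M%:R by rewrite ltr0n.
have KM : K / M%:R <= e / 2.
  rewrite ler_pdivrMr// mulrC -ler_pdivrMr ?divr_gt0// invf_div mulrA (mulrC K).
  by rewrite ltW// truncnS_gt.
pose B (j : nat) := [set x | j.+1%:R * (K / M%:R) <= h x].
have mB j : measurable (B j).
  rewrite /B (_ : [set x | _] = setT `&` h @^-1` `[j.+1%:R * (K / M%:R), +oo[); last first.
    by rewrite setTI; apply/seteqP; split => x /=; rewrite in_itv/= andbT.
  exact: mh.
have e2 : 0 < e / (2 * K) by rewrite divr_gt0// mulr_gt0.
have /choice[g hg] : forall j, exists g, [/\ A g, (forall x, 0 <= g x <= 1),
    \int[mu]_x `|\1_(B j) x - g x| <= e / (2 * K) &
    \int[Q]_x `|\1_(B j) x - g x| <= e / (2 * K)].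
  by move=> j; exact: A_indic.
have Ag j : A (g j) by have [] := hg j.
have bg j := A_bounded _ (Ag j).
have KM0 : 0 < K / M%:R by rewrite divr_gt0.
have Asum : A (fun x => \sum_(j < M) g j x).
  rewrite (_ : (fun=> _) = (fun x => \sum_(j <- index_enum 'I_M) g (nat_of_ord j) x))//.
  elim: (index_enum _) => [|j s IH].
    by rewrite (_ : (fun=> _) = (fun=> 0)) //; apply/funext => x; rewrite big_nil.
  rewrite (_ : (fun=> _) = (fun x => g j x + \sum_(i <- s) g (nat_of_ord i) x)); first exact: AD.
  by apply/funext => x; rewrite big_cons.
have pt x : `|h x - K / M%:R * \sum_(j < M) g j x| <=
    e / 2 + K / M%:R * \sum_(j < M) `|\1_(B j) x - g j x|.
  have -> : h x - K / M%:R * \sum_(j < M) g j x =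
    (h x - K / M%:R * \sum_(j < M) \1_(B j) x) +
    K / M%:R * \sum_(j < M) (\1_(B j) x - g j x) by rewrite sumrB; ring.
  rewrite (le_trans (ler_normD _ _))// lerD//; last first.
    by rewrite normrM gtr0_norm// ler_pM2l// ler_norm_sum.
  have -> : h x - K / M%:R * \sum_(j < M) \1_(B j) x =
    K / M%:R * (h x / (K / M%:R) - \sum_(j < M) (j.+1%:R <= h x / (K / M%:R))%R%:R).
    rewrite mulrBr mulrCA divff ?gt_eqF// mulr1; congr (_ - _ * _).
    apply: eq_bigr => j _; rewrite indicE ler_pdivlMr//; congr ((nat_of_bool _)%:R).
    by apply/idP/idP; rewrite in_setE.
  rewrite normrM gtr0_norm// (le_trans _ KM)// -[leRHS]mulr1 ler_pM2l//.
  apply: layer_cake; have /andP[h0 h1] := hK x.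
  rewrite divr_ge0 ?(ltW KM0)//= ler_pdivrMr// mulrCA divff ?gt_eqF// mulr1//.
have int (P : probability T R) : (forall j, \int[P]_x `|\1_(B j) x - g j x| <= e / (2 * K)) ->
    \int[P]_x `|h x - K / M%:R * \sum_(j < M) g j x| <= e.
  move=> hP.
  have bS j : bounded_meas (fun x => `|\1_(B j) x - g j x|).
    by apply/bounded_meas_norm/bounded_measB => //; exact: bounded_meas_indic.
  have bSum : bounded_meas (fun x => \sum_(j < M) `|\1_(B j) x - g j x|).
    exact: bounded_meas_sum.
  apply: (@le_trans _ _ (\int[P]_x (e / 2 + K / M%:R * \sum_(j < M) `|\1_(B j) x - g j x|))).
    apply: le_Rint => //.
    - apply/bounded_meas_norm/bounded_measB => //; apply: bounded_measZ; exact: A_bounded.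
    - by apply: bounded_measD; [exact: bounded_meas_cst|exact: bounded_measZ].
  rewrite RintD; [|exact: bounded_meas_cst|exact: bounded_measZ].
  rewrite Rint_cst RintZl// Rint_sum//.
  have : \sum_(j < M) \int[P]_x `|\1_(B j) x - g j x| <= \sum_(j < M) e / (2 * K).
    exact: ler_sum.
  rewrite sumr_const card_ord -[_ *+ M]mulr_natr => H.
  have : K / M%:R * \sum_(j < M) \int[P]_x `|\1_(B j) x - g j x| <= K / M%:R * (e / (2 * K) * M%:R).
    by rewrite ler_pM2l.
  have -> : K / M%:R * (e / (2 * K) * M%:R) = e / 2 by field; rewrite !gt_eqF.
  lra.
exists (fun x => K / M%:R * \sum_(j < M) g j x); split.
- exact: AZ.
- move=> x; apply/andP; split.
    by rewrite mulr_ge0 ?(ltW KM0)// sumr_ge0// => j _; have [_ /(_ x)/andP[]] := hg j.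
  have : \sum_(j < M) g j x <= \sum_(j < M) 1.
    by apply: ler_sum => j _; have [_ /(_ x)/andP[]] := hg j.
  rewrite sumr_const card_ord => H.
  by rewrite -ler_pdivlMl// invf_div mulrC mulrCA mulfV ?gt_eqF// mulr1.
- by apply: int => j; have [] := hg j.
- by apply: int => j; have [] := hg j.
Qed.

Lemma V_ge0 : (0 <= V)%E.
Proof.
have := AV _ (A_cst 0); rewrite Rint_cst (_ : \int[Q]_x _ = 1).
  by rewrite ln1 subrr.
by rewrite -[RHS](Rint_cst Q); apply: eq_Rintegral => x _; rewrite expR0.
Qed.

(** For functions with values in [0, K], exp is Lipschitz with constant exp K, and the integrals of
    the exponentials are at least 1, where ln is 1-Lipschitz. So L1 approximation carries over to
    the functional. *)
Let DV_nonneg (h : T -> R) (K : R) : measurable_fun setT h -> 0 < K ->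
  (forall x, 0 <= h x <= K) ->
  ((\int[mu]_x h x - ln (\int[Q]_x expR (h x)))%:E <= V)%E.
Proof.
move=> mh K0 hK.
have bh : bounded_meas h.
  by split => //; exists K => x; have /andP[? ?] := hK x; rewrite ger0_norm.
have beh := bounded_meas_expR h bh.
have := V_ge0; case: V AV => [v| |]// AV' _; last by rewrite leey.
rewrite lee_fin; apply/ler_addgt0Pr => e e0.
have E0 : 0 < expR K := expR_gt0 K.
(* The error [e'] appears once in the [mu] integral and, multiplied by exp K, in the logarithm. *)
have [e' [e'0 eE]] : exists e', 0 < e' /\ e' + expR K * e' = e.
  exists (e / (1 + expR K)); have E1 : 0 < 1 + expR K by rewrite ltr_pwDl// ltW.
  split; first by rewrite divr_gt0.
  by field; rewrite gt_eqF.
have [g [Ag gK gmu gQ]] := A_approx h K e' mh K0 hK e'0.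
have bg := A_bounded _ Ag.
have beg := bounded_meas_expR g bg.
have b1 : bounded_meas (fun x => `|h x - g x|) by exact/bounded_meas_norm/bounded_measB.
have H1 : \int[mu]_x h x <= \int[mu]_x g x + e'.
  apply: (@le_trans _ _ (\int[mu]_x (g x + `|h x - g x|))).
    apply: le_Rint; [exact: bh|exact: bounded_measD|].
    by move=> x; have := ler_norm (h x - g x); lra.
  by rewrite RintD; [rewrite lerD2l|exact: bg|exact: b1].
have bEb : bounded_meas (fun x => expR K * `|h x - g x|).
  exact: bounded_measZ.
have H2 : \int[Q]_x expR (g x) <= \int[Q]_x expR (h x) + expR K * e'.
  apply: (@le_trans _ _ (\int[Q]_x (expR (h x) + expR K * `|h x - g x|))).
    apply: le_Rint; [exact: beg|exact: bounded_measD|].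
    move=> x; have e1 := expR_ge1Dx (h x - g x).
    have I1 : expR (g x) * (1 + (h x - g x)) <= expR (h x).
      by rewrite -[in leRHS](subrKC (g x) (h x)) expRD ler_pM2l ?expR_gt0.
    have : expR (g x) * (g x - h x) <= expR K * `|h x - g x|.
      apply: (@le_trans _ _ (expR (g x) * `|h x - g x|)).
        by rewrite ler_pM2l ?expR_gt0// distrC ler_norm.
      by rewrite ler_wpM2r// ler_expR; have /andP[] := gK x.
    lra.
  rewrite RintD; [|exact: beh|exact: bEb].
  by rewrite lerD2l RintZl// ler_pM2l.
have ge1 (k : T -> R) : bounded_meas k -> (forall x, 0 <= k x <= K) ->
    1 <= \int[Q]_x expR (k x).
  move=> bk kK; rewrite -[leLHS](Rint_cst Q 1).
  apply: le_Rint; [exact: bounded_meas_cst|exact: bounded_meas_expR|].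
  by move=> x; rewrite -expR0 ler_expR; have /andP[] := kK x.
have a1 := ge1 h bh hK; have g1 := ge1 g bg gK.
have := AV' _ Ag; rewrite lee_fin.
move: H1 H2 a1 g1; move: (\int[Q]_x expR (h x)) (\int[Q]_x expR (g x)) => a b.
move: (\int[mu]_x g x) (\int[mu]_x h x) (expR K) E0 eE => mg mh' E E0 eE H1 H2 a1 g1 H3.
have a0 : 0 < a by lra.
have b0 : 0 < b by lra.
have Ee : 0 < E * e' by rewrite mulr_gt0.
have ba : 0 < b / a by rewrite divr_gt0.
have H4 : ln b <= ln a + E * e'.
  have := ln_le_subr1 _ ba; rewrite ln_div ?posrE// => H.
  have H5 : b / a <= 1 + E * e'.
    rewrite ler_pdivrMr//; nra.
  lra.
lra.
Qed.

(** Adding a constant changes both terms of the functional equally, so [h] may be made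
    nonnegative. *)
Lemma DV_bounded (h : T -> R) : bounded_meas h ->
  ((\int[mu]_x h x - ln (\int[Q]_x expR (h x)))%:E <= V)%E.
Proof.
move=> bh; have [mh [K0 hK0]] := bh.
have [K [Kp hK]] : exists K : R, 0 < K /\ forall x, `|h x| <= K.
  exists (`|K0| + 1); split; first by rewrite ltr_pwDr.
  by move=> x; rewrite (le_trans (hK0 x))// (le_trans (ler_norm _))// lerDl.
have K2 : 0 < 2 * K by rewrite mulr_gt0.
have h'K x : 0 <= h x + K <= 2 * K.
  by have := hK x; rewrite ler_norml => /andP[? ?]; apply/andP; split; lra.
have mh' : measurable_fun setT (fun x => h x + K).
  by apply: measurable_funD => //; exact: measurable_cst.
have := DV_nonneg _ _ mh' K2 h'K.
rewrite RintD; [|exact: bh|exact: bounded_meas_cst].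
have -> : \int[Q]_x expR (h x + K) = expR K * \int[Q]_x expR (h x).
  rewrite -RintZl; last exact: bounded_meas_expR.
  by apply: eq_Rintegral => x _; rewrite addrC expRD.
have Ep := Rint_expR_gt0 Q _ bh.
rewrite Rint_cst lnM ?posrE ?expR_gt0// expRK.
by rewrite (_ : _ + K - (K + _) = \int[mu]_x h x - ln (\int[Q]_x expR (h x)))//; ring.
Qed.

Variable J : (T -> \bar R) -> \bar R.
Hypothesis JQ : forall g, measurable_fun setT g -> (forall x, 0 <= g x)%E ->
  J g = (\int[Q]_x g x)%E.

(** A multiple of the indicator of a Q-null set leaves the exponential integral equal to 1, while
    its [mu] integral is as large as desired. *)
Let V_not_dominated (B : set T) : measurable B -> Q B = 0%E -> mu B != 0%E -> V = +oo%E.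
Proof.
move=> mB QB muB; have V0 := V_ge0.
have muB0 : 0 < fine (mu B).
  by rewrite fine_gt0// lt0e muB measure_ge0/= ltey_eq fin_num_measure.
suff H (M : R) : (M%:E <= V)%E by exact: eq_infty.
have [M0|M0] := leP M 0; first by rewrite (le_trans _ V0)// lee_fin.
pose c := M / fine (mu B).
have bh : bounded_meas (fun x => c * \1_B x).
  by apply: bounded_measZ; exact: bounded_meas_indic.
have := DV_bounded _ bh; rewrite RintZl; last exact: bounded_meas_indic.
rewrite Rint_indic// /c divfK ?gt_eqF// (_ : \int[Q]_x _ = 1) ?ln1 ?subr0//.
rewrite -[RHS](Rint_cst Q) /Rintegral; congr fine; apply: ae_eq_integral => //.
- by apply/measurable_EFinP; exact: (bounded_meas_expR _ bh).1.
exists B; split => // x /=; apply: contra_notP => Bx _.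
by rewrite indicE memNset// mulr0 expR0.
Qed.

(* Test the bound on [ln f] truncated above and below. *)
Lemma donsker_varadhan_le : (relent d T J mu <= V)%E.
Proof.
have [PQ|nPQ] := pselect (mu `<< Q); last first.
  suff -> : V = +oo%E by rewrite leey.
  have [B [mB QB muB]] : exists B, [/\ measurable B, Q B = 0%E & mu B != 0%E].
    apply: contrapT => H; apply: nPQ; apply/null_content_dominatesP => B mB QB.
    by apply: contrapT => /eqP muB; apply: H; exists B.
  exact: V_not_dominated mB QB muB.
have [f hf] := dominates_has_density Q mu J JQ PQ.
rewrite (relentE Q mu J JQ f)//.
have [mf f0 fE] := hf.
have := V_ge0; have := DV_bounded; case: V => [v| |]// DVb _; last by rewrite leey.
have ml : measurable_fun setT (fun x => ln (f x)) by exact: measurableT_comp.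
have mEl := proj2 (measurable_EFinP setT _) ml.
have nf : (\int[mu]_x (fun x => (ln (f x))%:E)^\- x < +oo)%E.
  apply: (density_ln_neg_lty Q mu J JQ _ setT hf) => //.
    by rewrite [X in (X < _)%E]probability_setT ltry.
  by rewrite setCT measure0.
have nf0 : (0 <= \int[mu]_x (fun x => (ln (f x))%:E)^\- x)%E by exact: integral_ge0.
set c := (\int[mu]_x (fun x => (ln (f x))%:E)^\- x)%E in nf nf0.
rewrite integralE -/c.
suff H (e : R) : 0 < e -> (\int[mu]_x (fun x => (ln (f x))%:E)^\+ x <= (v + e)%:E + c)%E.
  move: nf nf0 H; case: c => [c| |]// _ _ H.
  apply/lee_addgt0Pr => e e0; rewrite leeBlDr//; have := H e e0.
  by rewrite -!EFinD.
move=> e0.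
have bound (k : nat) :
    (\int[mu]_x (Num.min (Num.max (ln (f x)) 0) k%:R)%:E <= (v + e)%:E + c)%E.
  (* The floor [e] makes the logarithm bounded below; since exp h <= f + e, the exponential integral
     is at most 1 + e, and its logarithm costs at most [e]. *)
  pose h x := ln (Num.max (Num.min (f x) (expR k%:R)) e).
  have max_gt0 x : 0 < Num.max (Num.min (f x) (expR k%:R)) e by rewrite lt_max e0 orbT.
  have mh : measurable_fun setT h.
    apply: measurableT_comp => //; apply: measurable_maxr; last exact: measurable_cst.
    by apply: measurable_minr => //; exact: measurable_cst.
  have bh : bounded_meas h.
    split => //; exists (`|ln e| + `|ln (Num.max (expR k%:R) e)|) => x.
    have h1 : ln e <= h x by rewrite ler_ln ?posrE// le_max lexx orbT.
    have h2 : h x <= ln (Num.max (expR k%:R) e).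
      rewrite ler_ln ?posrE ?lt_max ?e0 ?orbT//.
      by rewrite ge_max le_max ge_min lexx orbT /= le_max lexx orbT.
    rewrite ler_norml; apply/andP; split.
      apply: le_trans h1; have := ler_norm (- ln e); rewrite normrN.
      by have := normr_ge0 (ln (Num.max (expR k%:R) e)); lra.
    apply: (le_trans h2); have := ler_norm (ln (Num.max (expR k%:R) e)).
    by have := normr_ge0 (ln e); lra.
  have Eh x : expR (h x) = Num.max (Num.min (f x) (expR k%:R)) e by rewrite /h lnK ?posrE.
  have I1 : \int[Q]_x expR (h x) <= 1 + e.
    rewrite -lee_fin EFin_Rint; last exact: bounded_meas_expR.
    apply: (@le_trans _ _ (\int[Q]_x ((f x)%:E + e%:E)%E)%E).
      apply: ge0_le_integral => //.
      - by apply/measurable_EFinP; exact: (bounded_meas_expR _ bh).1.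
      - by apply: emeasurable_funD; exact/measurable_EFinP.
      move=> x _; rewrite Eh -EFinD lee_fin ge_max; apply/andP; split.
        by rewrite (@le_trans _ _ (f x))// ?ge_min ?lexx// lerDl ltW.
      by rewrite lerDr.
    rewrite ge0_integralD//; do ?[exact/measurable_EFinP|by move=> x _; rewrite lee_fin|by move=> x _; rewrite lee_fin ltW|exact: measurable_cst].
    rewrite integral_cst// [X in (_ * X)%E]probability_setT mule1 EFinD leeD2r//.
    have : mu setT = (\int[Q]_x (f x)%:E)%E by rewrite fE// (J_indic Q J JQ).
    by move=> <-; rewrite probability_setT.
  have Ip := Rint_expR_gt0 Q _ bh.
  have I2 : \int[mu]_x h x <= v + e.
    have := DVb _ bh; rewrite lee_fin.
    have L1 : ln (\int[Q]_x expR (h x)) <= ln (1 + e).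
      have e1p : 0 < 1 + e by lra.
      by rewrite ler_ln ?posrE.
    have L2 : ln (1 + e) <= e by apply: le_ln1Dx; lra.
    move: I1 L1 L2.
    by move=> *; lra.
  (* Adding the negative part of ln f cancels the part of [h] coming from f < 1, so [F] dominates
     the truncated positive part wherever f > 0. *)
  pose F x := ((h x)%:E + (fun x => (ln (f x))%:E)^\- x)%E.
  have intln : mu.-integrable setT (fun x => (ln (f x))%:E)^\-%E.
    apply/integrableP; split; first exact: measurable_funeneg.
    by rewrite (eq_integral _ _ (fun x _ => gee0_abs (funeneg_ge0 _ x))).
  have mF : measurable_fun setT F.
    by apply: emeasurable_funD; [exact/measurable_EFinP|exact: measurable_funeneg].
  have IF : (\int[mu]_x F x <= (v + e)%:E + c)%E.
    rewrite integralD//; last exact: bounded_meas_int.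
    by rewrite leeD2r// -EFin_Rint.
  apply: (le_trans _ IF).
  have fpos : {ae mu, forall x, 0 < f x}.
    have m0 : measurable [set x | f x = 0].
      by rewrite -[X in measurable X]setTI; exact: (mf measurableT [set 0]).
    exists [set x | f x = 0]; split => //; first exact: (density_gt0 Q mu J JQ _ hf).
    by move=> x /= /negP; rewrite -leNgt => h'; apply/eqP; rewrite eq_le h' f0.
  have ptw x : 0 < f x -> ((Num.min (Num.max (ln (f x)) 0) k%:R)%:E <= F x)%E.
    move=> fx; rewrite /F funenegE -EFin_max -EFinD lee_fin.
    have k0 : (0 : R) <= k%:R by [].
    have [f1|f1] := leP 1 (f x).
      have l0 : 0 <= ln (f x) by exact: ln_ge0.
      rewrite (max_l l0) (_ : Num.max (- ln (f x)) 0 = 0) ?addr0; last first.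
        by apply/max_r; lra.
      apply: (@le_trans _ _ (ln (Num.min (f x) (expR k%:R)))); last first.
        by rewrite ler_ln ?posrE// ?le_max ?lexx// lt_min fx expR_gt0.
      have [h1|h1] := leP (f x) (expR k%:R); first by rewrite ge_min lexx.
      by rewrite expRK ge_min lexx orbT.
    have l0 : ln (f x) <= 0 by apply: ln_le0; exact: ltW.
    rewrite (max_r l0) (min_l k0) max_l; last by lra.
    rewrite subr_ge0 ler_ln ?posrE// le_max; apply/orP; left.
    by rewrite le_min lexx /= (le_trans (ltW f1))// -expR0 ler_expR.
  (* [F] is nonnegative only where f > 0; its positive part is nonnegative everywhere and has the
     same integral. *)
  rewrite (@ae_eq_integral _ _ _ mu setT (fun x => maxe 0 (F x))%E F)//; last 2 first.
  - by apply: measurable_maxe => //; exact: measurable_cst.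
  - apply: filterS fpos => x fx _; rewrite max_r//; apply: le_trans (ptw x fx).
    by rewrite lee_fin le_min le_max lexx orbT /=.
  apply: ae_ge0_le_integral => //.
  - by move=> x _; rewrite lee_fin le_min le_max lexx orbT /=.
  - apply/measurable_EFinP; apply: measurable_minr; last exact: measurable_cst.
    by apply: measurable_maxr => //; exact: measurable_cst.
  - by move=> x _; rewrite le_max lexx.
  - by apply: measurable_maxe => //; exact: measurable_cst.
  - apply: filterS fpos => x fx _; rewrite le_max; apply/orP; right; exact: ptw.
(* Remove the truncation at [k] by monotone convergence. *)
rewrite (_ : (\int[mu]_x _)%E =
   limn (fun k => \int[mu]_x (Num.min (Num.max (ln (f x)) 0) k%:R)%:E)%E); last first.
  rewrite -monotone_convergence//.
  - apply: eq_integral => x _; apply/esym/cvg_lim => //.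
    rewrite funeposE -EFin_max.
    apply: cvg_near_cst; near=> k.
    rewrite min_l//; near: k; exact: nbhs_infty_ger.
  - move=> k; apply/measurable_EFinP; apply: measurable_minr; last exact: measurable_cst.
    by apply: measurable_maxr => //; exact: measurable_cst.
  - by move=> k x _; rewrite lee_fin le_min le_max lexx orbT /=.
  - move=> x _ a b ab; rewrite lee_fin le_min ge_min lexx /= ge_min.
    by rewrite ler_nat ab orbT.
apply: lime_le; last exact: nearW.
apply: ereal_nondecreasing_is_cvgn => a b ab; apply: ge0_le_integral => //.
- by move=> x _; rewrite lee_fin le_min le_max lexx orbT /=.
- apply/measurable_EFinP; apply: measurable_minr; last exact: measurable_cst.
  by apply: measurable_maxr => //; exact: measurable_cst.
- apply/measurable_EFinP; apply: measurable_minr; last exact: measurable_cst.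
  by apply: measurable_maxr => //; exact: measurable_cst.
- move=> x _; rewrite lee_fin le_min ge_min lexx /= ge_min.
  by rewrite ler_nat ab orbT.
Unshelve. all: by end_near. Qed.

End DonskerVaradhan.

(** * Uniform limits of polynomials *)

Section PolyApprox.
Context {R : realType} {d} {T : measurableType d} {I : Type} (X : I -> T -> R).

(** Monomials are indexed by words, like the moments that [Delta_sym] constrains. *)
Definition monomial (w : seq I) (x : T) : R := \prod_(i <- w) X i x.
Definition peval (p : seq (R * seq I)) (x : T) : R := \sum_(cw <- p) cw.1 * monomial cw.2 x.

(** The approximation is uniform on the whole of [T], which bounded generators permit. *)
Definition polyapprox (f : T -> R) : Prop :=
  measurable_fun setT f /\
  forall e : R, 0 < e -> exists p, forall x, `|f x - peval p x| <= e.

Hypothesis X_bounded : forall i, bounded_meas (X i).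

Lemma monomial_bounded w : bounded_meas (monomial w).
Proof.
elim: w => [|i w IH].
  rewrite (_ : monomial [::] = fun=> 1); first exact: bounded_meas_cst.
  by apply/funext => x; rewrite /monomial big_nil.
rewrite (_ : monomial (i :: w) = fun x => X i x * monomial w x); first exact: bounded_measM.
by apply/funext => x; rewrite /monomial big_cons.
Qed.

Lemma peval_bounded p : bounded_meas (peval p).
Proof.
apply: bounded_meas_sum => -[c w]; apply: bounded_measZ.
exact: monomial_bounded.
Qed.

Lemma polyapprox_bounded f : polyapprox f -> bounded_meas f.
Proof.
move=> [mf /(_ 1 ltr01)[p fp]]; have [_ [K pK]] := peval_bounded p.
split => //; exists (1 + K) => x.
rewrite -(subrK (peval p x) (f x)) (le_trans (ler_normD _ _))// lerD//.
Qed.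

Lemma peval_cat p q x : peval (p ++ q) x = peval p x + peval q x.
Proof. by rewrite /peval big_cat. Qed.

Definition pmul (p q : seq (R * seq I)) : seq (R * seq I) :=
  [seq (a.1 * b.1, a.2 ++ b.2) | a <- p, b <- q].

Lemma peval_mul p q x : peval (pmul p q) x = peval p x * peval q x.
Proof.
rewrite /peval /pmul big_allpairs_dep /= mulr_suml; apply: eq_bigr => a _.
rewrite mulr_sumr; apply: eq_bigr => b _.
by rewrite /monomial big_cat /=; ring.
Qed.

Lemma eq_polyapprox f g : f =1 g -> polyapprox f -> polyapprox g.
Proof. by move=> /funext ->. Qed.

Lemma polyapprox_monomial w : polyapprox (monomial w).
Proof.
split; first exact: (monomial_bounded w).1.
move=> e e0; exists [:: (1, w)] => x.
by rewrite /peval big_seq1 mul1r subrr normr0 ltW.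
Qed.

Lemma polyapprox_cst c : polyapprox (fun=> c).
Proof.
split; first exact: measurable_cst.
move=> e e0; exists [:: (c, [::])] => x.
by rewrite /peval big_seq1 /monomial big_nil mulr1 subrr normr0 ltW.
Qed.

Lemma polyapprox_gen i : polyapprox (X i).
Proof.
have -> : X i = monomial [:: i] by apply/funext => x; rewrite /monomial big_seq1.
exact: polyapprox_monomial.
Qed.

Lemma polyapproxD f g : polyapprox f -> polyapprox g -> polyapprox (fun x => f x + g x).
Proof.
move=> [mf hf] [mg hg]; split; first exact: measurable_funD.
move=> e e0; have e2 : 0 < e / 2 by rewrite divr_gt0.
have [p fp] := hf _ e2; have [q gq] := hg _ e2; exists (p ++ q) => x.
rewrite peval_cat (_ : _ - _ = (f x - peval p x) + (g x - peval q x)); last by ring.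
by rewrite (le_trans (ler_normD _ _))// [leRHS](splitr e) lerD.
Qed.

Lemma polyapproxM f g : polyapprox f -> polyapprox g -> polyapprox (fun x => f x * g x).
Proof.
move=> hf hg; have [_ [K fK]] := polyapprox_bounded _ hf.
have [_ [L gL]] := polyapprox_bounded _ hg.
have [mf {}hf] := hf; have [mg {}hg] := hg; split; first exact: measurable_funM.
move=> e e0; pose M := `|K| + `|L| + 1.
have M0 : 0 < M by rewrite /M ltr_pwDr// addr_ge0.
have fM x : `|f x| <= M.
  by have := fK x; have := ler_norm K; have := normr_ge0 L; rewrite /M; lra.
have gM x : `|g x| <= M.
  by have := gL x; have := ler_norm L; have := normr_ge0 K; rewrite /M; lra.
clearbody M.
(* The error of a product is at most M dl + dl M + dl dl, and dl <= 1 bounds this by (2 M + 1)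
   dl. *)
pose dl := Num.min 1 (e / (2 * M + 1)).
have M1 : 0 < 2 * M + 1 by rewrite ltr_pwDr// mulr_ge0// ltW.
have dl0 : 0 < dl by rewrite lt_min ltr01 divr_gt0.
have dl1 : dl <= 1 by rewrite ge_min lexx.
have dle : dl * (2 * M + 1) <= e by rewrite -ler_pdivlMr// ge_min lexx orbT.
clearbody dl.
have [p fp] := hf _ dl0; have [q gq] := hg _ dl0; exists (pmul p q) => x.
rewrite peval_mul (_ : _ - _ = f x * (g x - peval q x) + (f x - peval p x) * g x
   - (f x - peval p x) * (g x - peval q x)); last by ring.
have := fp x; have := gq x; have := fM x; have := gM x.
move: (f x) (g x) (f x - peval p x) (g x - peval q x) => a b u v hb ha hv hu.
have h1 : `|a * v| <= M * dl by rewrite normrM ler_pM.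
have h2 : `|u * b| <= dl * M by rewrite normrM ler_pM.
have h3 : `|u * v| <= dl * 1.
  by rewrite normrM ler_pM// (le_trans hv).
have := ler_normB (a * v + u * b) (u * v); have := ler_normD (a * v) (u * b); lra.
Qed.

Lemma polyapproxZ c f : polyapprox f -> polyapprox (fun x => c * f x).
Proof. by move=> hf; apply: polyapproxM => //; exact: polyapprox_cst. Qed.

Lemma polyapproxB f g : polyapprox f -> polyapprox g -> polyapprox (fun x => f x - g x).
Proof.
move=> hf hg; rewrite (_ : (fun=> _) = (fun x => f x + -1 * g x)).
  by apply: polyapproxD => //; exact: polyapproxZ.
by apply/funext => x; rewrite mulN1r.
Qed.

(* The iteration [a' = a + (t^2 - a^2) / 2] converges to [|t|] uniformly on [[-1, 1]]. *)
Let abs_iter (k : nat) (t : R) : R := iter k (fun a => a + (t ^+ 2 - a ^+ 2) / 2) 0.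

Let abs_iterP (k : nat) (t : R) : `|t| <= 1 ->
  0 <= abs_iter k t /\ 0 <= `|t| - abs_iter k t <= 2 / (k.+2)%:R.
Proof.
move=> t1; have t0 := normr_ge0 t; elim: k => [|k [IH0 /andP[IH1 IH2]]].
  by rewrite /abs_iter /= subr0 t0 divff.
rewrite /abs_iter iterS -/(abs_iter k t); move: (abs_iter k t) IH0 IH1 IH2 => a a0 at0 atk.
have -> : t ^+ 2 = `|t| ^+ 2 by rewrite real_normK// num_real.
move: `|t| t0 t1 at0 atk => s s0 s1 as0 ask.
have k2 : (0 : R) < k.+2%:R by rewrite ltr0n.
have k3 : (0 : R) < k.+3%:R by rewrite ltr0n.
split; first by nra.
have E : s - (a + (s ^+ 2 - a ^+ 2) / 2) = (s - a) * (1 - (s + a) / 2) by field.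
have h0 : 0 <= 1 - (s + a) / 2 by lra.
rewrite E mulr_ge0//=.
set u := s - a in as0 ask *; set v := 2 / k.+2%:R in ask.
have v1 : v <= 1 by rewrite ler_pdivrMr// mul1r ler_nat.
(* The error [u] is multiplied by 1 - (s + a) / 2 <= 1 - u / 2. As x (1 - x / 2) increases on
   [0, 1], the bound 2 / (k+2) propagates to 2 / (k+3). *)
have h1 : u * (1 - (s + a) / 2) <= u * (1 - u / 2).
  by rewrite ler_wpM2l// /u; lra.
have h2 : u * (1 - u / 2) <= v * (1 - v / 2).
  by clearbody u v; nra.
apply: (le_trans h1); apply: (le_trans h2).
rewrite ler_pdivlMr// /v.
have -> : 2 / k.+2%:R * (1 - 2 / k.+2%:R / 2) * k.+3%:R =
  2 * ((k.+2%:R - 1) * k.+3%:R / (k.+2%:R ^+ 2)) :> R.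
  by field; rewrite gt_eqF.
rewrite -[leRHS]mulr1 ler_pM2l// ler_pdivrMr ?exprn_gt0// mul1r.
rewrite -[k.+3%:R]natr1; nra.
Qed.

Lemma polyapprox_lim (f : T -> R) : measurable_fun setT f ->
  (forall e : R, 0 < e -> exists2 g, polyapprox g & forall x, `|f x - g x| <= e) ->
  polyapprox f.
Proof.
move=> mf h; split => // e e0; have e2 : 0 < e / 2 by rewrite divr_gt0.
have [g [_ /(_ _ e2)[p gp]] fg] := h _ e2; exists p => x.
rewrite -(subrKA (g x)) (le_trans (ler_normD _ _))// [leRHS](splitr e) lerD//.
Qed.

(** The step of the Stone-Weierstrass theorem that makes a closed algebra a lattice; dividing by a
    bound [K] brings the values into [-1, 1]. *)
Lemma polyapprox_norm f : polyapprox f -> polyapprox (fun x => `|f x|).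
Proof.
move=> hf; have [mf [K0 fK0]] := polyapprox_bounded _ hf.
have [K [K1 fK]] : exists K : R, 0 < K /\ forall x, `|f x| <= K.
  exists (`|K0| + 1); split; first by rewrite ltr_pwDr.
  by move=> x; rewrite (le_trans (fK0 x))// (le_trans (ler_norm _))// lerDl.
apply: polyapprox_lim; first exact: measurableT_comp.
move=> e e0; pose k := Num.truncn (2 * K / e).
have ke : K * (2 / k.+2%:R) <= e.
  have k0 : (0 : R) < k.+2%:R by rewrite ltr0n.
  have H : 2 * K / e <= k.+2%:R.
    by rewrite (le_trans (ltW (truncnS_gt _)))// ler_nat.
  rewrite ler_pdivrMr// in H.
  rewrite mulrA ler_pdivrMr//.
  by move: (k.+2%:R : R) H => y H; lra.
exists (fun x => K * abs_iter k (f x / K)).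
  apply: polyapproxZ; elim: (k) => [|m IH]; first exact: polyapprox_cst.
  have hfK : polyapprox (fun x => f x / K).
    rewrite (_ : (fun=> _) = (fun x => K^-1 * f x)); first exact: polyapproxZ.
    by apply/funext => x; rewrite mulrC.
  have h2 : polyapprox (fun x => 2^-1 * ((f x / K) * (f x / K) - abs_iter m (f x / K) * abs_iter m (f x / K))).
    by apply: polyapproxZ; apply: polyapproxB; apply: polyapproxM.
  apply: eq_polyapprox (polyapproxD _ _ IH h2) => x.
  rewrite /abs_iter iterS; set a := iter m _ _; move: a (f x / K) => a b.
  by field.
move=> x; have h1 : `|f x / K| <= 1.
  by rewrite normrM normfV (gtr0_norm K1) ler_pdivrMr// mul1r.
have [_ /andP[h2 h3]] := abs_iterP k _ h1.
have -> : `|f x| - K * abs_iter k (f x / K) = K * (`|f x / K| - abs_iter k (f x / K)).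
  by rewrite normrM normfV (gtr0_norm K1); field; rewrite gt_eqF.
rewrite ger0_norm; last by rewrite mulr_ge0// ltW.
by apply: le_trans ke; rewrite ler_pM2l.
Qed.

Lemma polyapprox_max f g : polyapprox f -> polyapprox g ->
  polyapprox (fun x => Num.max (f x) (g x)).
Proof.
move=> hf hg.
have : polyapprox (fun x => 2^-1 * ((f x + g x) + `|f x - g x|)).
  apply: polyapproxZ; apply: polyapproxD; first exact: polyapproxD.
  by apply: polyapprox_norm; exact: polyapproxB.
apply: eq_polyapprox => x.
by case: (leP (f x) (g x)) => h; [rewrite ler0_norm|rewrite gtr0_norm]; lra.
Qed.

Lemma polyapprox_min f g : polyapprox f -> polyapprox g ->
  polyapprox (fun x => Num.min (f x) (g x)).
Proof.
move=> hf hg; have := polyapproxB _ _ (polyapproxD _ _ hf hg) (polyapprox_max _ _ hf hg).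
apply: eq_polyapprox => x.
by case: (leP (f x) (g x)) => h; lra.
Qed.

Definition clamp01 (y : R) : R := Num.max 0 (Num.min y 1).

Lemma clamp01_itv y : 0 <= clamp01 y <= 1.
Proof. by rewrite le_max lexx /= ge_max ler01 ge_min lexx orbT. Qed.

Lemma polyapprox_clamp01 f : polyapprox f -> polyapprox (fun x => clamp01 (f x)).
Proof.
move=> hf; apply: polyapprox_max; first exact: polyapprox_cst.
by apply: polyapprox_min => //; exact: polyapprox_cst.
Qed.

End PolyApprox.

(** * Approximating indicators in L1 for finitely many probabilities at once *)

Section Approximable.
Context {R : realType} {d} {T : measurableType d} {Idx : Type} (X : Idx -> T -> R).
Hypothesis X_bounded : forall i, bounded_meas (X i).
Context {J : finType} (P : J -> probability T R).

Lemma nonincreasing_small (F : nat -> set T) (e : R) :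
  (forall k, measurable (F k)) -> nonincreasing_seq F ->
  (forall j, P j (\bigcap_k F k) = 0%E) -> 0 < e ->
  exists k, forall j, fine (P j (F k)) <= e.
Proof.
move=> mF niF F0 e0.
have H j : \forall k \near \oo, fine (P j (F k)) <= e.
  have : P j \o F @ \oo --> P j (\bigcap_k F k).
    apply: nonincreasing_cvg_mu => //; last exact: bigcapT_measurable.
    by rewrite ltey_eq fin_num_measure.
  rewrite F0 => /fine_cvg /= /cvgrPdist_le/(_ e e0).
  apply: filterS => k; rewrite sub0r normrN ger0_norm//.
  exact: fine_ge0.
have [k _ /(_ k (leqnn k)) h] := filter_forall _ H.
by exists k.
Qed.

Definition approximable (B : set T) : Prop := measurable B /\
  forall e : R, 0 < e -> exists g, [/\ polyapprox X g, (forall x, 0 <= g x <= 1) &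
    forall j, \int[P j]_x `|\1_B x - g x| <= e].

Let bounded_itv g : polyapprox X g -> bounded_meas g.
Proof. exact: polyapprox_bounded. Qed.

(** A ramp of slope k + 1 starting at [t] differs from the indicator only on the strip t < Y <= t +
    1 / (k+1). These strips decrease to the empty set, so atoms at [t] do no harm. *)
Lemma approximable_halfline (Y : T -> R) (t : R) : polyapprox X Y ->
  approximable [set x | t < Y x].
Proof.
move=> hY; have [mY _] := hY.
have mgt (s : R) : measurable [set x | s < Y x].
  rewrite (_ : [set x | _] = setT `&` Y @^-1` `]s, +oo[); first exact: mY.
  by rewrite setTI; apply/seteqP; split => x /=; rewrite in_itv/= andbT.
split=> // e e0.
pose F k := [set x | t < Y x] `\` [set x | t + k.+1%:R^-1 < Y x].
have mF k : measurable (F k) by exact: measurableD.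
have [|j|k hk] := nonincreasing_small F e mF _ _ e0.
- apply/nonincreasing_seqP => k; apply/subsetPset => x [h1 h2]; split => //= h3.
  apply: h2 => /=; apply: le_lt_trans h3; rewrite lerD2l lef_pV2 ?posrE ?ltr0n//.
  by rewrite ler_nat.
- rewrite (_ : \bigcap_k F k = set0) ?measure0//; apply/seteqP; split => // x h.
  have [tY _] := h 0%N I.
  have tY' : 0 < Y x - t by rewrite subr_gt0.
  have [_] := h (Num.truncn (Y x - t)^-1) I; apply => /=.
  rewrite -ltrBrDl invf_plt ?posrE ?ltr0n//; exact: truncnS_gt.
have k0 : (0 : R) < k.+1%:R by rewrite ltr0n.
exists (fun x => clamp01 (k.+1%:R * (Y x - t))); split.
- apply: polyapprox_clamp01 => //; apply: polyapproxZ => //; apply: polyapproxB => //.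
  exact: polyapprox_cst.
- by move=> x; exact: clamp01_itv.
move=> j; rewrite (le_trans _ (hk j))// -Rint_indic//; apply: le_Rint.
- apply/bounded_meas_norm/bounded_measB; first exact: bounded_meas_indic.
  apply: bounded_itv; apply: polyapprox_clamp01 => //; apply: polyapproxZ => //.
  by apply: polyapproxB => //; exact: polyapprox_cst.
- exact: bounded_meas_indic.
move=> x; rewrite !indicE.
have [h|h] := boolP (t < Y x); last first.
  rewrite [x \in [set x | t < Y x]]memNset; last exact/negP.
  have hle : k.+1%:R * (Y x - t) <= 0.
    by rewrite mulr_ge0_le0 ?(ltW k0)// subr_le0 leNgt.
  rewrite /clamp01 min_l; last by rewrite (le_trans hle).
  by rewrite max_l// subr0 normr0.
rewrite [x \in [set x | t < Y x]]mem_set//.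
have [h'|h'] := boolP (t + k.+1%:R^-1 < Y x).
  rewrite /clamp01 min_r ?max_r ?ler01 ?subrr ?normr0//.
  by rewrite -ler_pdivrMl// mulr1 lerBrDl ltW.
rewrite [x \in F k]mem_set; last by split => //; apply/negP.
have /andP[] := clamp01_itv (k.+1%:R * (Y x - t)).
by rewrite /= ler_norml => *; apply/andP; split; lra.
Qed.

Lemma approximable0 : approximable set0.
Proof.
split => // e e0; exists (fun=> 0); split; first exact: polyapprox_cst.
  by move=> x; rewrite lexx ler01.
move=> j; rewrite (_ : Rintegral _ _ _ = 0) ?ltW// -[RHS](Rint_cst (P j)).
by apply: eq_Rintegral => x _; rewrite indic0 subrr normr0.
Qed.

Lemma approximableC B : approximable B -> approximable (~` B).
Proof.
move=> [mB hB]; split; first exact: measurableC.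
move=> e e0; have [g [hg g01 gB]] := hB e e0.
exists (fun x => 1 - g x); split.
- by apply: polyapproxB => //; exact: polyapprox_cst.
- by move=> x; have /andP[? ?] := g01 x; apply/andP; split; lra.
move=> j; rewrite (le_trans _ (gB j))// le_eqVlt; apply/orP; left; apply/eqP.
apply: eq_Rintegral => x _; rewrite -[LHS]normrN; congr (`| _ |).
rewrite !indicE; have [h|h] := boolP (x \in B).
  by rewrite [_ \in ~` B]memNset ?h /=; [lra|apply; rewrite -in_setE].
by rewrite [_ \in ~` B]mem_set ?(negbTE h) /=; [lra|rewrite notin_setE in h].
Qed.

Lemma approximableU A B : approximable A -> approximable B -> approximable (A `|` B).
Proof.
move=> [mA hA] [mB hB]; split; first exact: measurableU.
move=> e e0; have e2 : 0 < e / 2 by rewrite divr_gt0.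
have [f [hf f01 fA]] := hA _ e2; have [g [hg g01 gB]] := hB _ e2.
have hm := polyapprox_max X X_bounded _ _ hf hg.
exists (fun x => Num.max (f x) (g x)); split => //.
  move=> x; have /andP[f0 f1] := f01 x; have /andP[g0 g1] := g01 x.
  by rewrite le_max f0 /= ge_max f1 g1.
move=> j; have bA : bounded_meas (fun x => `|\1_A x - f x|).
  by apply/bounded_meas_norm/bounded_measB; [exact: bounded_meas_indic|exact: bounded_itv].
have bB : bounded_meas (fun x => `|\1_B x - g x|).
  by apply/bounded_meas_norm/bounded_measB; [exact: bounded_meas_indic|exact: bounded_itv].
apply: (@le_trans _ _ (\int[P j]_x (`|\1_A x - f x| + `|\1_B x - g x|))).
  apply: le_Rint; last 1 first.
  - move=> x; rewrite !indicE in_setU.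
    have /andP[f0 f1] := f01 x; have /andP[g0 g1] := g01 x.
    case: (leP (f x) (g x)) => h; case: (x \in A); case: (x \in B) => /=;
    rewrite ?subr0 ?sub0r ?normrN; do ?[rewrite (ger0_norm f0)]; do ?[rewrite (ger0_norm g0)];
    do ?[rewrite (@ger0_norm _ (1 - f x)); last by lra]; do ?[rewrite (@ger0_norm _ (1 - g x)); last by lra];
    lra.
  - apply/bounded_meas_norm/bounded_measB; last exact: bounded_itv.
    by apply: bounded_meas_indic; exact: measurableU.
  - exact: bounded_measD.
by rewrite RintD// [leRHS](splitr e) lerD.
Qed.

(** A finite union carries all but e / 2 of the mass for every measure of the family, and finite
    unions are handled by maxima. *)
Lemma approximable_bigcup (F : nat -> set T) : (forall k, approximable (F k)) ->
  approximable (\bigcup_k F k).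
Proof.
move=> hF; have mF k : measurable (F k) by have [] := hF k.
split; first exact: bigcupT_measurable.
move=> e e0; have e2 : 0 < e / 2 by rewrite divr_gt0.
pose U n := \big[setU/set0]_(k < n) F k.
have hU n : approximable (U n).
  rewrite /U; elim: n => [|n IH]; first by rewrite big_ord0; exact: approximable0.
  by rewrite big_ord_recr /=; exact: approximableU.
pose G n := (\bigcup_k F k) `\` U n.
have mG n : measurable (G n).
  by apply: measurableD; [exact: bigcupT_measurable|have [] := hU n].
have [||n hn] := nonincreasing_small G (e / 2) mG _ _ e2.
- apply/nonincreasing_seqP => k; apply/subsetPset => x [h1 h2]; split => // h3.
  by apply: h2; rewrite /U big_ord_recr /=; left.
- move=> j; rewrite (_ : \bigcap_k G k = set0) ?measure0//; apply/seteqP; split => // x h.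
  have [[k _ Fk] _] := h 0%N I; have [_] := h k.+1 I; apply.
  by rewrite /U big_ord_recr /=; right.
have [_ /(_ _ e2)[g [hg g01 gU]]] := hU n.
exists g; split => // j.
have bU : bounded_meas (fun x => `|\1_(U n) x - g x|).
  apply/bounded_meas_norm/bounded_measB; last exact: bounded_itv.
  by apply: bounded_meas_indic; have [] := hU n.
apply: (@le_trans _ _ (\int[P j]_x (\1_(G n) x + `|\1_(U n) x - g x|))).
  apply: le_Rint.
  - apply/bounded_meas_norm/bounded_measB; last exact: bounded_itv.
    by apply: bounded_meas_indic; exact: bigcupT_measurable.
  - by apply: bounded_measD => //; exact: bounded_meas_indic.
  move=> x; have -> : \1_(\bigcup_k F k) x = \1_(G n) x + \1_(U n) x :> R.
    rewrite !indicE; have [hU'|hU'] := boolP (x \in U n).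
      rewrite [x \in G n]memNset ?add0r; last by move=> [_]; apply; rewrite -in_setE.
      rewrite mem_set//; move: hU'; rewrite in_setE /U -bigcup_mkord => -[k _ Fk].
      by exists k.
    rewrite addr0; congr ((nat_of_bool _)%:R); apply/idP/idP; rewrite !in_setE.
      by move=> h; split => //; rewrite notin_setE in hU'.
    by case.
  by rewrite -addrA (le_trans (ler_normD _ _))// lerD2r ger0_norm// indicE.
rewrite RintD//; last exact: bounded_meas_indic.
by rewrite [leRHS](splitr e) lerD// Rint_indic.
Qed.

Lemma approximable_ae A B : measurable B ->
  (forall j, {ae P j, forall x, A x <-> B x}) -> approximable A -> approximable B.
Proof.
move=> mB AB [mA hA]; split => // e e0; have [g [hg g01 gA]] := hA e e0.
exists g; split => // j; rewrite (le_trans _ (gA j))// /Rintegral.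
rewrite (@ae_eq_integral _ _ _ (P j) setT (fun x => `|\1_A x - g x|%:E) (fun x => `|\1_B x - g x|%:E))//.
- apply/measurable_EFinP; apply: (bounded_meas_norm _ _).1.
  by apply: bounded_measB; [exact: bounded_meas_indic|exact: bounded_itv].
- apply/measurable_EFinP; apply: (bounded_meas_norm _ _).1.
  by apply: bounded_measB; [exact: bounded_meas_indic|exact: bounded_itv].
apply: filterS (AB j) => x [h1 h2] _; congr (`| _ - _ |%:E).
rewrite !indicE; congr ((nat_of_bool _)%:R).
by apply/idP/idP; rewrite !in_setE.
Qed.

End Approximable.

(** * Clamped coordinates generate the measurable sets of the box *)

Section BoxAlgebra.
Context {R : realType} (r : R) (n : nat).
Hypothesis r0 : 0 < r.

Definition clampr (y : R) : R := Num.max (- r) (Num.min y r).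

Lemma clampr_itv y : - r <= clampr y <= r.
Proof.
rewrite /clampr le_max lexx /= ge_max ge_min lexx orbT andbT.
by rewrite lerNl (le_trans _ (ltW r0))// oppr_le0 ltW.
Qed.

Lemma clampr_id y : - r <= y <= r -> clampr y = y.
Proof. by move=> /andP[h1 h2]; rewrite /clampr min_l// max_r. Qed.

Lemma clampr_bounded : bounded_meas clampr.
Proof.
split; last by exists r => y; rewrite ler_norml; exact: clampr_itv.
by apply: measurable_maxr; [exact: measurable_cst|apply: measurable_minr => //; exact: measurable_cst].
Qed.

Definition coordX (i : 'I_n) (x : n.-tuple R) : R := clampr (tnth x i).

Lemma coordX_bounded (i : 'I_n) : bounded_meas (coordX i).
Proof.
have [mc [K cK]] := clampr_bounded; split; last by exists K => x; exact: cK.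
exact: (measurableT_comp mc (measurable_tnth i)).
Qed.

(** Approximable sets form a sigma-algebra. It contains the half spaces, since clamped and true
    coordinates agree almost surely, and half spaces generate first each coordinate and then the
    tuples. *)
Lemma approximable_measurable {J : finType} (P : J -> probability (n.-tuple R) R)
    (B : set (n.-tuple R)) :
  (forall j, P j (box r n) = 1%E) -> measurable B -> approximable coordX P B.
Proof.
move=> Pbox.
have aebox j : {ae P j, forall x, box r n x}.
  exists (~` box r n); split => //; first by apply: measurableC; exact: measurable_box.
  by rewrite probability_setC ?Pbox ?subee//; exact: measurable_box.
have half i (t : R) : approximable coordX P [set x | t < tnth x i].
  apply: (approximable_ae _ coordX_bounded _ [set x | t < coordX i x]); last first.
  - by apply: approximable_halfline; [exact: coordX_bounded|apply: polyapprox_gen; exact: coordX_bounded].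
  - by move=> j; apply: filterS (aebox j) => x bx; rewrite /= /coordX clampr_id//; exact: bx.
  rewrite (_ : [set x | _] = setT `&` (fun x : n.-tuple R => tnth x i) @^-1` `]t, +oo[).
    exact: measurable_tnth.
  by rewrite setTI; apply/seteqP; split => x /=; rewrite in_itv/= andbT.
have SA : sigma_algebra setT (approximable coordX P).
  split; first exact: approximable0.
  - by move=> A hA; rewrite setTD; apply: approximableC => //; exact: coordX_bounded.
  - by move=> F hF; apply: approximable_bigcup => //; exact: coordX_bounded.
have pre i (C : set R) : measurable C -> approximable coordX P ((fun x => tnth x i) @^-1` C).
  rewrite [measurable](_ : _ = (@RGenOInfty.G R).-sigma.-measurable); last exact: RGenOInfty.measurableE.
  move: C; apply: smallest_sub => /=.
    split.
    - by rewrite /= preimage_set0; exact: approximable0.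
    - by move=> A hA; rewrite /= setTD preimage_setC; apply: approximableC => //; exact: coordX_bounded.
    - by move=> F hF; rewrite /= preimage_bigcup; apply: approximable_bigcup => //; exact: coordX_bounded.
  move=> _ [t ->] /=; rewrite (_ : _ @^-1` _ = [set x | t < tnth x i]); first exact: half.
  by apply/seteqP; split => x /=; rewrite in_itv/= andbT.
move: B; apply: smallest_sub => // A.
rewrite -bigcup_seq /= => -[i _ [C mC <-]]; rewrite setTI.
exact: pre.
Qed.

End BoxAlgebra.

(** * Partitions without boundary mass *)

Section NonAtom.
Context {R : realType}.
Local Open Scope ereal_scope.

(* Tonelli on the diagonal: [\int P{t} dt = \int leb{x} dP(x) = 0]. *)
Lemma ae_non_atom (P : probability R R) : {ae lebR, forall t, P [set t] = 0}.
Proof.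
pose D : set (R * R) := [set z | z.1 = z.2].
have mD : measurable D.
  have msub : measurable_fun setT (fun z : R * R => (z.1 - z.2)%R).
    by apply: measurable_funB.
  rewrite (_ : D = setT `&` (fun z : R * R => (z.1 - z.2)%R) @^-1` [set 0%R]); first exact: msub.
  rewrite setTI; apply/seteqP; split => -[x y]; rewrite /D /=; first by move=> ->; rewrite subrr.
  by move=> /eqP; rewrite subr_eq0 => /eqP.
have mf : measurable_fun setT (fun z : R * R => (\1_D z)%:E : \bar R).
  by apply/measurable_EFinP; exact: measurable_indic.
have f0 (z : R * R) : 0 <= ((\1_D z)%:E : \bar R) by rewrite lee_fin.
have I1 t : \int[P]_x (\1_D (x, t))%:E = P [set t].
  by rewrite -(setIT [set t]) -integral_indic//; apply: eq_integral => x _.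
have I2 x : \int[lebR]_t (\1_D (x, t))%:E = 0.
  transitivity (\int[lebR]_t (\1_[set x] t)%:E).
    apply: eq_integral => t _.
    by rewrite !indicE; congr ((nat_of_bool _)%:R%:E); apply/idP/idP; rewrite !in_setE.
  by rewrite integral_indic// setIT; exact: lebesgue_measure_set1.
have := fubini_tonelli (m1 := P) (m2 := lebR) (fun z : R * R => (\1_D z)%:E : \bar R) mf f0.
rewrite /fubini_F /fubini_G.
under eq_integral do rewrite I2.
rewrite integral0; under eq_integral do rewrite I1.
move=> /esym H.
have mP : measurable_fun setT (fun t => P [set t]).
  have := @measurable_fun_fubini_tonelli_G _ _ _ _ _ P (fun z : R * R => (\1_D z)%:E : \bar R) mf f0.
  by apply: eq_measurable_fun => t _; rewrite /fubini_G I1.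
have : ae_eq lebR setT (fun t => P [set t]) (cst 0).
  apply/ae_eq_integral_abs => //; rewrite -[RHS]H; apply: eq_integral => t _.
  by rewrite gee0_abs.
by apply: filterS => t h; exact: h.
Qed.

Lemma ex_non_atom {J : finType} (P : J -> probability R R) (a b : R) : (a < b)%R ->
  exists t, (a < t < b)%R /\ forall j, P j [set t] = 0.
Proof.
move=> ab; have [N [mN N0 sN]] : {ae lebR, forall t, forall j, P j [set t] = 0}.
  by apply: filter_forall => j; exact: ae_non_atom.
apply: contrapT => H.
have sub : `]a, b[%classic `<=` N.
  move=> t tab; apply: sN => /= h; apply: H; exists t; split => //.
have : lebR `]a, b[%classic = 0 by apply: (@subset_measure0 _ _ _ lebR _ N).
rewrite /lebR lebesgue_measure_itv/= lte_fin ab -EFinD => /eqP.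
by rewrite eqe subr_eq0 gt_eqF.
Qed.

End NonAtom.

Section Partition.
Context {R : realType} (r : R) (n : nat) (mu : probability (n.-tuple R) R).
Variable Xi : forall N : nat, 'I_n -> 'I_N -> R.
Hypothesis r0 : 0 < r.
Hypothesis mu_box : mu (box r n) = 1%E.
Hypothesis hXi : approx_seq r n mu Xi.

Let X1 (_ : unit) : R -> R := clampr r.
Let X1_bounded u : bounded_meas (X1 u).
Proof. exact: clampr_bounded. Qed.
Let P (i : 'I_n) : probability R R := margp n mu i.

Lemma kappaD (N : nat) (f g : 'I_N -> R) :
  kappa N (fun j => f j + g j) = kappa N f + kappa N g.
Proof. by rewrite /kappa big_split mulrDr. Qed.

Lemma kappaZ (N : nat) (c : R) (f : 'I_N -> R) :
  kappa N (fun j => c * f j) = c * kappa N f.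
Proof. by rewrite /kappa [RHS]mulrCA; congr (_ * _); rewrite mulr_sumr. Qed.

Lemma le_kappa (N : nat) (f g : 'I_N -> R) : (forall j, f j <= g j) ->
  kappa N f <= kappa N g.
Proof. by move=> fg; rewrite /kappa ler_wpM2l ?invr_ge0// ler_sum. Qed.

Lemma kappa_cst_le (N : nat) (c : R) : 0 <= c -> kappa N (fun=> c) <= c.
Proof.
move=> c0; rewrite /kappa sumr_const card_ord; have [->|N0] := posnP N.
  by rewrite mulr0n mulr0.
by rewrite -[c *+ N]mulr_natr mulrCA mulVf ?mulr1// gt_eqF// ltr0n.
Qed.

Lemma kappa_dist (N : nat) (f g : 'I_N -> R) (e : R) : 0 <= e ->
  (forall j, `|f j - g j| <= e) -> `|kappa N f - kappa N g| <= e.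
Proof.
move=> e0 fg; apply: le_trans (kappa_cst_le N e e0).
rewrite /kappa -mulrBr -sumrB normrM ger0_norm ?invr_ge0//.
by rewrite ler_wpM2l ?invr_ge0// (le_trans (ler_norm_sum _ _ _))// ler_sum.
Qed.

Lemma Xi_itv N i j : - r <= Xi N i j <= r.
Proof. by have [h _ _] := hXi; exact: h. Qed.

Lemma cvg_moment (i : 'I_n) (w : seq unit) :
  (fun N => kappa N (fun j => monomial X1 w (Xi N i j))) @ \oo -->
  \int[P i]_x monomial X1 w x.
Proof.
have mE x : monomial X1 w x = clampr r x ^+ size w.
  by rewrite /monomial; elim: w => [|u w IH] /=; rewrite ?big_nil// big_cons IH exprS.
have [_ _ /(_ i (size w)) H] := hXi.
have E : (\int[marg n mu i]_x (x ^+ size w)%:E)%E = (\int[P i]_x monomial X1 w x)%:E.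
  rewrite EFin_Rint; last exact: monomial_bounded.
  apply: (@ae_eq_integral _ _ _ (P i)) => //.
  - by apply/measurable_EFinP; exact: measurable_funX.
  - by apply/measurable_EFinP; exact: (monomial_bounded X1 X1_bounded w).1.
  exists (~` `[(- r), r]%classic); split.
  - exact: measurableC.
  - exact: (marg_boxC r n mu mu_box i).
  - move=> x h xr; apply: h; move: xr; rewrite /= in_itv/= => xr _.
    by rewrite mE clampr_id.
rewrite E in H; move/fine_cvg : H => /=.
apply: cvg_trans; apply: near_eq_cvg; apply: nearW => N /=; congr kappa.
by apply/funext => j; rewrite mE clampr_id//; exact: Xi_itv.
Qed.

Lemma cvg_kappa_polyapprox (i : 'I_n) (f : R -> R) : polyapprox X1 f ->
  (fun N => kappa N (fun j => f (Xi N i j))) @ \oo --> \int[P i]_x f x.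
Proof.
move=> hf; have bf := polyapprox_bounded X1 X1_bounded _ hf.
have [mf {}hf] := hf.
have cvgp p : (fun N => kappa N (fun j => peval X1 p (Xi N i j))) @ \oo --> \int[P i]_x peval X1 p x.
  elim: p => [|[c w] p IH].
    rewrite (_ : Rintegral _ _ _ = 0); last first.
      by rewrite -[RHS](Rint_cst (P i)); apply: eq_Rintegral => x _; rewrite /peval big_nil.
    apply: cvg_near_cst; apply: nearW => N; rewrite /kappa big1 ?mulr0// => j _.
    by rewrite /peval big_nil.
  have bm := monomial_bounded X1 X1_bounded w.
  have bp := peval_bounded X1 X1_bounded p.
  rewrite (_ : Rintegral _ _ _ = c * \int[P i]_x monomial X1 w x + \int[P i]_x peval X1 p x); last first.
    rewrite -RintZl// -RintD//.
      by apply: eq_Rintegral => x _; rewrite /peval big_cons.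
    exact: bounded_measZ.
  rewrite (_ : (fun N => _) = (fun N => c * kappa N (fun j => monomial X1 w (Xi N i j)) +
     kappa N (fun j => peval X1 p (Xi N i j)))); last first.
    apply/funext => N; rewrite -kappaZ -kappaD; congr kappa; apply/funext => j.
    by rewrite /peval big_cons.
  by apply: cvgD => //; apply: cvgMr; exact: cvg_moment.
apply/cvgrPdist_le => e e0; have e3 : 0 < e / 3 by rewrite divr_gt0.
have [p fp] := hf _ e3; have bp := peval_bounded X1 X1_bounded p.
have /cvgrPdist_le/(_ _ e3) := cvgp p; apply: filterS => N.
have h1 : `|kappa N (fun j => f (Xi N i j)) - kappa N (fun j => peval X1 p (Xi N i j))| <= e / 3.
  by apply: kappa_dist => //; exact: ltW.
have h2 : `|\int[P i]_x f x - \int[P i]_x peval X1 p x| <= e / 3.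
  exact: Rint_dist.
move: h1 h2; rewrite !ler_norml => /andP[? ?] /andP[? ?] /andP[? ?].
by apply/andP; split; lra.
Qed.

(** Sets whose indicator is squeezed between test functions with close integrals, for all marginals
    at once. Convergence of moments controls the frequencies of exactly such sets by this squeeze,
    in place of the portmanteau theorem. *)
Definition riemann_set (B : set R) : Prop := measurable B /\
  forall e : R, 0 < e -> exists f g, [/\ polyapprox X1 f, polyapprox X1 g,
    (forall x, [/\ 0 <= f x, f x <= \1_B x, \1_B x <= g x & g x <= 1]) &
    forall i, \int[P i]_x (g x - f x) <= e].

Lemma riemannC B : riemann_set B -> riemann_set (~` B).
Proof.
move=> [mB hB]; split; first exact: measurableC.
move=> e e0; have [f [g [hf hg fBg ie]]] := hB e e0.
exists (fun x => 1 - g x), (fun x => 1 - f x); split.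
- by apply: polyapproxB => //; exact: polyapprox_cst.
- by apply: polyapproxB => //; exact: polyapprox_cst.
- move=> x; have [h1 h2 h3 h4] := fBg x.
  have -> : \1_(~` B) x = 1 - \1_B x :> R.
    by rewrite !indicE in_setC; case: (x \in B) => /=; rewrite ?subr0 ?subrr.
  by split; lra.
- move=> i; rewrite (le_trans _ (ie i))// le_eqVlt; apply/orP; left; apply/eqP.
  by apply: eq_Rintegral => x _; lra.
Qed.

Lemma riemannI A B : riemann_set A -> riemann_set B -> riemann_set (A `&` B).
Proof.
move=> [mA hA] [mB hB]; split; first exact: measurableI.
move=> e e0; have e2 : 0 < e / 2 by rewrite divr_gt0.
have [f [g [hf hg fAg ie]]] := hA _ e2.
have [f' [g' [hf' hg' fBg' ie']]] := hB _ e2.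
exists (fun x => f x * f' x), (fun x => g x * g' x); split.
- exact: polyapproxM.
- exact: polyapproxM.
- move=> x; have [h1 h2 h3 h4] := fAg x; have [k1 k2 k3 k4] := fBg' x.
  have -> : \1_(A `&` B) x = \1_A x * \1_B x :> R by rewrite indicI.
  by split; rewrite ?mulr_ge0 ?ler_pM ?mulr_ile1//; lra.
- move=> i; have b q : polyapprox X1 q -> bounded_meas q by exact: polyapprox_bounded.
  have [bf bg bf' bg'] : [/\ bounded_meas f, bounded_meas g, bounded_meas f' & bounded_meas g'] by split; apply: b.
  apply: (@le_trans _ _ (\int[P i]_x ((g x - f x) + (g' x - f' x)))).
    apply: le_Rint.
    + by apply: bounded_measB; exact: bounded_measM.
    + by apply: bounded_measD; exact: bounded_measB.
    move=> x; have [h1 h2 h3 h4] := fAg x; have [k1 k2 k3 k4] := fBg' x.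
    (* The difference of the products is g' (g - f) + f (g' - f'), with g' and f at most 1. *)
    have : 0 <= (1 - g' x) * (g x - f x) by apply: mulr_ge0; lra.
    have : 0 <= (1 - f x) * (g' x - f' x) by apply: mulr_ge0; lra.
    by lra.
  by rewrite RintD; [rewrite [leRHS](splitr e) lerD|exact: bounded_measB|exact: bounded_measB].
Qed.

Lemma riemannT : riemann_set setT.
Proof.
split=> // e e0; exists (fun=> 1), (fun=> 1); split; try exact: polyapprox_cst.
  by move=> x; rewrite indicE in_setT; split; rewrite ?ler01 ?lexx.
by move=> i; under eq_Rintegral do rewrite subrr; rewrite Rint_cst ltW.
Qed.

(** Two ramps, one starting and one ending at [t], differ only within 1 / (k+1) of [t]; these
    neighbourhoods shrink to the point [t], which is null. As [t] is interior, clamping moves no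
    other point onto it. *)
Lemma riemann_halfline (t : R) : - r < t < r -> (forall i, P i [set t] = 0%E) ->
  riemann_set [set x | t < x].
Proof.
move=> /andP[rt tr] Pt; split.
  rewrite (_ : [set x | _] = `]t, +oo[%classic) //.
  by apply/seteqP; split => x /=; rewrite in_itv/= andbT.
move=> e e0.
have [mc _] := clampr_bounded r r0.
have clt x : (t < clampr r x) = (t < x).
  by rewrite /clampr lt_max ltNge (ltW rt) /= lt_min tr andbT.
have ct x : clampr r x = t -> x = t.
  move=> h; have : t <= clampr r x <= t by rewrite h lexx.
  rewrite /clampr le_max leNgt rt /= le_min => /andP[/andP[tx _]].
  rewrite ge_max => /andP[_]; rewrite ge_min [r <= t]leNgt tr orbF => xt.
  by apply/eqP; rewrite eq_le tx xt.
pose F (k : nat) := [set x | `|clampr r x - t| <= k.+1%:R^-1].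
have bF : bounded_meas (fun x => `|clampr r x - t|).
  by apply/bounded_meas_norm/bounded_measB; [exact: clampr_bounded|exact: bounded_meas_cst].
have mF k : measurable (F k).
  rewrite (_ : F k = setT `&` (fun x => `|clampr r x - t|) @^-1` `]-oo, k.+1%:R^-1]).
    by apply: bF.1.
  by rewrite setTI; apply/seteqP; split => x /=; rewrite in_itv/=.
have [|j|k hk] := nonincreasing_small P F e mF _ _ e0.
- apply/nonincreasing_seqP => k; apply/subsetPset => x /= h.
  by apply: (le_trans h); rewrite lef_pV2 ?posrE ?ltr0n// ler_nat.
- rewrite (_ : \bigcap_k F k = [set t]); first exact: Pt.
  apply/seteqP; split => [x h|x ->]; last first.
    move=> k _; rewrite /F /= clampr_id ?subrr ?normr0 ?invr_ge0//.
    by rewrite !ltW.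
  apply: ct; apply/eqP; rewrite -subr_eq0 -normr_eq0; apply/negPn/negP => h0.
  have hp : 0 < `|clampr r x - t| by rewrite lt_neqAle eq_sym h0 normr_ge0.
  have := h (Num.truncn `|clampr r x - t|^-1) I; apply/negP.
  rewrite -ltNge invf_plt ?posrE ?ltr0n//; exact: truncnS_gt.
have k0 : (0 : R) < k.+1%:R by rewrite ltr0n.
pose u x := k.+1%:R * (clampr r x - t).
have hu : polyapprox X1 u.
  apply: polyapproxZ => //; apply: polyapproxB => //; last exact: polyapprox_cst.
  exact: (polyapprox_gen X1 X1_bounded tt).
have hu1 : polyapprox X1 (fun x => u x + 1).
  by apply: polyapproxD => //; exact: polyapprox_cst.
have hf : polyapprox X1 (fun x => clamp01 (u x)) by exact: polyapprox_clamp01.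
have hg : polyapprox X1 (fun x => clamp01 (u x + 1)) by exact: polyapprox_clamp01.
have c1 y : 1 <= y -> clamp01 y = 1.
  by move=> y1; rewrite /clamp01 min_r// max_r.
have c0 y : y <= 0 -> clamp01 y = 0.
  by move=> y1; rewrite /clamp01 min_l ?max_l// (le_trans y1).
exists (fun x => clamp01 (u x)), (fun x => clamp01 (u x + 1)); split => //.
  move=> x; rewrite indicE.
  have /andP[f0 f1] := clamp01_itv (u x); have /andP[g0 g1] := clamp01_itv (u x + 1).
  have [h|h] := boolP (t < x).
    rewrite mem_set//; split => //; rewrite c1// lerDr mulr_ge0 ?(ltW k0)//.
    by rewrite subr_ge0 ltW// clt.
  rewrite memNset; last exact/negP.
  split => //; rewrite c0// mulr_ge0_le0 ?(ltW k0)// subr_le0 leNgt clt//.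
move=> i; rewrite (le_trans _ (hk i))// -Rint_indic//; apply: le_Rint.
- apply: bounded_measB; exact: (polyapprox_bounded X1 X1_bounded).
- exact: bounded_meas_indic.
move=> x; rewrite indicE.
have /andP[f0 f1] := clamp01_itv (u x); have /andP[g0 g1] := clamp01_itv (u x + 1).
have [h|/negP h] := boolP (`|clampr r x - t| <= k.+1%:R^-1).
  by rewrite mem_set//= ?mulr1n; lra.
rewrite memNset//=; move/negP: h; rewrite -ltNge => h.
have : 1 < `|u x|.
  by rewrite /u normrM gtr0_norm// -ltr_pdivrMl// mulr1.
rewrite lter_normr => /orP[h'|h'].
  by rewrite !c1 ?subrr//; lra.
by rewrite !c0 ?subrr//; lra.
Qed.

Lemma cvg_freq_riemann B i : riemann_set B ->
  (fun N => kappa N (fun j => \1_B (Xi N i j))) @ \oo --> fine (P i B).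
Proof.
move=> [mB hB]; apply/cvgrPdist_le => e e0.
have e2 : 0 < e / 2 by rewrite divr_gt0.
have [f [g [hf hg fBg ie]]] := hB _ e2.
have bf := polyapprox_bounded X1 X1_bounded _ hf.
have bg := polyapprox_bounded X1 X1_bounded _ hg.
have := ie i; rewrite RintB// => {}ie.
have Pf : \int[P i]_x f x <= fine (P i B).
  rewrite -Rint_indic//; apply: le_Rint => //; first exact: bounded_meas_indic.
  by move=> x; have [] := fBg x.
have Pg : fine (P i B) <= \int[P i]_x g x.
  rewrite -Rint_indic//; apply: le_Rint => //; first exact: bounded_meas_indic.
  by move=> x; have [] := fBg x.
have /cvgrPdist_le/(_ _ e2) Hf := cvg_kappa_polyapprox i _ hf.
have /cvgrPdist_le/(_ _ e2) Hg := cvg_kappa_polyapprox i _ hg.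
apply: filterS2 Hf Hg => N.
have kf : kappa N (fun j => f (Xi N i j)) <= kappa N (fun j => \1_B (Xi N i j)).
  by apply: le_kappa => j; have [] := fBg (Xi N i j).
have kg : kappa N (fun j => \1_B (Xi N i j)) <= kappa N (fun j => g (Xi N i j)).
  by apply: le_kappa => j; have [] := fBg (Xi N i j).
rewrite !ler_norml => /andP[? ?] /andP[? ?].
by apply/andP; split; lra.
Qed.

(** The cells cover the whole line; closeness to the centre is asked only after clamping. *)
Definition fine_partition (dl : R) (C : finType) (cell : R -> C) (ctr : C -> R) : Prop :=
  [/\ forall k, measurable (cell @^-1` [set k]),
      forall k, - r <= ctr k <= r,
      forall x, `|clampr r x - ctr (cell x)| <= dl &
      forall i k, (fun N => (cnt C N (fun j => cell (Xi N i j)) k)%:R / N%:R) @ \oo -->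
        fine (P i (cell @^-1` [set k]))].

(* Cutting at points that are atoms of no marginal keeps the cell frequencies convergent. *)
Lemma ex_partition (dl : R) : 0 < dl ->
  exists (C : finType) (cell : R -> C) (ctr : C -> R), fine_partition dl C cell ctr.
Proof.
move=> dl0; pose K := (Num.truncn (4 * r / dl)).+1.
pose eta := 2 * r / K%:R.
have K0 : (0 : R) < K%:R by rewrite ltr0n.
have eta0 : 0 < eta by rewrite divr_gt0// mulr_gt0.
have etadl : 2 * eta <= dl.
  rewrite /eta mulrA ler_pdivrMr// mulrA -ler_pdivrMl//.
  have -> : dl^-1 * (2 * 2 * r) = 4 * r / dl by rewrite mulrC; congr (_ * _); lra.
  by apply: ltW; exact: truncnS_gt.
have Keta : K%:R * eta = 2 * r by rewrite /eta mulrCA divff ?mulr1 // gt_eqF.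
have tK (k : 'I_K) : exists t, - r + k%:R * eta < t < - r + k.+1%:R * eta /\
    forall i, P i [set t] = 0%E.
  by apply: ex_non_atom; rewrite ltrD2l ltr_pM2r// ltr_nat.
have [t ht] := choice tK.
(* A cell is the vector of comparisons with all cut points, so it is a finite intersection of half
   lines and their complements; many of these vectors are never attained. *)
pose cell x : {ffun 'I_K -> bool} := [ffun k => t k < x].
have cell_close x y : - r <= x <= r -> - r <= y <= r -> x <= y ->
    cell x = cell y -> y - x <= dl.
  move=> /andP[rx _] /andP[_ yr] xy cxy; rewrite leNgt; apply/negP => yx.
  have xr0 : 0 <= (x + r) / eta by rewrite divr_ge0 ?(ltW eta0)//; lra.
  have /andP[m1 m2] := truncn_itv xr0.
  set m := Num.truncn ((x + r) / eta) in m1 m2.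
  rewrite ler_pdivlMr// in m1; rewrite ltr_pdivrMr// in m2.
  (* [x] lies in interval [m]; the cut of the next interval lies above [x] and below x + 2 eta,
     hence below [y], and separates them. *)
  have mS : (m.+1 < K)%N.
    rewrite -(ltr_nat R) -(ltr_pM2r eta0) Keta.
    rewrite -natr1 mulrDl mul1r; lra.
  have /= [/andP[t1 t2] _] := ht (Ordinal mS).
  move/ffunP : cxy => /(_ (Ordinal mS)); rewrite !ffunE.
  have -> : (t (Ordinal mS) < x) = false.
    by apply/negbTE; rewrite -leNgt ltW// (le_lt_trans _ t1)//; lra.
  move/esym/negbT/negP; apply; apply: (lt_trans t2).
  rewrite -natr1 mulrDl mul1r -[m.+1%:R]natr1 mulrDl mul1r; lra.
have ctrP (c : {ffun 'I_K -> bool}) : exists y, - r <= y <= r /\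
    forall x, - r <= x <= r -> cell x = c -> `|x - y| <= dl.
  have [[y [yr yc]]|no] := pselect (exists y, - r <= y <= r /\ cell y = c).
    exists y; split => // x xr xc.
    have [xy|/ltW yx] := leP x y.
      by rewrite distrC ger0_norm ?subr_ge0// cell_close// xc yc.
    by rewrite ger0_norm ?subr_ge0// cell_close// xc yc.
  (* No point of [-r, r] has this vector, so any centre will do. *)
  exists 0; split; first by rewrite oppr_le0 ltW.
  by move=> x xr xc; case: no; exists x.
have [ctr hctr] := choice ctrP.
have riem (c : {ffun 'I_K -> bool}) : riemann_set (cell @^-1` [set c]).
  have rs (s : seq 'I_K) : riemann_set [set x | all (fun k => (t k < x) == c k) s].
    elim: s => [|k s IH].
      by rewrite (_ : [set x | _] = setT); [exact: riemannT|exact/seteqP].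
    have half : riemann_set [set x | t k < x].
      have [/andP[t1 t2] at0] := ht k; apply: riemann_halfline => //.
      apply/andP; split; first by apply: le_lt_trans t1; rewrite lerDl mulr_ge0// ltW.
      apply: (lt_le_trans t2); rewrite -lerBrDl (_ : r - - r = K%:R * eta).
        by rewrite ler_pM2r// ler_nat.
      by rewrite Keta; lra.
    rewrite (_ : [set x | _] = (if c k then [set x | t k < x] else ~` [set x | t k < x])
        `&` [set x | all (fun k => (t k < x) == c k) s]).
      by apply: riemannI => //; case: (c k) => //; exact: riemannC.
    apply/seteqP; split => x /=.
      by move=> /andP[/eqP h1 h2]; split => //; case: (c k) h1 => /= ->.
    move=> [h1 h2]; rewrite h2 andbT; apply/eqP.
    by case: (c k) h1 => //=; move/negP/negbTE.
  have := rs (enum 'I_K); rewrite (_ : [set x | _] = cell @^-1` [set c])//.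
  apply/seteqP; split => x /=.
    by move=> /allP h; apply/ffunP => k; rewrite ffunE; apply/eqP/h; rewrite mem_enum.
  by move=> <-; apply/allP => k _; rewrite ffunE.
exists {ffun 'I_K -> bool}, cell, ctr; split.
- by move=> c; have [] := riem c.
- by move=> c; have [] := hctr c.
(* Every cut point is at least -r and less than r, so clamping does not change the cell. *)
- move=> x; have [_] := hctr (cell x); apply; first exact: clampr_itv.
  apply/ffunP => k; rewrite !ffunE; have [/andP[t1 t2] _] := ht k.
  rewrite /clampr lt_max lt_min [X in X || _]ltNge.
  have -> : - r <= t k by rewrite (le_trans _ (ltW t1))// lerDl mulr_ge0// ltW.
  suff -> : t k < r by rewrite andbT.
  apply: (lt_le_trans t2); rewrite -lerBrDl (_ : r - - r = K%:R * eta).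
    by rewrite ler_pM2r// ler_nat.
  by rewrite Keta; lra.
move=> i c; have := cvg_freq_riemann _ i (riem c).
apply: cvg_trans; apply: near_eq_cvg; apply: nearW => N.
rewrite /kappa mulrC; congr (_ / _).
rewrite /cnt natr_sum; apply: eq_bigr => j _; rewrite indicE; congr (nat_of_bool _)%:R.
by apply/idP/eqP; rewrite in_setE.
Qed.

End Partition.

(** * Variational lower bound for the relative entropy *)

Section RelentLower.
Context {R : realType} {d} {T : measurableType d} (mu Q : probability T R).
Variable J : (T -> \bar R) -> \bar R.
Hypothesis JQ : forall g, measurable_fun setT g -> (forall x, 0 <= g x)%E ->
  J g = (\int[Q]_x g x)%E.

(** Integrate exp y >= 1 + y at y = g - ln f under [mu]. The bound has the linearization 1 - z in
    place of - ln z, which spares a normalization of exp g. *)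
Lemma relent_ge (g : T -> R) : bounded_meas g ->
  ((\int[mu]_x g x + 1 - \int[Q]_x expR (g x))%:E <= relent d T J mu)%E.
Proof.
move=> bg; have [[f hf]|no] := pselect (exists f, has_density d T J mu f); last first.
  by rewrite relent_no_density ?leey.
rewrite (relentE Q mu J JQ f)//; have [mf f0 _] := hf; have [mg _] := bg.
have ml : measurable_fun setT (fun x => ln (f x)) by exact: measurableT_comp.
have nf : neg_finite mu (fun x => ln (f x)).
  split => //; apply: (density_ln_neg_lty Q mu J JQ _ setT hf) => //.
    by rewrite [X in (X < _)%E]probability_setT ltry.
  by rewrite setCT measure0.
have nf_ge0 (h : T -> R) : measurable_fun setT h -> (forall x, 0 <= h x) -> neg_finite mu h.
  move=> mh h0; split => //; rewrite integral0_eq ?ltry// => x _.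
  by rewrite funenegE -EFinN max_r// lee_fin oppr_le0.
have nf_bounded (h : T -> R) : bounded_meas h -> neg_finite mu h.
  move=> bh; split; first by have [] := bh.
  exact: (integral_funeneg_lt_pinfty measurableT (bounded_meas_int mu _ bh)).
pose G x := expR (g x - ln (f x)).
have mG : measurable_fun setT G.
  by apply: measurableT_comp => //; exact: measurable_funB.
have G0 x : 0 <= G x by exact: expR_ge0.
have [nF IF] := neg_finiteD mu _ _ nf (nf_ge0 _ mG G0).
(* Only an inequality: [f] may vanish on a set of positive Q measure. *)
have IG : (\int[mu]_x (G x)%:E <= (\int[Q]_x expR (g x))%:E)%E.
  rewrite (density_integral Q mu J JQ _ _ hf)//; last exact/measurable_EFinP.
  rewrite EFin_Rint; last exact: bounded_meas_expR.
  apply: ge0_le_integral => //.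
  - by move=> x _; rewrite -EFinM lee_fin mulr_ge0.
  - by apply: emeasurable_funM; exact/measurable_EFinP.
  - by apply/measurable_EFinP; exact: (bounded_meas_expR _ bg).1.
  move=> x _; rewrite -EFinM lee_fin /G.
  have := f0 x; rewrite le_eqVlt => /orP[/eqP <-|fx]; first by rewrite mul0r expR_ge0.
  by rewrite expRD expRN lnK ?posrE// mulrCA mulfV ?mulr1// gt_eqF.
pose H x := ln (f x) + G x - (g x + 1).
have bg1 : bounded_meas (fun x => g x + 1) by apply: bounded_measD => //; exact: bounded_meas_cst.
have mH : measurable_fun setT H.
  by apply: measurable_funB; [exact: nF.1|exact: bg1.1].
have H0 x : 0 <= H x.
  by have := expR_ge1Dx (g x - ln (f x)); rewrite /H /G; lra.
have [_ I2] := neg_finiteD mu _ _ (nf_bounded _ bg1) (nf_ge0 _ mH H0).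
have : ((\int[mu]_x g x + 1)%:E <= \int[mu]_x (ln (f x))%:E + \int[mu]_x (G x)%:E)%E.
  rewrite -IF (_ : (\int[mu]_x _ = \int[mu]_x (g x + 1 + H x)%:E)%E); last first.
    by apply: eq_integral => x _; congr EFin; rewrite /H /=; ring.
  rewrite I2 (_ : (_ + 1) = \int[mu]_x (g x + 1)).
    by rewrite EFin_Rint// -[leLHS]adde0 leeD2l//; apply: integral_ge0 => x _; rewrite lee_fin.
  by rewrite RintD ?Rint_cst//; exact: bounded_meas_cst.
move: IG; have : (0 <= \int[mu]_x (G x)%:E)%E by apply: integral_ge0 => x _; rewrite lee_fin.
case: (\int[mu]_x (G x)%:E)%E => [a| |]//.
case: (\int[mu]_x (ln (f x))%:E)%E => [b| |]//=.
  by rewrite -EFinD !lee_fin; lra.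
by move=> *; rewrite leey.
Qed.

Lemma relent_ge0 : (0 <= relent d T J mu)%E.
Proof.
have := relent_ge _ (bounded_meas_cst 0).
rewrite Rint_cst (_ : \int[Q]_x _ = 1) ?add0r ?subrr//.
by rewrite -[RHS](Rint_cst Q); apply: eq_Rintegral => x _; rewrite expR0.
Qed.

(* Test the variational bound on small multiples [t \1_B] of an indicator, [t] of the sign of
   [mu B - Q B]. *)
Lemma relent_eq0 : relent d T J mu = 0%E -> forall B, measurable B -> mu B = Q B.
Proof.
move=> S0 B mB; have bB := bounded_meas_indic _ mB.
have [p pE] : exists p, mu B = p%:E by exists (fine (mu B)); rewrite fineK ?fin_num_measure.
have [q qE] : exists q, Q B = q%:E by exists (fine (Q B)); rewrite fineK ?fin_num_measure.
have p01 : 0 <= p <= 1 by rewrite -!lee_fin -pE measure_ge0 probability_le1.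
have q01 : 0 <= q <= 1 by rewrite -!lee_fin -qE measure_ge0 probability_le1.
rewrite pE qE; congr EFin.
(* The test yields t (p - q) <= 2 t^2; with p - q = 4 t this forces t = 0. *)
pose t := (p - q) / 4.
have bt : bounded_meas (fun x => t * \1_B x).
  exact: bounded_measZ.
have := relent_ge _ bt; rewrite S0 lee_fin RintZl// Rint_indic// pE /=.
have -> : \int[Q]_x expR (t * \1_B x) = 1 + (expR t - 1) * q.
  have <- : \int[Q]_x \1_B x = q by rewrite Rint_indic// qE.
  rewrite -RintZl// -[X in X + _](Rint_cst Q 1).
  rewrite -RintD; [|exact: bounded_meas_cst|exact: bounded_measZ].
  apply: eq_Rintegral => x _; rewrite indicE; case: (x \in B) => /=.
    by rewrite !mulr1n !mulr1; ring.
  by rewrite !mulr0n !mulr0 expR0; ring.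
have tle : t <= 1 / 2 by case/andP: p01 => _ ?; case/andP: q01 => ? _; rewrite /t; lra.
(* From exp t <= 1 / (1 - t), for t <= 1/2. *)
have et : expR t - 1 <= t + 2 * t ^+ 2.
  have h := expR_ge1Dx (- t); have h0 : 0 < 1 - t by lra.
  have : expR t <= (1 - t)^-1.
    rewrite -[t in leLHS]opprK expRN lef_pV2 ?posrE ?expR_gt0//.
  have : (1 - t)^-1 <= 1 + t + 2 * t ^+ 2.
    rewrite -[leLHS]mul1r ler_pdivrMr//.
    have : 0 <= t ^+ 2 * (1 - 2 * t) by rewrite mulr_ge0 ?sqr_ge0//; lra.
    by rewrite !expr2; lra.
  lra.
have q0 : 0 <= q by case/andP: q01.
have := ler_wpM2r q0 et => h1 h2.
have q1 : t ^+ 2 * q <= t ^+ 2 by rewrite ler_piMr// ?sqr_ge0//; case/andP: q01.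
have : t * (p - q) <= 2 * t ^+ 2 by lra.
have -> : p - q = 4 * t by rewrite /t; field.
rewrite mulrCA -expr2 => h3.
have : t ^+ 2 = 0 by apply/eqP; rewrite eq_le sqr_ge0 andbT; lra.
move/eqP; rewrite sqrf_eq0 => /eqP; rewrite /t; lra.
Qed.

End RelentLower.

(** * Continuity on the box *)

Section BoxContinuity.
Context {R : realType} (r : R) (n : nat).
Hypothesis r0 : 0 < r.
Local Notation box := (box r n).
Local Notation X := (coordX r n).

Definition unif_cont_box (h : n.-tuple R -> R) : Prop :=
  forall e, 0 < e -> exists2 dl : R, 0 < dl & forall x y, box x -> box y ->
    (forall i, `|tnth x i - tnth y i| <= dl) -> `|h x - h y| <= e.

Lemma unif_cont_cont_box h : unif_cont_box h -> cont_box r n h.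
Proof.
move=> uh x bx e e0; have e2 : 0 < e / 2 by rewrite divr_gt0.
have [dl dl0 H] := uh _ e2; exists dl => // y byy xy.
by rewrite (le_lt_trans (H _ _ bx byy _))// ?ltr_pdivrMr//; [move=> i; exact: ltW|lra].
Qed.

(** Heine's theorem, carried out on row vectors, where the box is a compact product of segments;
    compactness is used in its near-covering form. *)
Lemma cont_unif_cont_box h : cont_box r n h -> unif_cont_box h.
Proof.
move=> ch e e0; have e2 : 0 < e / 2 by rewrite divr_gt0.
pose tup (v : 'rV[R]_n) : n.-tuple R := [tuple v ord0 i | i < n].
pose K := [set v : 'rV[R]_n | forall i, `[- r, r]%classic (v ord0 i)].
have /compact_near_coveringP cK : compact K.
  by apply: (@rV_compact R n (fun=> `[- r, r]%classic)) => i; exact: segment_compact.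
pose Pd (d : R) (v : 'rV[R]_n) := K v -> forall y, box y ->
  (forall i, `|v ord0 i - tnth y i| <= d) -> `|h (tup v) - h y| <= e.
have Kbox v : K v -> box (tup v).
  by move=> Kv i; have := Kv i; rewrite /= in_itv /= tnth_mktuple.
have : \forall d \near 0^'+, K `<=` Pd d.
  apply: cK => v Kv.
  have [d1 d10 H] := ch _ (Kbox _ Kv) _ e2.
  have d2 : 0 < d1 / 2 by rewrite divr_gt0.
  (* Half the radius, so that a displacement of at most d1 / 2 from a point of the ball stays within
     [d1] of the centre. *)
  exists (ball v (d1 / 2), [set d | d < d1 / 2]).
    split => /=; first exact: nbhsx_ballx.
    exact: nbhs_right_lt.
  move=> [v' d] /= [vv' dd] Kv' y yb hy.
  have vvi i : `|v ord0 i - v' ord0 i| < d1 / 2 by have [_ /(_ ord0 i)] := vv'.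
  have h1 : `|h (tup v) - h (tup v')| < e / 2.
    apply: H; first exact: Kbox.
    move=> i; rewrite !tnth_mktuple; apply: (@lt_trans _ _ (d1 / 2)); first exact: vvi.
    lra.
  have h2 : `|h (tup v) - h y| < e / 2.
    apply: H => // i; rewrite tnth_mktuple.
    have := vvi i.
    have := hy i; rewrite !ler_norml !ltr_norml => /andP[? ?] /andP[? ?]; apply/andP; split; lra.
  move: h1 h2; rewrite !ltr_norml ler_norml => /andP[? ?] /andP[? ?]; apply/andP; split; lra.
move=> /(filterI (nbhs_right_gt 0)) /filter_ex [d [d0 Hd]].
exists d => // x y bx byy xy.
have E : tup (\row_i tnth x i) = x by apply: eq_from_tnth => i; rewrite tnth_mktuple mxE.
rewrite -E; apply: (Hd (\row_i tnth x i)) => //.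
- by move=> i; rewrite /= in_itv /= mxE; exact: bx.
- by move=> i; rewrite /= in_itv /= mxE; exact: bx.
- by move=> i; rewrite mxE.
Qed.

(** Replace the factors one by one; M >= 1 lets every partial product be bounded by the full
    power. *)
Lemma prod_lipschitz (I : Type) (w : seq I) (x y : I -> R) (M dl : R) : 1 <= M ->
  0 <= dl -> (forall i, `|x i| <= M) -> (forall i, `|y i| <= M) ->
  (forall i, `|x i - y i| <= dl) ->
  `|\prod_(i <- w) x i - \prod_(i <- w) y i| <= (size w)%:R * M ^+ size w * dl.
Proof.
move=> M1 dl0 xM yM xy; have M0 : 0 <= M by rewrite (le_trans ler01).
have yP v : `|\prod_(i <- v) y i| <= M ^+ size v.
  elim: v => [|i v IH]; first by rewrite big_nil normr1.
  by rewrite big_cons /= exprS normrM ler_pM.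
elim: w => [|i w IH]; first by rewrite !big_nil subrr normr0 !mul0r.
rewrite !big_cons /= exprS.
have -> : x i * \prod_(j <- w) x j - y i * \prod_(j <- w) y j =
  x i * (\prod_(j <- w) x j - \prod_(j <- w) y j) + (x i - y i) * \prod_(j <- w) y j by ring.
rewrite (le_trans (ler_normD _ _))// !normrM.
have h1 : `|x i| * `|\prod_(j <- w) x j - \prod_(j <- w) y j| <= M * ((size w)%:R * M ^+ size w * dl).
  exact: ler_pM.
have h2 : `|x i - y i| * `|\prod_(j <- w) y j| <= dl * M ^+ size w by exact: ler_pM.
have h3 : dl * M ^+ size w <= dl * (M * M ^+ size w).
  by rewrite ler_wpM2l// ler_peMl// exprn_ge0.
rewrite -natr1; lra.
Qed.

Lemma box_coordX x i : box x -> X i x = tnth x i.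
Proof. by move=> bx; rewrite /coordX clampr_id. Qed.

Lemma box_norm_le x i : box x -> `|tnth x i| <= Num.max r 1.
Proof. by move=> bx; rewrite le_max ler_norml bx. Qed.

Lemma monomial_box (w : seq 'I_n) x : box x -> monomial X w x = \prod_(i <- w) tnth x i.
Proof. by move=> bx; apply: eq_bigr => i _; rewrite box_coordX. Qed.

Lemma unif_cont_monomial (w : seq 'I_n) : unif_cont_box (monomial X w).
Proof.
move=> e e0; set c : R := (size w)%:R * Num.max r 1 ^+ size w.
have M1 : 1 <= Num.max r 1 by rewrite le_max lexx orbT.
have c0 : 0 <= c by rewrite mulr_ge0// exprn_ge0// (le_trans ler01).
have c1 : 0 < c + 1 by rewrite ltr_wpDl.
exists (e / (c + 1)); first by rewrite divr_gt0.
move=> x y bx byy xy; rewrite !monomial_box//.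
have d0 : 0 <= e / (c + 1) by rewrite divr_ge0// ltW.
have := prod_lipschitz _ w (fun i => tnth x i) (fun i => tnth y i) _ _ M1 d0
  (fun i => box_norm_le x i bx) (fun i => box_norm_le y i byy) xy.
move/le_trans; apply.
by rewrite -/c mulrA ler_pdivrMr// mulrC ler_wpM2l ?(ltW e0)// lerDl.
Qed.

Lemma unif_cont_peval p : unif_cont_box (peval X p).
Proof.
elim: p => [|[c w] p IH] e e0.
  by exists 1 => // x y _ _ _; rewrite /peval !big_nil subrr normr0 ltW.
have c1 : 0 < `|c| + 1 by rewrite ltr_wpDl.
have e1 : 0 < e / (2 * (`|c| + 1)) by rewrite divr_gt0 // mulr_gt0.
have e2 : 0 < e / 2 by rewrite divr_gt0.
have [d1 d10 H1] := unif_cont_monomial w _ e1; have [d2 d20 H2] := IH _ e2.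
exists (Num.min d1 d2); first by rewrite lt_min d10.
move=> x y bx byy xy.
have h1 : `|monomial X w x - monomial X w y| <= e / (2 * (`|c| + 1)).
  by apply: H1 => // i; rewrite (le_trans (xy i))// ge_min lexx.
have h2 : `|peval X p x - peval X p y| <= e / 2.
  by apply: H2 => // i; rewrite (le_trans (xy i))// ge_min lexx orbT.
rewrite /peval !big_cons /= -/(peval X p x) -/(peval X p y).
have -> : c * monomial X w x + peval X p x - (c * monomial X w y + peval X p y) =
  c * (monomial X w x - monomial X w y) + (peval X p x - peval X p y) by ring.
rewrite (le_trans (ler_normD _ _))// [leRHS](splitr e) lerD// normrM.
apply: (le_trans (ler_wpM2l (normr_ge0 c) h1)).
rewrite mulrA ler_pdivrMr; last by rewrite mulr_gt0.
have := normr_ge0 c; have -> : e / 2 * (2 * (`|c| + 1)) = e * (`|c| + 1) by field.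
by move=> ?; rewrite mulrC ler_wpM2l ?(ltW e0)// lerDl.
Qed.

Lemma polyapprox_cont_box h : polyapprox X h -> cont_box r n h.
Proof.
move=> [_ hh]; apply: unif_cont_cont_box => e e0.
have e3 : 0 < e / 3 by rewrite divr_gt0.
have [p hp] := hh _ e3; have [dl dl0 H] := unif_cont_peval p _ e3.
exists dl => // x y bx byy xy.
have := H _ _ bx byy xy; have := hp x; have := hp y.
by rewrite !ler_norml => /andP[? ?] /andP[? ?] /andP[? ?]; apply/andP; split; lra.
Qed.

Definition clampT (x : n.-tuple R) : n.-tuple R := [tuple clampr r (tnth x i) | i < n].

Lemma clampT_box x : box (clampT x).
Proof. by move=> i; rewrite tnth_mktuple; exact: clampr_itv. Qed.

Lemma clampT_id x : box x -> clampT x = x.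
Proof. by move=> bx; apply: eq_from_tnth => i; rewrite tnth_mktuple clampr_id. Qed.

(** The generators see only clamped coordinates, so their uniform limits do too. *)
Lemma polyapprox_clampT h : polyapprox X h -> (fun x => h (clampT x)) = h.
Proof.
move=> [_ hh]; apply/funext => x; apply/eqP; rewrite -subr_eq0 -normr_eq0 eq_le normr_ge0 andbT.
apply/ler_addgt0Pr => e e0; rewrite add0r.
have e2 : 0 < e / 2 by rewrite divr_gt0.
have [p hp] := hh _ e2.
have E : peval X p (clampT x) = peval X p x.
  apply: eq_bigr => cw _; congr (_ * _); apply: eq_bigr => i _.
  by rewrite /coordX tnth_mktuple clampr_id//; exact: clampr_itv.
have := hp x; have := hp (clampT x); rewrite E.
by rewrite !ler_norml => /andP[? ?] /andP[? ?]; apply/andP; split; lra.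
Qed.

End BoxContinuity.

Section MargQ.
Context {R : realType} (n : nat) (mu : probability (n.-tuple R) R).

Definition margq : set (n.-tuple R) -> \bar R := margprod n mu.

Let margq0 : margq set0 = 0%E. Proof. exact: measure0. Qed.
Let margq_ge0 A : (0 <= margq A)%E. Proof. exact: measure_ge0. Qed.
Let margq_semi_sigma_additive : semi_sigma_additive margq.
Proof. exact: measure_semi_sigma_additive. Qed.
HB.instance Definition _ := isMeasure.Build _ _ _ margq margq0 margq_ge0 margq_semi_sigma_additive.
HB.instance Definition _ := Measure_isProbability.Build _ _ _ margq (margprod_setT n mu).

Lemma margq_integral (g : n.-tuple R -> \bar R) : measurable_fun setT g ->
  (forall x, 0 <= g x)%E -> prodmargT n mu g = (\int[margq]_x g x)%E.
Proof. by move=> mg g0; rewrite prodmargT_integral. Qed.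

End MargQ.

Section BoundedLim.
Context {R : realType} {d} {T : measurableType d}.

(** Measurability of a clamped continuous function will come from here, through uniform
    approximation by functions of the cell. *)
Lemma bounded_meas_lim (f : T -> R) :
  (forall e, 0 < e -> exists g, bounded_meas g /\ forall x, `|f x - g x| <= e) -> bounded_meas f.
Proof.
move=> hf; split.
  have gP k : exists g, bounded_meas g /\ forall x, `|f x - g x| <= k.+1%:R^-1 by exact: hf.
  have [g hg] := choice gP.
  apply: (measurable_fun_cvg (h := g)) => [k|x _]; first by have [[]] := hg k.
  apply/cvgrPdist_le => e e0.
  have : \forall k \near \oo, e^-1 <= k%:R by exact: nbhs_infty_ger.
  apply: filterS => k ek; have [_ /(_ x) h] := hg k; apply: (le_trans h).
  rewrite invf_ple ?posrE ?ltr0n// (le_trans ek)// ler_nat//.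
have [g [[_ [K gK]] fg]] := hf 1 ltr01; exists (K + 1) => x.
rewrite -(subrK (g x) (f x)) addrC (le_trans (ler_normD _ _))// lerD//.
Qed.

End BoundedLim.

(** * Cells of the box and the permuted sample *)

Section Cells.
Context {R : realType} (r : R) (n : nat) (mu : probability (n.-tuple R) R).
Variable Xi : forall N : nat, 'I_n -> 'I_N -> R.
Hypothesis r0 : 0 < r.
Hypothesis mu_box : mu (box r n) = 1%E.
Hypothesis hXi : approx_seq r n mu Xi.
Variables (dl : R) (C : finType) (cell : R -> C) (ctr : C -> R).
Hypothesis hC : fine_partition r n mu Xi dl C cell ctr.
Local Notation W := {ffun 'I_n -> C}.

Definition cellT (x : n.-tuple R) : W := [ffun i => cell (tnth x i)].
Definition ctrT (w : W) : n.-tuple R := [tuple ctr (w i) | i < n].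
Definition cell_mass (i : 'I_n) (k : C) : R := fine (margp n mu i (cell @^-1` [set k])).

Lemma ctrT_box w : box r n (ctrT w).
Proof. by move=> i; rewrite tnth_mktuple; have [_ + _ _] := hC; apply. Qed.

Lemma cellT_dist x i : `|tnth (clampT r n x) i - tnth (ctrT (cellT x)) i| <= dl.
Proof. by rewrite !tnth_mktuple ffunE; have [_ _ + _] := hC; apply. Qed.

Lemma cellT_rect w : cellT @^-1` [set w] = [set x | forall i, (cell @^-1` [set w i]) (tnth x i)].
Proof.
apply/seteqP; split => x /=; first by move=> <- i; rewrite ffunE.
by move=> h; apply/ffunP => i; rewrite ffunE.
Qed.

Lemma measurable_cellT w : measurable (cellT @^-1` [set w]).
Proof.
rewrite cellT_rect (_ : [set x | _] = \bigcap_(i in [set: 'I_n])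
   ((fun x : n.-tuple R => tnth x i) @^-1` (cell @^-1` [set w i]))); last first.
  by apply/seteqP; split => x /= h i; [move=> _; exact: h|exact: h].
apply: fin_bigcap_measurable => // i _; rewrite -[X in measurable X]setTI.
by apply: measurable_tnth => //; have [+ _ _ _] := hC; apply.
Qed.

Lemma margq_cellT w : fine (margq n mu (cellT @^-1` [set w])) = \prod_i cell_mass i (w i).
Proof.
rewrite /margq cellT_rect (margprod_rect n mu (fun i => cell @^-1` [set w i])); last first.
  by move=> i; have [+ _ _ _] := hC; apply.
rewrite -[RHS]/(fine (\prod_i cell_mass i (w i))%:E); congr fine.
elim/big_rec2 : _ => // i x y _ ->; rewrite EFinM; congr (_ * _)%E.
by rewrite /cell_mass fineK ?fin_num_measure//; have [+ _ _ _] := hC; apply.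
Qed.

Lemma cellT_step (g : W -> R) x : g (cellT x) = \sum_w g w * \1_(cellT @^-1` [set w]) x.
Proof.
rewrite (bigD1 (cellT x))//= indicE mem_set// mulr1 big1 ?addr0// => w wx.
by rewrite indicE memNset ?mulr0// => /= xw; rewrite xw eqxx in wx.
Qed.

Lemma bounded_meas_cell (g : W -> R) : bounded_meas (fun x => g (cellT x)).
Proof.
rewrite (_ : (fun x => _) = (fun x => \sum_w g w * \1_(cellT @^-1` [set w]) x)).
  apply: bounded_meas_sum => w; apply: bounded_measZ.
  by apply: bounded_meas_indic; exact: measurable_cellT.
by apply/funext => x; exact: cellT_step.
Qed.

Lemma Rint_cell (P : probability (n.-tuple R) R) (g : W -> R) :
  \int[P]_x g (cellT x) = \sum_w g w * fine (P (cellT @^-1` [set w])).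
Proof.
transitivity (\int[P]_x (\sum_w g w * \1_(cellT @^-1` [set w]) x)).
  by apply: eq_Rintegral => x _; exact: cellT_step.
rewrite Rint_sum => [|w]; last first.
  apply: bounded_measZ.
  by apply: bounded_meas_indic; exact: measurable_cellT.
apply: eq_bigr => w _; rewrite RintZl ?Rint_indic//; first exact: measurable_cellT.
by apply: bounded_meas_indic; exact: measurable_cellT.
Qed.

Definition sample (N : nat) (s : {ffun 'I_n -> 'S_N}) (j : 'I_N) : n.-tuple R :=
  mktuple (fun i => Xi N i (((s i)^-1)%g j)).

Lemma sample_box N s j : box r n (sample N s j).
Proof. by move=> i; rewrite tnth_mktuple; have [h _ _] := hXi; exact: h. Qed.

Lemma joint_cellT N s j : joint n C N (fun i j => cell (Xi N i j)) s j = cellT (sample N s j).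
Proof. by apply/ffunP => i; rewrite !ffunE tnth_mktuple. Qed.

End Cells.

Arguments ctrT_box {R r n mu Xi dl C cell ctr} hC w.
Arguments cellT_dist {R r n mu Xi dl C cell ctr} hC x i.
Arguments measurable_cellT {R r n mu Xi dl C cell ctr} hC w.
Arguments margq_cellT {R r n mu Xi dl C cell ctr} hC w.
Arguments bounded_meas_cell {R r n mu Xi dl C cell ctr} hC g.
Arguments Rint_cell {R r n mu Xi dl C cell ctr} hC P g.
Arguments sample_box {R r n mu Xi} hXi N s j.

(** * Bounds on the partition functions *)

Section LimnEsup.
Context {R : realType}.
Local Open Scope ereal_scope.

Lemma limn_esup_le_near (u : (\bar R)^nat) (c : \bar R) :
  (\forall N \near \oo, u N <= c) -> limn_esup u <= c.
Proof.
move=> h; apply: (@le_trans _ _ (ereal_sup (u @` [set N | u N <= c]))).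
  by apply: ereal_inf_lbound; exists [set N | u N <= c].
by apply: ge_ereal_sup => _ [N hN <-].
Qed.

Lemma limn_esup_ge_near (u : (\bar R)^nat) (c : \bar R) :
  (\forall N \near \oo, c <= u N) -> c <= limn_esup u.
Proof.
move=> h; apply: le_ereal_inf_tmp => _ [A FA <-].
have [N [AN cN]] : exists N, (A `&` [set N | c <= u N]) N.
  by apply: (@filter_ex _ \oo); apply: filterI.
by apply: (le_trans cN); apply: ereal_sup_ubound; exists N.
Qed.

End LimnEsup.

Section AverageExp.
Context {R : realType} (n : nat) (Xi : forall N : nat, 'I_n -> 'I_N -> R).

Definition avg_exp (h : n.-tuple R -> R) (N : nat) : R :=
  ((N`!)%:R ^+ n)^-1 * \sum_(s : {ffun 'I_n -> 'S_N}) expR (\sum_(j < N) h (sample n Xi N s j)).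

Lemma psym_termE h N : psym_term n Xi h N = N%:R^-1 * ln (avg_exp h N).
Proof. by []. Qed.

Lemma avg_exp_gt0 h N : 0 < avg_exp h N.
Proof.
rewrite mulr_gt0 ?invr_gt0 ?exprn_gt0 ?ltr0n ?fact_gt0//.
by rewrite (bigD1 [ffun=> 1%g])//= ltr_wpDr ?expR_gt0// sumr_ge0// => s _; exact: expR_ge0.
Qed.

End AverageExp.

(** * The pressure is at most the logarithm of the exponential Q integral *)

Section UpperBound.
Context {R : realType} (r : R) (n : nat) (mu : probability (n.-tuple R) R).
Variable Xi : forall N : nat, 'I_n -> 'I_N -> R.
Hypothesis r0 : 0 < r.
Hypothesis mu_box : mu (box r n) = 1%E.
Hypothesis hXi : approx_seq r n mu Xi.
Local Notation Q := (margq n mu).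
Local Notation clampT := (clampT r n).

Lemma ex_step (h : n.-tuple R -> R) (e dl0 : R) : cont_box r n h -> 0 < e -> 0 < dl0 ->
  exists (dl : R) (C : finType) (cell : R -> C) (ctr : C -> R),
  [/\ fine_partition r n mu Xi dl C cell ctr, dl <= dl0 &
    forall x, `|h (clampT x) - h (ctrT n C ctr (cellT n C cell x))| <= e].
Proof.
move=> /cont_unif_cont_box uh e0 dl00; have [d1 d10 H] := uh _ e0.
pose dl := Num.min d1 dl0; have dlp : 0 < dl by rewrite lt_min d10.
have [C [cell [ctr hC]]] := ex_partition r n mu Xi r0 mu_box hXi dl dlp.
exists dl, C, cell, ctr; split => //; first by rewrite ge_min lexx orbT.
move=> x; apply: H; [exact: clampT_box|exact: (ctrT_box hC)|move=> i].
by rewrite (le_trans (cellT_dist hC x i))// ge_min lexx.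
Qed.

Lemma bounded_meas_clampT (h : n.-tuple R -> R) : cont_box r n h ->
  bounded_meas (fun x => h (clampT x)).
Proof.
move=> ch; apply: bounded_meas_lim => e e0.
have [dl [C [cell [ctr [hC _ H]]]]] := ex_step h e 1 ch e0 ltr01.
exists (fun x => h (ctrT n C ctr (cellT n C cell x))); split => //.
exact: (bounded_meas_cell hC (fun w => h (ctrT n C ctr w))).
Qed.

Lemma integral_box (h : n.-tuple R -> R) : cont_box r n h ->
  (\int[mu]_(x in box r n) (h x)%:E)%E = (\int[mu]_x h (clampT x))%:E.
Proof.
move=> ch; have bh := bounded_meas_clampT h ch; rewrite EFin_Rint//.
have mb := measurable_box r n.
transitivity (\int[mu]_(x in box r n) (h (clampT x))%:E)%E.
  by apply: eq_integral => x; rewrite inE => bx; rewrite clampT_id.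
have mu0 : mu (~` box r n) = 0%E by rewrite probability_setC// mu_box subee.
have mE := proj2 (measurable_EFinP setT _) bh.1.
rewrite integral_mkcond; apply: ae_eq_integral => //.
  exact/(measurable_restrictT _ mb)/measurable_funTS.
exists (~` box r n); split; first exact: measurableC.
  exact: mu0.
move=> x /= h1 h2; apply: h1 => _.
by rewrite /patch mem_set.
Qed.

Lemma psym_upper (h : n.-tuple R -> R) (e : R) : cont_box r n h -> 0 < e ->
  \forall N \near \oo, psym_term n Xi h N <= ln (\int[Q]_x expR (h (clampT x))) + e.
Proof.
move=> ch e0; have e4 : 0 < e / 4 by rewrite divr_gt0.
have [dl [C [cell [ctr [hC _ H]]]]] := ex_step h _ 1 ch e4 ltr01.
(* Budget 4 e1: two for a function of the cell lying above [h], one for the convergence of the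
   frequencies, one for the polynomial factor. *)
set e1 := e / 4 in e4 H.
have bh := bounded_meas_clampT h ch; have beh := bounded_meas_expR _ bh.
pose g w := expR (h (ctrT n C ctr w) + e1).
pose fr N i k : R := (cnt C N (fun j => cell (Xi N i j)) k)%:R / N%:R.
pose SN N := \sum_(w : {ffun 'I_n -> C}) g w * \prod_i fr N i (w i).
set E := \int[Q]_x expR (h (clampT x)).
have E0 : 0 < E := Rint_expR_gt0 Q _ bh.
have SE : SN @ \oo --> \sum_w g w * \prod_i cell_mass n mu C cell i (w i).
  apply: cvg_big => [|w _]; first exact: add_continuous.
  apply: cvgMr; apply: cvg_big => [|i _]; first exact: mul_continuous.
  by have [_ _ _] := hC; apply.
have SB : \sum_w g w * \prod_i cell_mass n mu C cell i (w i) <= expR (2 * e1) * E.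
  under eq_bigr do rewrite -(margq_cellT hC).
  rewrite -(Rint_cell hC) -RintZl//; apply: le_Rint.
  - exact: (bounded_meas_cell hC).
  - exact: bounded_measZ.
  move=> x; rewrite -expRD ler_expR; have := H x; rewrite ler_norml => /andP[? ?]; lra.
have SB' : \sum_w g w * \prod_i cell_mass n mu C cell i (w i) < expR (3 * e1) * E.
  apply: (le_lt_trans SB); rewrite ltr_pM2r// ltr_expR; lra.
near=> N.
have N0 : (0 < N)%N by near: N; exact: nbhs_infty_gt.
have N0R : (0 : R) < N%:R by rewrite ltr0n.
have hS : SN N <= expR (3 * e1) * E.
  near: N; move/cvgr_le : SE; exact.
have hl : (n%:R * (2 * #|C|%:R)) * ln N.+1%:R <= e1 * N%:R :> R.
  by near: N; apply: ln_succ_little => //; rewrite !mulr_ge0.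
have hsum := sum_joint_le n C N (fun i j => cell (Xi N i j)) N0 g (fun w => expR_ge0 _).
set A := avg_exp n Xi h N; have A0 : 0 < A by exact: avg_exp_gt0.
have AS : A <= expR (2 * #|C|%:R * ln N.+1%:R) ^+ n * (SN N) ^+ N.
  apply: le_trans hsum; rewrite ler_wpM2l ?invr_ge0 ?exprn_ge0//.
  apply: ler_sum => s _; rewrite expR_sum; apply: ler_prod => j _.
  rewrite expR_ge0 /= /g ler_expR (joint_cellT n Xi C cell N s j).
  have := H (sample n Xi N s j); rewrite clampT_id; last exact: (sample_box hXi).
  by rewrite -/(sample n Xi N s j) ler_norml => /andP[? ?]; lra.
have AB : A <= expR (2 * #|C|%:R * ln N.+1%:R) ^+ n * (expR (3 * e1) * E) ^+ N.
  apply: (le_trans AS); rewrite ler_wpM2l ?exprn_ge0 ?expR_ge0//.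
  rewrite lerXn2r// nnegrE ?mulr_ge0 ?expR_ge0 ?(ltW E0)//.
  by rewrite sumr_ge0// => w _; rewrite mulr_ge0 ?expR_ge0 ?prodr_ge0// => i _; rewrite divr_ge0.
rewrite psym_termE -/A ler_pdivrMl//.
have : ln A <= n%:R * (2 * #|C|%:R * ln N.+1%:R) + N%:R * (3 * e1 + ln E).
  have := AB; rewrite -ler_ln ?posrE//; last by rewrite !mulr_gt0 ?exprn_gt0 ?mulr_gt0 ?expR_gt0.
  move/le_trans; apply.
  rewrite lnM ?posrE ?exprn_gt0 ?mulr_gt0 ?expR_gt0//.
  by rewrite !lnXn ?mulr_gt0 ?expR_gt0// lnM ?posrE ?expR_gt0// !expRK (mulr_natl _ n) (mulr_natl _ N).
move/le_trans; apply; rewrite (_ : e = 4 * e1); last by rewrite /e1; field.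
by clear -hl; move: hl; lra.
Unshelve. all: by end_near. Qed.

Lemma Psym_le (h : n.-tuple R -> R) : cont_box r n h ->
  (Psym n Xi h <= (ln (\int[Q]_x expR (h (clampT x))))%:E)%E.
Proof.
move=> ch; apply/lee_addgt0Pr => e e0; apply: limn_esup_le_near.
by have := psym_upper h e ch e0; apply: filterS => N; rewrite -EFinD lee_fin.
Qed.

End UpperBound.

(** * Typical permutation tuples *)

Section LowerBound.
Context {R : realType} (r : R) (n : nat) (mu : probability (n.-tuple R) R).
Variable Xi : forall N : nat, 'I_n -> 'I_N -> R.
Hypothesis r0 : 0 < r.
Hypothesis mu_box : mu (box r n) = 1%E.
Hypothesis hXi : approx_seq r n mu Xi.
Local Notation Q := (margq n mu).
Local Notation clampT := (clampT r n).
Local Notation sample := (sample n Xi).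
Local Notation S := (relent _ _ (prodmargT n mu) mu).

Section Discretize.
Variables (dl : R) (C : finType) (cell : R -> C) (ctr : C -> R).
Hypothesis hC : fine_partition r n mu Xi dl C cell ctr.
Local Notation W := {ffun 'I_n -> C}.
Local Notation q := (cell_mass n mu C cell).

Definition cell_prob (w : W) : R := fine (mu (cellT n C cell @^-1` [set w])).
Local Notation p := cell_prob.

Lemma cell_prob_ge0 w : 0 <= p w.
Proof. exact: fine_ge0. Qed.

Lemma sum_cell_prob : \sum_w p w = 1.
Proof.
rewrite -(Rint_cst mu 1) (Rint_cell hC mu (fun=> 1)).
by apply: eq_bigr => w _; rewrite mul1r.
Qed.

Lemma marg_cell_prob i k : \sum_(w : W | w i == k) p w = q i k.
Proof.
have mk : measurable ((fun x : n.-tuple R => tnth x i) @^-1` (cell @^-1` [set k])).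
  rewrite -[X in measurable X]setTI; apply: measurable_tnth => //.
  by have [+ _ _ _] := hC; apply.
transitivity (\int[mu]_x (\1_((fun x : n.-tuple R => tnth x i) @^-1` (cell @^-1` [set k])) x : R)).
  rewrite big_mkcond /=.
  transitivity (\sum_(w : W) (w i == k)%:R * p w).
    by apply: eq_bigr => w _; case: eqP; rewrite ?mul1r ?mul0r.
  rewrite -(Rint_cell hC mu (fun w => (w i == k)%:R)).
  apply: eq_Rintegral => x _; rewrite indicE ffunE; congr (nat_of_bool _)%:R.
  by apply/eqP/idP; rewrite in_setE.
by rewrite Rint_indic.
Qed.

(* Test the variational bound for [S] on the step function [ln (p / prod q)], truncated where [p]
   vanishes. *)
Lemma discrete_relent_le (s : R) : S = s%:E ->
  \sum_w xlnx (p w) - \sum_i \sum_k xlnx (q i k) <= s.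
Proof.
move=> Ss; apply/ler_addgt0Pr => e e0.
(* The value ln e where [p] vanishes adds at most [e] to the exponential sum and nothing to the [mu]
   sum. *)
pose g (w : W) := if 0 < p w then ln (p w) - \sum_i ln (q i (w i)) else ln e.
have := relent_ge mu Q _ (margq_integral n mu) _ (bounded_meas_cell hC g).
rewrite Ss lee_fin (Rint_cell hC mu g) (Rint_cell hC Q (fun w => expR (g w))).
have qp w i : p w <= q i (w i).
  rewrite -marg_cell_prob (bigD1 w)//= lerDl sumr_ge0// => w' _; exact: cell_prob_ge0.
have E1 : \sum_w g w * p w = \sum_w xlnx (p w) - \sum_i \sum_k xlnx (q i k).
  have -> : \sum_i \sum_k xlnx (q i k) = \sum_w p w * \sum_i ln (q i (w i)).
    under [RHS]eq_bigr do rewrite mulr_sumr.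
    rewrite [RHS]exchange_big /=; apply: eq_bigr => i _.
    rewrite (partition_big (fun w : W => w i) xpredT)//=; apply: eq_bigr => k _.
    rewrite /xlnx -marg_cell_prob mulr_suml; apply: eq_bigr => w /eqP wk.
    by rewrite wk marg_cell_prob.
  rewrite -sumrB; apply: eq_bigr => w _; rewrite /g /xlnx.
  case: ltP => h; first by ring.
  have -> : p w = 0 by apply/eqP; rewrite eq_le h cell_prob_ge0.
  by rewrite !mul0r mulr0 subrr.
have E2 : \sum_w expR (g w) * fine (Q (cellT n C cell @^-1` [set w])) <= 1 + e.
  apply: (@le_trans _ _ (\sum_w (p w + e * fine (Q (cellT n C cell @^-1` [set w]))))).
    apply: ler_sum => w _; rewrite /g; case: ltP => h.
      have q0 i : 0 < q i (w i) by apply: lt_le_trans (qp w i).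
      rewrite (margq_cellT hC) expRD expRN lnK ?posrE// -ln_prod ?lnK ?posrE ?prodr_gt0//.
      by rewrite -mulrA mulVf ?mulr1 ?gt_eqF ?prodr_gt0// lerDl mulr_ge0 ?(ltW e0)// prodr_ge0// => i _; rewrite ltW.
    by rewrite lnK ?posrE// lerDr cell_prob_ge0.
  rewrite big_split /= sum_cell_prob lerD2l -(Rint_cell hC Q (fun=> e)) Rint_cst//.
rewrite E1; lra.
Qed.

Definition typical (N : nat) (e : R) : {set {ffun 'I_n -> 'S_N}} :=
  [set s | [forall w : W, `|(cnt W N (joint n C N (fun i j => cell (Xi N i j)) s) w)%:R / N%:R - p w| <= e]]%SET.

Lemma typical_lower (s e : R) : S = s%:E -> 0 < e -> \forall N \near \oo,
  expR (- (N%:R * (s + e))) <= #|typical N e|%:R / (N`!)%:R ^+ n.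
Proof.
move=> Ss e0.
have hfreq i k : (fun N => (cnt C N (fun j => cell (Xi N i j)) k)%:R / N%:R) @ \oo --> q i k.
  by have [_ _ _] := hC; apply.
have := joint_type_lower n C (fun N i j => cell (Xi N i j)) q p cell_prob_ge0
  sum_cell_prob marg_cell_prob hfreq e e0.
apply: filterS => N; apply: le_trans.
by rewrite ler_expR lerN2 ler_wpM2l// lerD2r discrete_relent_le.
Qed.

Lemma typical_kappa (N : nat) (e : R) (g : W -> R) (s : {ffun 'I_n -> 'S_N}) :
  s \in typical N e ->
  `|kappa N (fun j => g (cellT n C cell (sample N s j))) - \int[mu]_x g (cellT n C cell x)|
  <= e * \sum_w `|g w|.
Proof.
rewrite inE => /forallP h; rewrite (Rint_cell hC mu g).
rewrite /kappa (eq_bigr (fun j => g (joint n C N (fun i j => cell (Xi N i j)) s j))); last first.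
  by move=> j _; rewrite (joint_cellT n Xi C cell N s j).
rewrite sumr_cnt mulr_sumr -sumrB (le_trans (ler_norm_sum _ _ _))// mulr_sumr.
apply: ler_sum => w _.
have -> : N%:R^-1 * (g w *+ cnt W N (joint n C N (fun i j => cell (Xi N i j)) s) w) - g w * p w =
  ((cnt W N (joint n C N (fun i j => cell (Xi N i j)) s) w)%:R / N%:R - p w) * g w.
  rewrite -[g w *+ _]mulr_natr; ring.
by rewrite normrM ler_wpM2r//; exact: h.
Qed.

End Discretize.

(** Equicontinuity lets one partition serve the whole family, so a single typical set works for all
    its members: one function for the pressure, all moments of degree at most m for [Delta_sym]. *)
Lemma equicont_lower (H : (n.-tuple R -> R) -> Prop) (K s e : R) : S = s%:E -> 0 < e ->
  (forall h x, H h -> box r n x -> `|h x| <= K) ->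
  (forall e, 0 < e -> exists2 dl, 0 < dl & forall h x y, H h -> box r n x -> box r n y ->
    (forall i, `|tnth x i - tnth y i| <= dl) -> `|h x - h y| <= e) ->
  \forall N \near \oo, expR (- (N%:R * (s + e))) <=
    #|[set t : {ffun 'I_n -> 'S_N} | `[< forall h, H h ->
       `|kappa N (fun j => h (sample N t j)) - \int[mu]_x h (clampT x)| <= e >]]%SET|%:R / (N`!)%:R ^+ n.
Proof.
move=> Ss e0 HK Hequi.
have Hcont h : H h -> cont_box r n h.
  move=> Hh; apply: unif_cont_cont_box => e' e'0; have [dl dl0 hdl] := Hequi _ e'0.
  by exists dl => // x y; exact: hdl.
have e4 : 0 < e / 4 by rewrite divr_gt0.
have [dl dl0 hdl] := Hequi _ e4.
have [C [cell [ctr hC]]] := ex_partition r n mu Xi r0 mu_box hXi dl dl0.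
(* [M] bounds the sum of |g w| over the cells, so that e2 M <= e / 2; the two replacements of [h] by
   its value at cell centres cost e / 4 each. *)
pose M := #|{ffun 'I_n -> C}|%:R * `|K| : R.
have M0 : 0 <= M by rewrite mulr_ge0.
pose e2 := Num.min e (e / (2 * (M + 1))).
have M1 : 0 < 2 * (M + 1) by rewrite mulr_gt0// ltr_wpDl.
have e20 : 0 < e2 by rewrite lt_min e0 divr_gt0.
have := typical_lower _ _ _ _ hC s e2 Ss e20; apply: filterS2 (nbhs_infty_gt 0) => N N0.
have lt1 : expR (- (N%:R * (s + e))) <= expR (- (N%:R * (s + e2))).
  by rewrite ler_expR lerN2 ler_wpM2l// lerD2l ge_min lexx.
move/(le_trans lt1)/le_trans; apply.
rewrite ler_wpM2r ?invr_ge0 ?exprn_ge0// ler_nat; apply/subset_leq_card/fintype.subsetP => t ht.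
rewrite inE; apply/asboolP => h Hh.
pose g w := h (ctrT n C ctr w).
have gx x : `|h (clampT x) - g (cellT n C cell x)| <= e / 4.
  by apply: hdl => //; [exact: clampT_box|exact: (ctrT_box hC)|exact: (cellT_dist hC)].
have bh := bounded_meas_clampT r n mu Xi r0 mu_box hXi h (Hcont _ Hh).
have bg := bounded_meas_cell hC g.
have h1 : `|kappa N (fun j => h (sample N t j)) - kappa N (fun j => g (cellT n C cell (sample N t j)))| <= e / 4.
  apply: kappa_dist => [|j]; first exact: ltW.
  by have := gx (sample N t j); rewrite clampT_id//; exact: (sample_box hXi).
have h2 := typical_kappa _ _ _ _ hC _ _ g _ ht.
have h3 : `|\int[mu]_x h (clampT x) - \int[mu]_x g (cellT n C cell x)| <= e / 4.
  exact: Rint_dist.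
have h4 : e2 * \sum_w `|g w| <= e / 2.
  apply: (@le_trans _ _ (e2 * M)).
    rewrite ler_wpM2l ?(ltW e20)// /M mulr_natl -sumr_const ler_sum// => w _.
    by rewrite (le_trans (HK _ _ Hh (ctrT_box hC w)))// ler_norm.
  apply: (@le_trans _ _ (e / (2 * (M + 1)) * M)).
    by rewrite ler_wpM2r// ge_min lexx orbT.
  rewrite mulrAC ler_pdivrMr//.
  have -> : e / 2 * (2 * (M + 1)) = e * (M + 1) by field.
  by rewrite ler_wpM2l ?(ltW e0)// lerDl.
move: (le_trans h2 h4) h1 h3; rewrite !ler_norml => /andP[? ?] /andP[? ?] /andP[? ?].
by apply/andP; split; lra.
Qed.

End LowerBound.

(** * Both quantities equal the relative entropy *)

Section Variational.
Context {R : realType} (r : R) (n : nat) (mu : probability (n.-tuple R) R).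
Variable Xi : forall N : nat, 'I_n -> 'I_N -> R.
Hypothesis r0 : 0 < r.
Hypothesis mu_box : mu (box r n) = 1%E.
Hypothesis hXi : approx_seq r n mu Xi.
Local Notation Q := (margq n mu).
Local Notation clampT := (clampT r n).
Local Notation sample := (sample n Xi).
Local Notation S := (relent _ _ (prodmargT n mu) mu).
Local Notation X := (coordX r n).

Lemma EFin_le_approx (x : R) (y : \bar R) :
  (forall e : R, 0 < e -> ((x - e)%:E <= y)%E) -> (x%:E <= y)%E.
Proof. by move=> h; apply/lee_addgt0Pr => e e0; rewrite -leeBlDr// -EFinB h. Qed.

Lemma sum_kappa (N : nat) (x : 'I_N -> R) : (0 < N)%N -> \sum_j x j = N%:R * kappa N x.
Proof. by move=> N0; rewrite /kappa mulrA divff ?mul1r// pnatr_eq0 -lt0n. Qed.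

(** Used in both directions: a large set [T] bounds the average from below, and a known average
    bounds the size of [T] (Markov). *)
Lemma avg_exp_ge (h : n.-tuple R -> R) (N : nat) (T : {set {ffun 'I_n -> 'S_N}}) (c : R) :
  (0 < N)%N -> (forall t, t \in T -> c <= kappa N (fun j => h (sample N t j))) ->
  #|T|%:R / (N`!)%:R ^+ n * expR (N%:R * c) <= avg_exp n Xi h N.
Proof.
move=> N0 hT; rewrite /avg_exp mulrAC mulrC ler_wpM2l ?invr_ge0 ?exprn_ge0//.
rewrite (mulr_natl _ #|T|) -sumr_const [leRHS](bigID (fun t => t \in T))/= ler_wpDr//.
  by apply: sumr_ge0 => s _; exact: expR_ge0.
by apply: ler_sum => t tT; rewrite ler_expR sum_kappa// ler_wpM2l// hT.
Qed.

Lemma Psym_ge (h : n.-tuple R -> R) (s : R) : cont_box r n h -> S = s%:E ->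
  ((\int[mu]_x h (clampT x) - s)%:E <= Psym n Xi h)%E.
Proof.
move=> ch Ss; have [_ [K hK]] := bounded_meas_clampT r n mu Xi r0 mu_box hXi h ch.
set I := \int[mu]_x _; apply: EFin_le_approx => e e0; apply: limn_esup_ge_near.
have e2 : 0 < e / 2 by rewrite divr_gt0.
have := equicont_lower r n mu Xi r0 mu_box hXi (eq h) K s (e / 2) Ss e2.
have H1 f x : h = f -> box r n x -> `|f x| <= K.
  by move=> <- bx; rewrite -(clampT_id r n x bx).
have H2 e' : 0 < e' -> exists2 dl, 0 < dl & forall f x y, h = f -> box r n x -> box r n y ->
    (forall i, `|tnth x i - tnth y i| <= dl) -> `|f x - f y| <= e'.
  move=> e'0; have [dl dl0 hdl] := cont_unif_cont_box r n h ch e' e'0.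
  by exists dl => // f x y <-; exact: hdl.
move=> /(_ H1 H2); apply: filterS2 (nbhs_infty_gt 0) => N N0.
set T := [set t | _]%SET => hT.
have N0R : (0 : R) < N%:R by rewrite ltr0n.
have := avg_exp_ge h N T (I - e / 2) N0.
have hT' t : t \in T -> I - e / 2 <= kappa N (fun j => h (sample N t j)).
  by rewrite inE => /asboolP/(_ _ erefl); rewrite ler_norml => /andP[? ?]; rewrite /I; lra.
move=> /(_ hT') hA.
have : expR (N%:R * (I - s - e)) <= avg_exp n Xi h N.
  apply: le_trans hA; rewrite (_ : N%:R * (I - s - e) = - (N%:R * (s + e / 2)) + N%:R * (I - e / 2)); last by field.
  by rewrite expRD ler_wpM2r ?expR_ge0.
rewrite -ler_ln ?posrE ?expR_gt0 ?avg_exp_gt0// expRK => h3.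
by rewrite lee_fin psym_termE ler_pdivlMl.
Qed.

Lemma calIsym_le : (calIsym r n mu Xi <= S)%E.
Proof.
have := relent_ge0 mu Q _ (margq_integral n mu).
case Ss : S => [s| |]// _; last by rewrite leey.
apply: ge_ereal_sup => _ [h ch <-]; rewrite (integral_box r n mu Xi r0 mu_box hXi)//.
have := Psym_ge h s ch Ss; case: (Psym n Xi h) => [p|_|]; last by [].
  by rewrite -EFinB !lee_fin; lra.
by rewrite leNye.
Qed.

Lemma Rint_prod_tnth (k : nat) (w : 'I_k -> 'I_n) :
  Rintegral mu setT (fun x => \prod_(l < k) tnth x (w l)) =
  \int[mu]_x (\prod_(l < k) tnth (clampT x) (w l)).
Proof.
have mtn (i : 'I_n) : measurable_fun setT (fun x : n.-tuple R => tnth x i).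
  exact: measurable_tnth.
congr fine; apply: ae_eq_integral => //.
- by apply/measurable_EFinP; apply: measurable_prod => l _; exact: mtn.
- apply/measurable_EFinP; apply: measurable_prod => l _.
  rewrite (_ : (fun x => _) = X (w l)); first by have [] := coordX_bounded r n r0 (w l).
  by apply/funext => x; rewrite tnth_mktuple.
have mb := measurable_box r n.
have mu0 : mu (~` box r n) = 0%E by rewrite probability_setC// mu_box subee.
exists (~` box r n); split => //; first exact: measurableC.
by move=> x /= h1 h2; apply: h1 => _; rewrite clampT_id.
Qed.

Lemma Isym_le : (Isym n mu Xi <= S)%E.
Proof.
have := relent_ge0 mu Q _ (margq_integral n mu).
case Ss : S => [s| |]// _; last by rewrite leey.
rewrite /Isym leeNl; apply: le_ereal_inf_tmp => _ [[m d] /= d0 <-].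
apply: EFin_le_approx => e e0; apply: limn_esup_ge_near.
(* All moments of degree at most [m], as one bounded equicontinuous family. *)
pose H (h : n.-tuple R -> R) := exists (k : nat) (w : 'I_k -> 'I_n),
  (k <= m)%N /\ h = (fun x => \prod_(l < k) tnth x (w l)).
set M := Num.max r 1; have M1 : 1 <= M by rewrite le_max lexx orbT.
have M0 : 0 <= M by rewrite (le_trans ler01).
have H1 h x : H h -> box r n x -> `|h x| <= M ^+ m.
  move=> [k [w [km ->]]] bx; rewrite normr_prod (@le_trans _ _ (M ^+ k))//.
    rewrite -[k in leRHS]card_ord -prodr_const; apply: ler_prod => l _.
    by rewrite normr_ge0 /=; exact: box_norm_le.
  by rewrite ler_weXn2l.
have H2 e' : 0 < e' -> exists2 dl, 0 < dl & forall h x y, H h -> box r n x -> box r n y ->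
    (forall i, `|tnth x i - tnth y i| <= dl) -> `|h x - h y| <= e'.
  move=> e'0; pose c := m%:R * M ^+ m.
  have c0 : 0 <= c by rewrite mulr_ge0// exprn_ge0.
  have c1 : 0 < c + 1 by rewrite ltr_wpDl.
  exists (e' / (c + 1)); first by rewrite divr_gt0.
  move=> h x y [k [w [km ->]]] bx byy xy.
  have d00 : 0 <= e' / (c + 1) by rewrite divr_ge0// ltW.
  have := prod_lipschitz _ (index_enum 'I_k) (fun l => tnth x (w l)) (fun l => tnth y (w l)) M _ M1 d00
    (fun l => box_norm_le r n x (w l) bx) (fun l => box_norm_le r n y (w l) byy) (fun l => xy (w l)).
  have -> : size (index_enum 'I_k) = k by rewrite -[RHS]card_ord cardE enumT.
  move=> /le_trans; apply.
  apply: (@le_trans _ _ (c * (e' / (c + 1)))).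
    by rewrite ler_wpM2r// ler_pM ?exprn_ge0// ?ler_nat// ler_weXn2l.
  by rewrite mulrCA ler_piMr ?(ltW e'0)// ler_pdivrMr// mul1r lerDl.
(* Half of [d], because [Delta_sym] asks for strict inequalities. *)
pose e2 := Num.min e (d / 2).
have e20 : 0 < e2 by rewrite lt_min e0 divr_gt0.
have := equicont_lower r n mu Xi r0 mu_box hXi H _ s e2 Ss e20 H1 H2.
apply: filterS2 (nbhs_infty_gt 0) => N N0; set T := [set t | _]%SET => hT.
have N0R : (0 : R) < N%:R by rewrite ltr0n.
have hg : expR (- (N%:R * (s + e))) <= gamma_Delta n mu Xi N m d.
  apply: (@le_trans _ _ (expR (- (N%:R * (s + e2))))).
    by rewrite ler_expR lerN2 ler_wpM2l// lerD2l ge_min lexx.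
  apply: (le_trans hT); rewrite ler_wpM2r ?invr_ge0 ?exprn_ge0// ler_nat.
  apply/subset_leq_card/fintype.subsetP => t; rewrite !inE => /asboolP h.
  apply/asboolP => k w /andP[_ km]; rewrite Rint_prod_tnth.
  have := h (fun x => \prod_(l < k) tnth x (w l)) (ex_intro _ k (ex_intro _ w (conj km erefl))).
  rewrite (_ : kappa N _ = kappa N (fun j => \prod_(l < k) Xi N (w l) (((t (w l))^-1)%g j))).
    move/le_lt_trans; apply; apply: (@le_lt_trans _ _ (d / 2)); first by rewrite ge_min lexx orbT.
    lra.
  by congr kappa; apply/funext => j; apply: eq_bigr => l _; rewrite tnth_mktuple.
have g0 : 0 < gamma_Delta n mu Xi N m d by apply: lt_le_trans hg; exact: expR_gt0.
rewrite (leNgt (gamma_Delta n mu Xi N m d)) g0 /= -EFinM lee_fin ler_pdivlMl//.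
by rewrite (le_trans _ (_ : - (N%:R * (s + e)) <= _)) //; [lra|rewrite -ler_expR lnK ?posrE].
Qed.

Lemma Delta_sym_monomial N m d t (w : seq 'I_n) : (0 < N)%N -> 0 < d -> (size w <= m)%N ->
  t \in Delta_sym n mu Xi N m d ->
  `|kappa N (fun j => monomial X w (sample N t j)) - \int[mu]_x monomial X w x| <= d.
Proof.
move=> N0 d0 wm; rewrite inE => /asboolP h.
(* The empty word is not constrained by [Delta_sym]; its average is exactly 1 since N > 0. *)
case: w wm => [|i w] wm.
  have E : monomial X [::] = fun=> 1 by apply/funext => x; rewrite /monomial big_nil.
  rewrite E Rint_cst /kappa sumr_const card_ord mulVf ?subrr ?normr0 ?ltW//.
  by rewrite pnatr_eq0 -lt0n.
have := h (size (i :: w)) (tnth (in_tuple (i :: w))) wm.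
rewrite Rint_prod_tnth => /ltW; congr (`|_ - _| <= _).
  congr kappa; apply/funext => j; rewrite monomial_box; last exact: (sample_box hXi).
  by rewrite [RHS]big_tnth; apply: eq_bigr => l _; rewrite tnth_mktuple.
apply: eq_Rintegral => x _; rewrite /monomial [RHS]big_tnth; apply: eq_bigr => l _.
by rewrite tnth_mktuple.
Qed.

Lemma Delta_sym_peval N m d t (p : seq (R * seq 'I_n)) : (0 < N)%N -> 0 < d ->
  (forall cw, cw \in p -> size cw.2 <= m)%N -> t \in Delta_sym n mu Xi N m d ->
  `|kappa N (fun j => peval X p (sample N t j)) - \int[mu]_x peval X p x|
  <= (\sum_(cw <- p) `|cw.1|) * d.
Proof.
move=> N0 d0 hp ht; have bX := coordX_bounded r n r0.
have -> : \int[mu]_x peval X p x = \sum_(cw <- p) cw.1 * \int[mu]_x monomial X cw.2 x.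
  rewrite /peval Rint_sum; last first.
    move=> cw; apply: bounded_measZ.
    exact: (monomial_bounded _ bX).
  apply: eq_bigr => cw _; rewrite RintZl//; exact: (monomial_bounded _ bX).
have -> : kappa N (fun j => peval X p (sample N t j)) =
    \sum_(cw <- p) cw.1 * kappa N (fun j => monomial X cw.2 (sample N t j)).
  rewrite /kappa /peval exchange_big mulr_sumr; apply: eq_bigr => cw _.
  by rewrite mulrCA; congr (_ * _); rewrite mulr_sumr.
rewrite -sumrB mulr_suml (le_trans (ler_norm_sum _ _ _))// !big_seq.
apply: ler_sum => cw cwp; rewrite -mulrBr normrM ler_wpM2l//.
exact: (Delta_sym_monomial N m d t _ N0 d0 (hp _ cwp) ht).
Qed.

(* On [Delta_sym] the exponent [kappa_N h] is close to [mu h] (Weierstrass), so Markov's inequality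
   bounds the size of [Delta_sym] by the average of [exp (N kappa_N h)]. *)
Lemma Isym_ge (h : n.-tuple R -> R) : polyapprox X h ->
  ((\int[mu]_x h x - ln (\int[Q]_x expR (h x)))%:E <= Isym n mu Xi)%E.
Proof.
move=> hh; have bX := coordX_bounded r n r0; have bh := polyapprox_bounded X bX _ hh.
have ch := polyapprox_cont_box r n h hh.
set I := \int[mu]_x h x; set L := ln _.
rewrite /Isym leeNr -EFinN; apply/lee_addgt0Pr => e e0.
have e4 : 0 < e / 4 by rewrite divr_gt0.
have [_ happ] := hh; have [p hp] := happ _ e4.
have bp := peval_bounded X bX p.
pose m := \max_(cw <- p) size cw.2.
have hm cw : cw \in p -> (size cw.2 <= m)%N by move=> cwp; apply: leq_bigmax_seq.
set c := \sum_(cw <- p) `|cw.1|; have c0 : 0 <= c by apply: sumr_ge0.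
have c1 : 0 < c + 1 by rewrite ltr_wpDl.
(* The moment errors, weighted by the coefficients of [p], sum to at most e / 4. The polynomial
   approximation costs e / 4 in the sample and e / 4 under [mu], and [psym_upper] takes the last
   quarter. *)
pose d := e / 4 / (c + 1); have d0 : 0 < d by rewrite divr_gt0.
have cd : c * d <= e / 4.
  by rewrite /d mulrCA ler_piMr ?(ltW e4)// ler_pdivrMr// mul1r lerDl.
apply: (@le_trans _ _ (limn_esup (fun N => (N%:R^-1)%:E * lne (gamma_Delta n mu Xi N m d)%:E)%E)).
  by apply: ereal_inf_lbound; exists (m, d).
apply: limn_esup_le_near.
have := psym_upper r n mu Xi r0 mu_box hXi h _ ch e4.
rewrite (_ : (fun x => _) = (fun x => expR (h x))); last first.
  by apply/funext => x; rewrite -[in RHS](polyapprox_clampT r n r0 h hh).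
rewrite -/L; apply: filterS2 (nbhs_infty_gt 0) => N N0.
have N0R : (0 : R) < N%:R by rewrite ltr0n.
rewrite psym_termE ler_pdivrMl// => hN.
have hT t : t \in Delta_sym n mu Xi N m d -> I - 3 * (e / 4) <= kappa N (fun j => h (sample N t j)).
  move=> ht; have h1 := le_trans (Delta_sym_peval N m d t p N0 d0 hm ht) cd.
  have h2 : `|kappa N (fun j => h (sample N t j)) - kappa N (fun j => peval X p (sample N t j))| <= e / 4.
    by apply: kappa_dist => [|j]; [exact: ltW|exact: hp].
  have h3 := Rint_dist mu _ _ _ bh bp hp; rewrite -/I in h3.
  move: h1 h2 h3; rewrite !ler_norml => /andP[? ?] /andP[? ?] /andP[? ?].
  by clear hN hh bh ch cd happ hp bp hm; lra.
have hA := avg_exp_ge h N _ _ N0 hT.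
(* If [Delta_sym] is empty, the logarithm is -oo and the bound is trivial. *)
have [g0|g0] := leP (gamma_Delta n mu Xi N m d) 0.
  by rewrite /lne g0 gt0_muleNy ?leNye// lte_fin invr_gt0.
rewrite (lne_EFin g0) -EFinM -EFinD lee_fin ler_pdivrMl//.
have : ln (gamma_Delta n mu Xi N m d * expR (N%:R * (I - 3 * (e / 4)))) <= ln (avg_exp n Xi h N).
  by rewrite ler_ln ?posrE ?avg_exp_gt0// mulr_gt0 ?expR_gt0.
rewrite lnM ?posrE ?expR_gt0// expRK => h1.
have := le_trans h1 hN; clear; lra.
Qed.

Lemma calIsym_ge (h : n.-tuple R -> R) : polyapprox X h ->
  ((\int[mu]_x h x - ln (\int[Q]_x expR (h x)))%:E <= calIsym r n mu Xi)%E.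
Proof.
move=> hh; have ch := polyapprox_cont_box r n h hh.
apply: (@le_trans _ _ (\int[mu]_(x in box r n) (h x)%:E - Psym n Xi h)%E); last first.
  by apply: ereal_sup_ubound; exists h.
rewrite (integral_box r n mu Xi r0 mu_box hXi)// (polyapprox_clampT r n r0 h hh) EFinB leeB//.
have := Psym_le r n mu Xi r0 mu_box hXi h ch.
rewrite (_ : (fun x => expR (h (clampT x))) = (fun x => expR (h x)))//.
by apply/funext => x; rewrite -[in RHS](polyapprox_clampT r n r0 h hh).
Qed.

Lemma margq_box : Q (box r n) = 1%E.
Proof.
rewrite /margq /= (_ : box r n = [set x | forall i, `[- r, r]%classic (tnth x i)]); last first.
  by apply/seteqP; split => x h i; have := h i; rewrite /= in_itv.
rewrite (margprod_rect n mu (fun=> `[- r, r]%classic))// big1// => i _.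
have mI : measurable `[- r, r]%classic by [].
have := probability_setC (margp n mu i) (measurableC mI); rewrite setCK => h.
by apply: etrans h _; rewrite [X in (1 - X)%E](_ : _ = 0%E) ?sube0//; exact: (marg_boxC r n mu mu_box i).
Qed.

(** Applied with [calIsym] and [Isym] as [V]: it closes both equalities at once. *)
Lemma relent_le_sup (V : \bar R) :
  (forall h, polyapprox X h ->
    ((\int[mu]_x h x - ln (\int[Q]_x expR (h x)))%:E <= V)%E) -> (S <= V)%E.
Proof.
move=> hV; have bX := coordX_bounded r n r0.
apply: (donsker_varadhan_le mu Q (polyapprox X) _ _ _ _ _ V hV _ (margq_integral n mu)).
- by move=> h; exact: polyapprox_bounded.
- by move=> c; exact: polyapprox_cst.
- by move=> f g; exact: polyapproxD.
- by move=> c f; exact: polyapproxZ.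
move=> B e mB e0.
(* A Boolean family, so that a single approximant is good for [mu] and for Q. *)
pose P (b : bool) : probability (n.-tuple R) R := if b then mu else Q.
have Pb b : P b (box r n) = 1%E by case: b => //; exact: margq_box.
have [_ /(_ e e0)[g [hg g01 ie]]] := approximable_measurable r n r0 P B Pb mB.
by exists g; split => //; [exact: (ie true)|exact: (ie false)].
Qed.

Lemma calIsymE : calIsym r n mu Xi = S.
Proof. by apply/eqP; rewrite eq_le calIsym_le relent_le_sup//; exact: calIsym_ge. Qed.

Lemma IsymE : Isym n mu Xi = S.
Proof. by apply/eqP; rewrite eq_le Isym_le relent_le_sup//; exact: Isym_ge. Qed.

Lemma relent_eq0P : S = 0%E <->
  (forall A, measurable A -> mu A = prodmargT n mu (fun x => (\1_A x)%:E)).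
Proof.
have E A : measurable A -> prodmargT n mu (fun x => (\1_A x)%:E) = Q A.
  move=> mA; rewrite margq_integral//; last exact/measurable_EFinP/measurable_indic.
  by rewrite integral_indic// setIT.
split => [S0 A mA|muQ].
  by rewrite E//; exact: (relent_eq0 mu Q _ (margq_integral n mu)).
rewrite (relentE (margprod n mu) mu _ (prodmargT_integral n mu) (fun=> 1)).
  by rewrite integral0_eq// => x _; rewrite ln1.
split => // A mA; apply: etrans (muQ A mA) _; congr prodmargT.
by apply/funext => x; rewrite mulr1.
Qed.

End Variational.

Theorem theorem3p5 (R : realType) (r : R) (n : nat)
  (mu : probability (n.-tuple R) R)
  (Xi : forall N : nat, 'I_n -> 'I_N -> R) :
  0 < r -> mu (box r n) = 1%E -> approx_seq r n mu Xi ->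
  (entropy _ _ (lebT n) mu
     = - calIsym r n mu Xi + \sum_(i < n) entropy _ _ leb1 (marg n mu i))%E
  /\ ((forall i : 'I_n, -oo < entropy _ _ leb1 (marg n mu i))%E ->
      [/\ calIsym r n mu Xi = Isym n mu Xi,
          Isym n mu Xi = relent _ _ (prodmargT n mu) mu
        & calIsym r n mu Xi = 0%E <->
          (forall A, measurable A ->
             mu A = prodmargT n mu (fun x => (\1_A x)%:E))]).
Proof.
move=> r0 mu_box hXi; rewrite (calIsymE r n mu Xi r0 mu_box hXi).
split=> [|_]; first exact: entropy_identity mu_box.
rewrite (IsymE r n mu Xi r0 mu_box hXi); split=> //; exact: relent_eq0P.
Qed.
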